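(* Let $n\ge1$, suppose the scale factor $a$ satisfies Assumption $H_3$ or Assumption $H_4$, and let $\varepsilon>0$ be sufficiently small. Consider the Cauchy problem $$\begin{cases}\dfrac{\partial}{\partial t}\Big(\dfrac{a(t)\rho}{c^2-|v|^2}\Big)+\displaystyle\sum_{i=1}^n\frac{\partial}{\partial x^i}\Big(\frac{\rho v^i}{c^2-|v|^2}\Big)+\Big(\frac{n\dot a(t)\rho}{c^2-|v|^2}-\frac{\dot a(t)\rho}{c^2}\Big)=0,\\[2mm] \dfrac{\partial}{\partial t}\Big(\dfrac{a(t)\rho v^i}{c^2-|v|^2}\Big)+\displaystyle\sum_{j=1}^n\frac{\partial}{\partial x^j}\Big(\frac{\rho v^iv^j}{c^2-|v|^2}\Big)+\frac{n\dot a(t)\rho v^i}{c^2-|v|^2}=0,\quad i=1,\dots,n,\end{cases}$$ with spherically symmetric initial data $$\rho(0,x)=\varepsilon\rho_0(r),\qquad v^i(0,x)=\varepsilon\,\mathbf v_0(r)\frac{x^i}{r},\qquad r=|x|,$$ where $\rho_0>0$, and its spherically symmetric solution $\rho=\rho(t,r)$, $v^i=\mathbf v(t,r)\frac{x^i}{r}$. If $\mathbf v_0'(\alpha)\ge0$ for all $\alpha$, then $(\rho,\mathbf v)\in C^1([0,+\infty)\times\mathbb R^+)$. On the other hand, if there exists an $\alpha$ such that $\mathbf v_0'(\alpha)<0$, then the density $\rho$ and the gradient of the velocity $\mathbf v$ blow up simultaneously (i.e. at the same finite time).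
   Context: $c>0$ is a constant and $|v|^2=\sum_i(v^i)^2$. The initial density profile and initial velocity profile, regarded as functions $\rho_0(|x|)$ and $\mathbf v_0(|x|)\frac{x}{|x|}$ on $\mathbb R^n$, are in $C^1(\mathbb R^n)$ with bounded $C^1$ norm and in $C^2(\mathbb R^n;\mathbb R^n)$ with bounded $C^2$ norm, respectively. $\mathbb R^+$ is the range of the radial variable $r$. The scale factor $a:[0,\infty)\to(0,\infty)$ is twice differentiable with $a(0)=1$; dots denote $d/dt$. Assumptions (for all $t\ge0$): - $H_3$: $\dot a(t)>0$, $\ddot a(t)<0$, and there is a constant $0<l\le\frac12$ with $a(t)\sim(1+t)^l$ (i.e. $C^{-1}(1+t)^l\le a(t)\le C(1+t)^l$ for some constant $C>0$). - $H_4$: $a(t)\equiv1$. *)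

(* Defs.v *)
From HB Require Import structures.
From mathcomp Require Export all_boot all_order all_algebra.
From mathcomp Require Export all_classical all_reals all_analysis.
Export numFieldNormedType.Exports.
Export Order.TTheory GRing.Theory Num.Theory.

Set Implicit Arguments.
Unset Strict Implicit.
Unset Printing Implicit Defensive.

Local Open Scope classical_set_scope.
Local Open Scope ring_scope.

Section Definitions.
Context {R : realType}.

(** The library norm of ['rV[R]_n] is the sup norm. *)
Definition enorm (n : nat) (x : 'rV[R]_n) : R :=
  Num.sqrt (\sum_(i < n) x 0 i ^+ 2).

Definition radial_scalar (n : nat) (f : R -> R) (x : 'rV[R]_n) : R :=
  f (enorm x).

(** [f(|x|) x / |x|]; since [0 / 0 = 0] its value at [x = 0] is [0], which is
    the only value a continuous field of this form can take there. *)
Definition radial_vector (n : nat) (f : R -> R) (i : 'I_n) (x : 'rV[R]_n) : R :=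
  f (enorm x) * (x 0 i / enorm x).

(** [f] is [C^k] on [R^n] with bounded [C^k] norm: all iterated partial
    derivatives up to order [k] exist and are continuous and bounded. *)
Fixpoint bounded_Ck (n k : nat) (f : 'rV[R]_n -> R) : Prop :=
  [/\ continuous f, exists M : R, forall x, `|f x| <= M &
      if k is k'.+1 then
        forall i : 'I_n, (forall x, derivable f x 'e_i) /\
                         bounded_Ck k' (fun x => 'D_'e_i f x)
      else True].

(** [l] is the derivative at [t] of the restriction of [f] to [A]. *)
Definition has_deriv_within (A : set R) (f : R -> R) (t l : R) : Prop :=
  (f s - f t) / (s - t) @[s --> within A t^'] --> l.

(** [a'] and [a''] are the first two derivatives of [a], one-sided at [0]. *)
Definition scale_factor (a a' a'' : R -> R) : Prop :=
  [/\ forall t, 0 <= t -> 0 < a t, a 0 = 1,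
      forall t, 0 <= t -> has_deriv_within `[0, +oo[ a t (a' t) &
      forall t, 0 <= t -> has_deriv_within `[0, +oo[ a' t (a'' t)].

Definition assumption_H3 (a a' a'' : R -> R) : Prop :=
  (forall t, 0 <= t -> 0 < a' t /\ a'' t < 0) /\
  exists l : R, [/\ 0 < l, l <= 2^-1 &
    exists2 C : R, 0 < C &
      forall t, 0 <= t ->
        C^-1 * (1 + t) `^ l <= a t /\ a t <= C * (1 + t) `^ l].

Definition assumption_H4 (a : R -> R) : Prop := forall t, 0 <= t -> a t = 1.

(** Regions of the [(t, r)] plane. *)
Definition quadrant : set (R * R) := [set p | 0 <= p.1 /\ 0 <= p.2].

Definition strip (T : R) : set (R * R) := [set p | 0 <= p.1 < T /\ 0 <= p.2].

(** [f = f(t, r)] is [C^1] on [D], with partial derivatives [ft] and [fr],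
    differentiability being relative to [D].  When [D] is relatively open in
    the quadrant, [ft] and [fr] are determined by [f] on [D]. *)
Definition C1_with (D : set (R * R)) (f ft fr : R -> R -> R) : Prop :=
  [/\ {within D, continuous (fun p : R * R => ft p.1 p.2)},
      {within D, continuous (fun p : R * R => fr p.1 p.2)} &
      forall p : R * R, D p -> forall e : R, 0 < e ->
        \forall q \near within D (nbhs p),
          `|f q.1 q.2 - f p.1 p.2
            - (ft p.1 p.2 * (q.1 - p.1) + fr p.1 p.2 * (q.2 - p.2))|
          <= e * `|q - p| ].

Definition C1_on (D : set (R * R)) (f : R -> R -> R) : Prop :=
  exists ft fr, C1_with D f ft fr.

(** [rho / (c^2 - |v|^2)] as a function on [R^n]. *)
Definition density_term (n : nat) (c : R) (rho v : R -> R -> R) (t : R)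
    (x : 'rV[R]_n) : R :=
  radial_scalar (rho t) x
  / (c ^+ 2 - \sum_(i < n) radial_vector (v t) i x ^+ 2).

Definition mass_equation (n : nat) (c : R) (a a' : R -> R)
    (rho v : R -> R -> R) (t : R) (x : 'rV[R]_n) : Prop :=
  let m := @density_term n c rho v in
  let V s := @radial_vector n (v s) in
  derive1 (fun s => a s * m s x) t
  + \sum_(i < n) 'D_'e_i (fun y => m t y * V t i y) x
  + (n%:R * a' t * m t x - a' t * radial_scalar (rho t) x / c ^+ 2) = 0.

Definition momentum_equation (n : nat) (c : R) (a a' : R -> R)
    (rho v : R -> R -> R) (i : 'I_n) (t : R) (x : 'rV[R]_n) : Prop :=
  let m := @density_term n c rho v in
  let V s := @radial_vector n (v s) in
  derive1 (fun s => a s * m s x * V s i x) t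
  + \sum_(j < n) 'D_'e_j (fun y => m t y * V t i y * V t j y) x
  + n%:R * a' t * m t x * V t i x = 0.

(** Spherically symmetric classical solution of the Cauchy problem on the set
    of [(t, x)] such that [(t, |x|)] lies in [D].  The equations are required
    at positive times only, where two-sided time derivatives make sense; they
    extend to [t = 0] by the [C^1] regularity up to the boundary.  Existence
    of the space derivatives is automatic away from [x = 0]; at [x = 0] it
    says that the fields are differentiable across the origin. *)
Record classical_solution (n : nat) (c : R) (a a' rho0 v0 : R -> R) (eps : R)
    (D : set (R * R)) (rho v : R -> R -> R) : Prop := {
  sol_rho_C1 : C1_on D rho;
  sol_v_C1 : C1_on D v;
  sol_subluminal : forall t r, D (t, r) -> `|v t r| < c;
  sol_rho_derivable : forall (t : R) (x : 'rV[R]_n), D (t, enorm x) ->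
    forall j, derivable (radial_scalar (rho t)) x 'e_j;
  sol_v_derivable : forall (t : R) (x : 'rV[R]_n), D (t, enorm x) ->
    forall i j, derivable (radial_vector (v t) i) x 'e_j;
  sol_mass : forall (t : R) (x : 'rV[R]_n), 0 < t -> D (t, enorm x) ->
    mass_equation c a a' rho v t x;
  sol_momentum : forall (t : R) (x : 'rV[R]_n), 0 < t -> D (t, enorm x) ->
    forall i, momentum_equation c a a' rho v i t x;
  sol_rho_init : forall x : 'rV[R]_n,
    radial_scalar (rho 0) x = eps * radial_scalar rho0 x;
  sol_v_init : forall (x : 'rV[R]_n) i,
    radial_vector (v 0) i x = eps * radial_vector v0 i x }.

Definition unique_classical_solution (n : nat) (c : R)
    (a a' rho0 v0 : R -> R) (eps : R) (D : set (R * R)) : Prop :=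
  exists rho v : R -> R -> R,
    classical_solution n c a a' rho0 v0 eps D rho v /\
    forall rho1 v1, classical_solution n c a a' rho0 v0 eps D rho1 v1 ->
      forall t r, D (t, r) -> rho1 t r = rho t r /\ v1 t r = v t r.

(** [g] is the radial coordinate of a fluid particle (a characteristic of the
    system) that stays in [D] during the time interval [I]. *)
Definition trajectory (a : R -> R) (v : R -> R -> R) (D : set (R * R))
    (I : set R) (g : R -> R) : Prop :=
  forall t, I t -> D (t, g t) /\ has_deriv_within I g t (v t (g t) / a t).

(** Domains on which the solution is determined by the initial data: relatively
    open regions containing the initial line, each of whose points is reached
    from the initial line by a trajectory inside the region.  Unlike a strip,
    such a region need not end at the same time for all particles. *)
Definition development (n : nat) (c : R) (a a' rho0 v0 : R -> R) (eps : R)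
    (D : set (R * R)) (rho v : R -> R -> R) : Prop :=
  [/\ exists2 U : set (R * R), open U & D = quadrant `&` U,
      forall r, 0 <= r -> D (0, r),
      classical_solution n c a a' rho0 v0 eps D rho v &
      forall t r, D (t, r) ->
        exists g, trajectory a v D `[0, t] g /\ g t = r].

(** Times [T > 0] for which there is a fluid particle whose density
    [p = rho(s, g s)] and velocity gradient [q = (d_r v)(s, g s)] satisfy
    [P p q T], the solution being [C^1] around the particle up to time [T]. *)
Definition blowup_times (n : nat) (c : R) (a a' rho0 v0 : R -> R) (eps : R)
    (P : (R -> R) -> (R -> R) -> R -> Prop) : set R :=
  [set T | 0 < T /\
    exists D rho v vt vr g,
      [/\ development n c a a' rho0 v0 eps D rho v,
          C1_with D v vt vr,
          trajectory a v D `[0, T[ g &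
          P (fun s => rho s (g s)) (fun s => vr s (g s)) T]].

Definition density_blowup (p q : R -> R) (T : R) : Prop :=
  p s @[s --> T^'-] --> +oo.

Definition gradient_blowup (p q : R -> R) (T : R) : Prop :=
  `|q s| @[s --> T^'-] --> +oo.

Definition joint_blowup (p q : R -> R) (T : R) : Prop :=
  density_blowup p q T /\ gradient_blowup p q T.

(** [T] is the blow-up time of the type described by [P].  It is an infimum,
    because the profiles live on an unbounded domain and need not attain their
    infima. *)
Definition is_blowup_time (n : nat) (c : R) (a a' rho0 v0 : R -> R) (eps : R)
    (P : (R -> R) -> (R -> R) -> R -> Prop) (T : R) : Prop :=
  has_inf (blowup_times n c a a' rho0 v0 eps P) /\
  inf (blowup_times n c a a' rho0 v0 eps P) = T.

End Definitions.

(* Main.v *)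
Require Import Defs.
From mathcomp Require Import ring lra.

(** Subtracting [v] times the mass equation from the momentum equation leaves,
    where the density is positive,
      [a v_t + v v_r + a' v (1 - v^2 / c^2) = 0],
    an equation for the velocity alone. Along a particle path [dr/dt = v / a] it
    says that the momentum [v / sqrt (1 - v^2 / c^2)] decays like [1 / a]. The
    whole motion is therefore explicit. The particle that starts at radius [s]
    with momentum [w(s)] has at time [t] the velocity and the radius
      [vel = w(s) / gam],  [path = s + w(s) * int_0^t dx / (a gam)],
    where [gam = sqrt (a^2 + w(s)^2 / c^2)], and the flow stretches radial
    distances by
      [stretch = d path / ds = 1 + w'(s) * squeeze],
      [squeeze = int_0^t a / gam^3 dx].
    Along each path the mass equation is a linear ordinary differential equation,
    solved by an explicit density [rhol] that contains [1 / stretch]; the radial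
    derivative of the velocity is [vels / stretch].

    The sign of [w'] is that of the derivative of the initial velocity. If it is
    nonnegative, [stretch >= 1] at all times, the flow is a bijection of the
    half-line at each time, with continuously differentiable inverse ([C1_lab]),
    and the explicit fields solve the system on the whole quadrant
    ([explicit_solution]). If [w'(s) < 0] for some [s], the slow expansion
    decides: the rate of [squeeze] is at least a constant times [1 / a^2], which
    for [a^2 <= C (1 + t)] is not integrable, so [squeeze] is unbounded
    ([squeeze_unbounded]) and [stretch] vanishes in finite time. The blow-up time
    [T] is the infimum of the times at which the stretch of some label is not
    positive; it is positive because [w'] is bounded.

    The labels range over an unbounded interval, so no particle need collapse at
    the time [T] itself. Restricting the labels to a suitable bounded interval
    gives, arbitrarily close to [T], a first collapse that is attained
    ([first_collapse]); along the collapsing particle the density and the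
    gradient of the velocity both tend to infinity ([density_collapse],
    [gradient_collapse]). Conversely nothing blows up before [T]
    ([blowup_after]), because every solution is the explicit one there.

    That last statement is uniqueness, and it rests on [transport]: along an
    explicit path, or along a trajectory of an arbitrary solution, the difference
    between the velocity of the solution and the explicit velocity solves a
    linear equation as long as the density is positive, and the density solves a
    linear equation as long as this difference is zero; hence both properties
    persist from the initial time. A trajectory cannot leave the centre
    ([trajectory_gt0]), so the argument applies off the centre, where the
    equations have their polar form. The system itself is verified at the origin by means of
    the parity of the profiles: the velocity extends to an odd function of the
    label and the density to an even one. *)

Set Implicit Arguments.
Unset Strict Implicit.
Unset Printing Implicit Defensive.

Local Open Scope classical_set_scope.
Local Open Scope ring_scope.

(** * Differentiability relative to a region of the plane *)

Lemma cvg_into {T : Type} {U : topologicalType} (F : set_system T) {FF : Filter F}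
  (D : set U) (f : T -> U) (l : U) :
  f @ F --> l -> (\forall x \near F, D (f x)) -> f @ F --> within D (nbhs l).
Proof.
move=> fl fD P; rewrite /within/= => DP.
have := fl _ DP; rewrite /= !nbhs_simpl/= => h.
by apply: filterS2 h fD => x; exact.
Qed.

Section Caratheodory.
Context {R : realType}.
Implicit Types (D : set (R * R)) (f g : R -> R -> R) (F : set_system (R * R)).

Definition cont2 D f := forall p, D p ->
  f q.1 q.2 @[q --> within D (nbhs p)] --> f p.1 p.2.

(** Carathéodory's form of differentiability: the increment of [f] is exactly
    a linear combination of the increments of the two coordinates, with
    coefficients that converge along [F]. Derivative rules then become
    algebraic identities between coefficients. *)
Definition slopes F f (p : R * R) (x y : R) : Prop :=
  exists A B : R * R -> R, [/\ A @ F --> x, B @ F --> y &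
    \forall q \near F, f q.1 q.2 - f p.1 p.2 =
      A q * (q.1 - p.1) + B q * (q.2 - p.2)].

Lemma cont2P D f : {within D, continuous (fun p : R * R => f p.1 p.2)} <->
  cont2 D f.
Proof. exact: subspace_continuousP. Qed.

Lemma norm_pairE (q : R * R) : `|q| = Num.max `|q.1| `|q.2|.
Proof. by []. Qed.

(** The remainder can be charged to the coordinate whose increment is the
    larger: divided by that increment it is as small as the remainder divided
    by the sup norm. *)
Lemma slopesP D f p x y : D p ->
  (forall e : R, 0 < e -> \forall q \near within D (nbhs p),
     `|f q.1 q.2 - f p.1 p.2 - (x * (q.1 - p.1) + y * (q.2 - p.2))|
       <= e * `|q - p|) <->
  slopes (within D (nbhs p)) f p x y.
Proof.
move=> Dp; split=> [H|[A [B [Ax By AB]]] e e0].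
  pose er (q : R * R) :=
    f q.1 q.2 - f p.1 p.2 - (x * (q.1 - p.1) + y * (q.2 - p.2)).
  pose b (q : R * R) := `|q.2 - p.2| <= `|q.1 - p.1|.
  have small (q : R * R) e : 0 < e -> `|er q| <= e * `|q - p| ->
      (if b q then `|er q / (q.1 - p.1)| <= e else `|er q / (q.2 - p.2)| <= e).
    move=> e0; rewrite norm_pairE/= !normrM !normfV /b.
    case: ifPn => [le|]; last rewrite -ltNge => lt.
      rewrite max_l//; have [->|n0] := eqVneq `|q.1 - p.1| 0.
        by rewrite invr0 !mulr0 => _; exact: ltW.
      by rewrite ler_pdivrMr// lt0r n0/=.
    rewrite max_r ?(ltW lt)// ler_pdivrMr//.
    by rewrite (le_lt_trans _ lt).
  exists (fun q => x + (if b q then er q / (q.1 - p.1) else 0)),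
         (fun q => y + (if b q then 0 else er q / (q.2 - p.2))).
  split.
  - apply/cvgrPdist_le => e e0; near=> q.
    rewrite opprD addNKr normrN.
    have /(small _ _ e0) : `|er q| <= e * `|q - p| by near: q; exact: H.
    by case: ifP => // _ _; rewrite normr0 ltW.
  - apply/cvgrPdist_le => e e0; near=> q.
    rewrite opprD addNKr normrN.
    have /(small _ _ e0) : `|er q| <= e * `|q - p| by near: q; exact: H.
    by case: ifP => // _ _; rewrite normr0 ltW.
  - near=> q.
    have E : `|er q| <= 1 * `|q - p| by near: q; exact: H.
    have -> : f q.1 q.2 - f p.1 p.2 =
      x * (q.1 - p.1) + y * (q.2 - p.2) + er q by rewrite /er; ring.
    have [d0|d0] := eqVneq `|q - p| 0.
      move: E; rewrite d0 mulr0 normr_le0 => /eqP ->.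
      by rewrite !mul0r; case: ifP; rewrite !addr0.
    rewrite /b in small *; case: ifPn => [le|].
      have n0 : q.1 - p.1 != 0.
        apply: contra_neq d0 => d1; move: le; rewrite norm_pairE/= d1 normr0.
        by rewrite normr_le0 => /eqP ->; rewrite normr0 maxxx.
      by field.
    rewrite -ltNge => lt.
    have n0 : q.2 - p.2 != 0.
      by rewrite -normr_gt0 (le_lt_trans _ lt).
    by field.
near=> q.
have -> : f q.1 q.2 - f p.1 p.2 = A q * (q.1 - p.1) + B q * (q.2 - p.2).
  by near: q.
have -> : A q * (q.1 - p.1) + B q * (q.2 - p.2) -
  (x * (q.1 - p.1) + y * (q.2 - p.2)) =
  - ((x - A q) * (q.1 - p.1)) - (y - B q) * (q.2 - p.2) by ring.
rewrite (le_trans (ler_normB _ _))// normrN !normrM norm_pairE/=.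
have h1 : `|x - A q| <= e / 2.
  by near: q; move/cvgrPdist_le : Ax; apply; rewrite divr_gt0.
have h2 : `|y - B q| <= e / 2.
  by near: q; move/cvgrPdist_le : By; apply; rewrite divr_gt0.
rewrite (splitr e) mulrDl lerD// ler_pM//; first by rewrite le_max lexx.
by rewrite le_max lexx orbT.
Unshelve. all: by end_near. Qed.

Lemma C1_withP D f ft fr : C1_with D f ft fr <->
  [/\ cont2 D ft, cont2 D fr & forall p, D p ->
      slopes (within D (nbhs p)) f p (ft p.1 p.2) (fr p.1 p.2)].
Proof.
split=> -[ct cr H]; split.
- exact: (cont2P D ft).1 ct.
- exact: (cont2P D fr).1 cr.
- by move=> p Dp; apply/slopesP => //; exact: H.
- exact: (cont2P D ft).2 ct.
- exact: (cont2P D fr).2 cr.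
- by move=> p Dp; apply/slopesP => //; exact: H.
Qed.

Lemma slopes_cvg F {FF : Filter F} f p x y :
  fst @ F --> p.1 -> snd @ F --> p.2 ->
  slopes F f p x y -> f q.1 q.2 @[q --> F] --> f p.1 p.2.
Proof.
move=> F1 F2 [A [B [Ax By AB]]].
have : f p.1 p.2 + (A q * (q.1 - p.1) + B q * (q.2 - p.2)) @[q --> F] -->
   f p.1 p.2 + (x * (p.1 - p.1) + y * (p.2 - p.2)).
  apply: cvgD; first exact: cvg_cst.
  by apply: cvgD; apply: cvgM => //; apply: cvgB => //; exact: cvg_cst.
rewrite !subrr !mulr0 !addr0; apply: cvg_trans; apply: near_eq_cvg.
by apply: filterS AB => q <-; rewrite addrC subrK.
Qed.

Lemma cvg_fst_within D (p : R * R) : fst @ within D (nbhs p) --> p.1.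
Proof.
by apply: cvg_within_filter; exact: cvg_fst.
Qed.

Lemma cvg_snd_within D (p : R * R) : snd @ within D (nbhs p) --> p.2.
Proof.
by apply: cvg_within_filter; exact: cvg_snd.
Qed.

Lemma C1_cont D f ft fr : C1_with D f ft fr -> cont2 D f.
Proof.
move=> /C1_withP[_ _ H] p Dp.
apply: slopes_cvg (H _ Dp); [exact: cvg_fst_within|exact: cvg_snd_within].
Qed.

Lemma C1_ext D f ft fr f' ft' fr' : C1_with D f ft fr ->
  (forall t r, D (t, r) -> [/\ f t r = f' t r, ft t r = ft' t r & fr t r = fr' t r]) ->
  C1_with D f' ft' fr'.
Proof.
move=> /C1_withP[ct cr H] E; apply/C1_withP.
have near_eq (u v : R -> R -> R) (p : R * R) : D p ->
    (forall t r, D (t, r) -> u t r = v t r) ->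
    u q.1 q.2 @[q --> within D (nbhs p)] --> u p.1 p.2 ->
    v q.1 q.2 @[q --> within D (nbhs p)] --> v p.1 p.2.
  move=> Dp uv; rewrite (uv p.1 p.2); last by rewrite -surjective_pairing.
  apply: cvg_trans; apply: near_eq_cvg.
  near=> q; have Dq : D q by near: q; exact: withinT.
  by apply: uv; rewrite -surjective_pairing.
split.
- move=> p Dp; apply: (near_eq ft) => //; last exact: ct.
  by move=> t r /E[].
- move=> p Dp; apply: (near_eq fr) => //; last exact: cr.
  by move=> t r /E[].
move=> p Dp; have [A [B [Ax By AB]]] := H _ Dp; exists A, B.
have [Ep1 Ep2 Ep3] : [/\ f p.1 p.2 = f' p.1 p.2, ft p.1 p.2 = ft' p.1 p.2 &
   fr p.1 p.2 = fr' p.1 p.2] by apply: E; rewrite -surjective_pairing.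
rewrite -Ep2 -Ep3; split => //.
near=> q.
have Dq : D q by near: q; exact: withinT.
have [<- _ _] : [/\ f q.1 q.2 = f' q.1 q.2, ft q.1 q.2 = ft' q.1 q.2 &
   fr q.1 q.2 = fr' q.1 q.2] by apply: E; rewrite -surjective_pairing.
by rewrite -Ep1; near: q.
Unshelve. all: by end_near. Qed.

Lemma C1_sub D D' f ft fr : D' `<=` D -> C1_with D f ft fr ->
  C1_with D' f ft fr.
Proof.
move=> D'D [ct cr H]; split.
- exact: continuous_subspaceW ct.
- exact: continuous_subspaceW cr.
- move=> p /D'D Dp e e0; have := H p Dp e e0.
  by rewrite !near_withinE; apply: filterS => q h /D'D /h.
Qed.

Lemma C1_cst D (k : R) : C1_with D (fun _ _ => k) (fun _ _ => 0) (fun _ _ => 0).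
Proof.
apply/C1_withP; split; [by move=> p _; exact: cvg_cst..|move=> p Dp].
exists (cst 0), (cst 0); split; [exact: cvg_cst..|].
by near=> q => /=; rewrite !mul0r addr0 subrr.
Unshelve. all: by end_near. Qed.

Lemma C1_snd D : C1_with D (fun _ r => r) (fun _ _ => 0) (fun _ _ => 1).
Proof.
apply/C1_withP; split; [by move=> p _; exact: cvg_cst..|move=> p Dp].
exists (cst 0), (cst 1); split; [exact: cvg_cst..|].
by near=> q => /=; rewrite mul0r add0r mul1r.
Unshelve. all: by end_near. Qed.

Lemma C1_add D f ft fr g gt gr : C1_with D f ft fr -> C1_with D g gt gr ->
  C1_with D (fun t r => f t r + g t r) (fun t r => ft t r + gt t r)
    (fun t r => fr t r + gr t r).
Proof.
move=> /C1_withP[cft cfr Hf] /C1_withP[cgt cgr Hg]; apply/C1_withP; split.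
- by move=> p Dp; apply: cvgD; [exact: cft|exact: cgt].
- by move=> p Dp; apply: cvgD; [exact: cfr|exact: cgr].
move=> p Dp; have [A [B [Ax By AB]]] := Hf _ Dp.
have [A' [B' [A'x B'y AB']]] := Hg _ Dp.
exists (fun q => A q + A' q), (fun q => B q + B' q).
split; [exact: cvgD|exact: cvgD|].
apply: filterS2 AB AB' => q h1 h2.
by rewrite opprD addrACA h1 h2; ring.
Qed.

Lemma C1_mul D f ft fr g gt gr : C1_with D f ft fr -> C1_with D g gt gr ->
  C1_with D (fun t r => f t r * g t r)
    (fun t r => ft t r * g t r + f t r * gt t r)
    (fun t r => fr t r * g t r + f t r * gr t r).
Proof.
move=> Cf Cg; have cf := C1_cont Cf; have cg := C1_cont Cg.
move: Cf Cg => /C1_withP[cft cfr Hf] /C1_withP[cgt cgr Hg]; apply/C1_withP; split.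
- move=> p Dp; apply: cvgD; apply: cvgM;
  [exact: cft|exact: cg|exact: cf|exact: cgt].
- move=> p Dp; apply: cvgD; apply: cvgM;
  [exact: cfr|exact: cg|exact: cf|exact: cgr].
move=> p Dp; have [A [B [Ax By AB]]] := Hf _ Dp.
have [A' [B' [A'x B'y AB']]] := Hg _ Dp.
exists (fun q => A q * g p.1 p.2 + f q.1 q.2 * A' q),
  (fun q => B q * g p.1 p.2 + f q.1 q.2 * B' q).
split.
- apply: cvgD; apply: cvgM => //; [exact: cvg_cst|exact: cf].
- apply: cvgD; apply: cvgM => //; [exact: cvg_cst|exact: cf].
apply: filterS2 AB AB' => q h1 h2.
have -> : f q.1 q.2 * g q.1 q.2 - f p.1 p.2 * g p.1 p.2 =
  (f q.1 q.2 - f p.1 p.2) * g p.1 p.2 + f q.1 q.2 * (g q.1 q.2 - g p.1 p.2).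
  by ring.
by rewrite h1 h2; ring.
Qed.

Lemma cvg_graph D (H : set (R * R)) (g : R -> R -> R) p : cont2 D g ->
  (forall t r, D (t, r) -> H (t, g t r)) -> D p ->
  (fun q : R * R => (q.1, g q.1 q.2)) @ within D (nbhs p) -->
    within H (nbhs (p.1, g p.1 p.2)).
Proof.
move=> cg DH Dp; apply: cvg_into.
  exact: (cvg_pair (@cvg_fst_within D p) (cg _ Dp)).
near=> q; apply: DH; rewrite -surjective_pairing.
by near: q; exact: withinT.
Unshelve. all: by end_near. Qed.

(** Only the second coordinate is substituted, at a fixed time: passing
    between the radius of a particle and its label has this form. *)
Lemma C1_comp (E D : set (R * R)) f ft fr g gt gr :
  C1_with E f ft fr -> C1_with D g gt gr ->
  (forall t r, D (t, r) -> E (t, g t r)) ->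
  C1_with D (fun t r => f t (g t r))
    (fun t r => ft t (g t r) + fr t (g t r) * gt t r)
    (fun t r => fr t (g t r) * gr t r).
Proof.
move=> Cf Cg DE; have cg := C1_cont Cg.
have toE p (Dp : D p) := cvg_graph cg DE Dp.
move: Cf Cg => /C1_withP[cft cfr Hf] /C1_withP[cgt cgr Hg]; apply/C1_withP.
have Ep p : D p -> E (p.1, g p.1 p.2).
  by move=> Dp; apply: DE; rewrite -surjective_pairing.
have cft' : cont2 D (fun t r => ft t (g t r)).
  by move=> p Dp; exact: (cvg_comp _ _ (toE p Dp) (cft _ (Ep p Dp))).
have cfr' : cont2 D (fun t r => fr t (g t r)).
  by move=> p Dp; exact: (cvg_comp _ _ (toE p Dp) (cfr _ (Ep p Dp))).
split.
- move=> p Dp; apply: cvgD; first exact: cft'.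
  by apply: cvgM; [exact: cfr'|exact: cgt].
- by move=> p Dp; apply: cvgM; [exact: cfr'|exact: cgr].
move=> p Dp; have [A [B [Ax By AB]]] := Hf _ (Ep _ Dp).
have [A' [B' [A'x B'y AB']]] := Hg _ Dp.
exists (fun q => A (q.1, g q.1 q.2) + B (q.1, g q.1 q.2) * A' q),
  (fun q => B (q.1, g q.1 q.2) * B' q).
have cA : A (q.1, g q.1 q.2) @[q --> within D (nbhs p)] --> ft p.1 (g p.1 p.2).
  exact: (cvg_comp _ _ (toE p Dp) Ax).
have cB : B (q.1, g q.1 q.2) @[q --> within D (nbhs p)] --> fr p.1 (g p.1 p.2).
  exact: (cvg_comp _ _ (toE p Dp) By).
split.
- by apply: cvgD => //; exact: cvgM.
- exact: cvgM.
have := toE p Dp _ AB; rewrite /= nbhs_simpl/= => {}AB.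
apply: filterS2 AB AB' => q/= h1 h2.
by rewrite h1 h2; ring.
Unshelve. all: by end_near. Qed.

End Caratheodory.

(** * Functions of one variable and curves *)

Section OneVariable.
Context {R : realType}.
Implicit Types (f g : R -> R) (A I : set R).

Lemma near_within_dnbhs A (t : R) (P : R -> Prop) :
  (\forall s \near within A t^', P s) <->
  (\forall s \near t, s != t -> A s -> P s).
Proof. by []. Qed.

Lemma near_within_nbhs A (t : R) (P : R -> Prop) :
  (\forall s \near within A (nbhs t), P s) <->
  (\forall s \near t, A s -> P s).
Proof. by []. Qed.

(** Carathéodory's form again, so that a curve can be composed with a [C^1]
    field by composing coefficients. *)
Lemma hdwP A f (t l : R) : has_deriv_within A f t l <->
  exists g, g @ within A (nbhs t) --> l /\
    \forall s \near within A (nbhs t), f s - f t = g s * (s - t).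
Proof.
split=> [H|[g [gl /near_within_nbhs fg]]].
  exists (fun s => if s == t then l else (f s - f t) / (s - t)); split.
    apply/cvgrPdist_le => e e0; move/cvgrPdist_le : H => /(_ _ e0).
    move=> /near_within_dnbhs H; apply/near_within_nbhs.
    near=> s => As; case: eqP => [_|/eqP st]; first by rewrite subrr normr0 ltW.
    by move: st As; near: s.
  apply: nearW => s; case: eqP => [->|/eqP st]; first by rewrite !subrr mulr0.
  by rewrite divfK// subr_eq0.
apply/cvgrPdist_le => e e0; move/cvgrPdist_le : gl => /(_ _ e0).
move=> /near_within_nbhs gl; apply/near_within_dnbhs.
near=> s => st As.
have -> : f s - f t = g s * (s - t) by move: As; near: s.
by rewrite mulfK ?subr_eq0//; move: As; near: s.
Unshelve. all: by end_near. Qed.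

Lemma hdw_sub A B f t l : B `<=` A -> has_deriv_within A f t l ->
  has_deriv_within B f t l.
Proof.
move=> BA; apply: cvg_trans => P /near_within_dnbhs H; apply/near_within_dnbhs.
by near=> s => st /BA; move: st; near: s.
Unshelve. all: by end_near. Qed.

Lemma hdw_cvg A f t l : has_deriv_within A f t l ->
  f @ within A (nbhs t) --> f t.
Proof.
move=> /hdwP[g [gl fg]].
have : f t + g s * (s - t) @[s --> within A (nbhs t)] --> f t + l * (t - t).
  apply: cvgD; first exact: cvg_cst.
  apply: cvgM => //; apply: cvgB; last exact: cvg_cst.
  by apply: cvg_within_filter; exact: cvg_id.
rewrite subrr mulr0 addr0; apply: cvg_trans; apply: near_eq_cvg.
by apply: filterS fg => s <-; rewrite addrC subrK.
Qed.

Lemma hdw_is_derive A f (t l : R) : nbhs t A -> has_deriv_within A f t l ->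
  is_derive t 1 f l.
Proof.
move=> At /hdwP[g []].
have -> : within A (nbhs t) = nbhs t.
  apply/seteqP; split => P; rewrite /within/= => H.
    by near=> s; have : A s by [near: s]; near: s.
  by apply: filterS H.
move=> gl fg; apply/is_derive1_caratheodory.
exists (fun s => if s == t then l else (f s - f t) / (s - t)); split.
- move=> z; case: eqP => [->|/eqP zt]; first by rewrite !subrr mulr0.
  by rewrite divfK// subr_eq0.
- apply/cvgrPdist_le => e e0; near=> s; rewrite eqxx.
  case: eqP => [_|/eqP st]; first by rewrite subrr normr0 ltW.
  have -> : f s - f t = g s * (s - t) by near: s.
  rewrite mulfK ?subr_eq0//.
  by near: s; move/cvgrPdist_le : gl; exact.
- by rewrite eqxx.
Unshelve. all: by end_near. Qed.

Lemma is_derive_hdw A f (t l : R) : is_derive t 1 f l -> has_deriv_within A f t l.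
Proof.
move=> /is_derive1_caratheodory[g [fg cg gt]]; apply/hdwP; exists g; split.
  by rewrite -gt; exact: cvg_within_filter.
exact: nearW.
Qed.

Lemma hdw_id A (t : R) : has_deriv_within A id t 1.
Proof. by apply: is_derive_hdw; exact: is_derive_id. Qed.

Lemma hdw_cst A (k t : R) : has_deriv_within A (fun=> k) t 0.
Proof. by apply: is_derive_hdw; exact: is_derive_cst. Qed.

Lemma hdw_curve (D : set (R * R)) F Ft Fr A f g (s f' g' : R) :
  C1_with D F Ft Fr -> A s -> (forall u, A u -> D (f u, g u)) ->
  has_deriv_within A f s f' -> has_deriv_within A g s g' ->
  has_deriv_within A (fun u => F (f u) (g u)) s
    (Ft (f s) (g s) * f' + Fr (f s) (g s) * g').
Proof.
move=> CF As AD hf hg.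
have cv : (fun u => (f u, g u)) @ within A (nbhs s) -->
    within D (nbhs (f s, g s)).
  apply: cvg_into; first exact: (cvg_pair (hdw_cvg hf) (hdw_cvg hg)).
  by near=> u; apply: AD; near: u; exact: withinT.
have [_ _ /(_ _ (AD _ As)) [B [C [Bl Cl BC]]]] := (C1_withP D F Ft Fr).1 CF.
have /hdwP[u [ul fu]] := hf; have /hdwP[v [vl gv]] := hg.
apply/hdwP; exists (fun x => B (f x, g x) * u x + C (f x, g x) * v x); split.
  apply: cvgD; apply: cvgM => //.
    exact: (cvg_comp _ _ cv Bl).
  exact: (cvg_comp _ _ cv Cl).
have := cv _ BC; rewrite /= nbhs_simpl/= => {}BC.
by apply: filterS3 fu gv BC => x/= h1 h2 ->; rewrite h1 h2; ring.
Unshelve. all: by end_near. Qed.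

Lemma cont_curve (D : set (R * R)) F A f g :
  cont2 D F -> (forall u, A u -> D (f u, g u)) ->
  {within A, continuous f} -> {within A, continuous g} ->
  {within A, continuous (fun u => F (f u) (g u))}.
Proof.
move=> CF AD /subspace_continuousP cf /subspace_continuousP cg.
apply/subspace_continuousP => s As.
have cv : (fun u => (f u, g u)) @ within A (nbhs s) -->
    within D (nbhs (f s, g s)).
  apply: cvg_into; first exact: (cvg_pair (cf _ As) (cg _ As)).
  by near=> u; apply: AD; near: u; exact: withinT.
exact: (cvg_comp _ _ cv (CF _ (AD _ As))).
Unshelve. all: by end_near. Qed.

Lemma C1_of_snd (I : set R) f f' :
  (forall y, I y -> is_derive y 1 f (f' y)) ->
  (forall y, I y -> {for y, continuous f'}) ->
  C1_with [set p : R * R | I p.2] (fun _ y => f y) (fun _ _ => 0) (fun _ y => f' y).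
Proof.
move=> df cf; apply/C1_withP; split; first by move=> p _; exact: cvg_cst.
  move=> p Ip; apply: (cvg_comp _ _ (@cvg_snd_within _ _ p)); exact: cf.
move=> p Ip; have /is_derive1_caratheodory[g [fg cg gt]] := df _ Ip.
exists (cst 0), (fun q => g q.2); split; first exact: cvg_cst.
  by rewrite -gt; apply: (cvg_comp _ _ (@cvg_snd_within _ _ p)); exact: cg.
by apply: nearW => q/=; rewrite fg mul0r add0r.
Qed.

Lemma C1_of_fst (I : set R) f f' :
  (forall t, I t -> has_deriv_within I f t (f' t)) ->
  {within I, continuous f'} ->
  C1_with [set p : R * R | I p.1] (fun t _ => f t) (fun t _ => f' t) (fun _ _ => 0).
Proof.
move=> df /subspace_continuousP cf; set D := [set p | _].
have cv (p : R * R) : fst @ within D (nbhs p) --> within I (nbhs p.1).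
  by apply: cvg_into; [exact: cvg_fst_within|exact: (withinT D (nbhs_filter p))].
apply/C1_withP; split; last 1 first.
- move=> p Ip; have /hdwP[g [gl fg]] := df _ Ip.
  exists (fun q => g q.1), (cst 0); split; last 1 first.
  + have := cv p _ fg; rewrite /= nbhs_simpl/=; apply: filterS => q/= ->.
    by rewrite mul0r addr0.
  + exact: (cvg_comp _ _ (cv p) gl).
  + exact: cvg_cst.
- by move=> p Ip; exact: (cvg_comp _ _ (cv p) (cf _ Ip)).
- by move=> p _; exact: cvg_cst.
Unshelve. all: by end_near. Qed.

(** The integral starts at [-1], which makes the derivative at the initial
    time [0] two-sided. *)
Lemma primitive_exists f : continuous f ->
  exists P : R -> R, P 0 = 0 /\ forall t : R, -1 < t -> is_derive t 1 P (f t).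
Proof.
move=> cf.
pose G (t : R) := (\int[lebesgue_measure]_(s in [set` Interval (BLeft (-1 : R)) (BRight t)]) f s)%R.
exists (fun t => G t - G 0); split; first by rewrite subrr.
move=> t t1.
have [|||dG eG] := @continuous_FTC1 R f (BLeft (-1)) t (t + 1) _ _ _ (cf t).
- by rewrite ltrDl.
- apply: continuous_compact_integrable; first exact: segment_compact.
  exact: continuous_subspaceT.
- by rewrite lte_fin.
have dG' : is_derive t 1 G (f t).
  by rewrite -eG derive1E; apply/derivableP.
have := is_deriveB dG' (is_derive_cst (G 0) t 1).
by rewrite subr0.
Qed.

(** Composition with [clamp T] extends a function continuous on [`[0, T]] to
    the whole line, where it has a primitive. *)
Definition clamp (T s : R) : R := Num.max 0 (Num.min s T).

Lemma clamp_id (T s : R) : s \in `[0, T] -> clamp T s = s.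
Proof.
by rewrite in_itv/= /clamp => /andP[s0 sT]; rewrite min_l// max_r.
Qed.

Lemma clamp_in (T s : R) : 0 <= T -> clamp T s \in `[0, T].
Proof.
by move=> T0; rewrite in_itv/= /clamp le_max lexx/= ge_max T0/= ge_min lexx orbT.
Qed.

Lemma clamp_continuous (T : R) : continuous (clamp T).
Proof.
move=> s; rewrite /clamp.
apply: (@continuous_max _ _ (fun=> 0) (fun s => Num.min s T)).
  exact: cvg_cst.
by apply: (@continuous_min _ _ id (fun=> T)); [exact: cvg_id|exact: cvg_cst].
Qed.

Lemma continuous_clamp (T : R) (b : R -> R) : 0 <= T -> {within `[0, T], continuous b} ->
  continuous (b \o clamp T).
Proof.
move=> T0 /subspace_continuousP cb s.
have h := cb _ (clamp_in s T0).
apply: (cvg_comp _ _ _ h); apply: cvg_into; first exact: clamp_continuous.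
by apply: (@nearW _ (nbhs s)) => u; exact: clamp_in.
Qed.

Lemma derive0_cst (T : R) (y : R -> R) : 0 <= T -> {within `[0, T], continuous y} ->
  (forall s, s \in `]0, T[ -> is_derive s 1 y 0) -> y T = y 0.
Proof.
move=> T0 cy dy; have [] := MVT_segment T0 (df := fun=> 0) dy cy.
by move=> c _ /eqP; rewrite mul0r subr_eq0 => /eqP.
Qed.

(** With [P] a primitive of [b], the product [y * exp P] is constant. Only
    the positivity of the factor matters later: it carries the sign or the
    vanishing of [y] from time [0] to time [T]. *)
Lemma linear_ode (T : R) (y b : R -> R) : 0 <= T ->
  {within `[0, T], continuous y} -> {within `[0, T], continuous b} ->
  (forall s, s \in `]0, T[ -> is_derive s 1 y (- b s * y s)) ->
  exists2 E : R, 0 < E & y T = E * y 0.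
Proof.
move=> T0 cy cb dy.
have [P [P0 dP]] := primitive_exists (continuous_clamp T0 cb).
exists (expR (- P T)); first exact: expR_gt0.
suff : y T * expR (P T) = y 0 * expR (P 0).
  by rewrite P0 expR0 mulr1 => <-; rewrite mulrCA -expRD addNr expR0 mulr1.
have dPs (s : R) : 0 <= s -> is_derive s 1 P ((b \o clamp T) s).
  by move=> s0; apply: dP; rewrite (lt_le_trans _ s0)// ltrN10.
apply: (@derive0_cst T (fun s => y s * expR (P s))) => //.
  move=> s; apply: cvgM; first exact: cy.
  move: s; change {within `[0, T], continuous (expR \o P)}.
  apply/subspace_continuousP => s; rewrite /= in_itv/= => /andP[s0 _].
  apply: cvg_within_filter.
  apply: (@continuous_comp _ _ _ P expR); last exact: continuous_expR.
  apply/differentiable_continuous/derivable1_diffP.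
  by have := dPs s s0; case.
move=> s sT; have := sT; rewrite in_itv/= => /andP[s0 s1].
have d1 := dy s sT; have d2 := dPs s (ltW s0).
have sc : s \in `[0, T] by rewrite in_itv/= !ltW.
have := is_deriveM d1 (is_derive1_comp (is_derive_expR (P s)) d2).
rewrite /= clamp_id// /GRing.scale/= => H; apply: (is_derive_eq H); ring.
Qed.

End OneVariable.

(** * Derivative rules and first-order Taylor bounds *)

Section DeriveRules.
Context {R : realType}.
Implicit Types (f g : R -> R) (x df dg : R).

Lemma derD f g x df dg : is_derive x 1 f df -> is_derive x 1 g dg ->
  is_derive x 1 (fun s => f s + g s) (df + dg).
Proof. exact: is_deriveD. Qed.

Lemma derM f g x df dg : is_derive x 1 f df -> is_derive x 1 g dg ->
  is_derive x 1 (fun s => f s * g s) (df * g x + f x * dg).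
Proof.
move=> h1 h2; apply: (is_derive_eq (is_deriveM h1 h2)).
by rewrite /GRing.scale/= addrC (mulrC (g x)).
Qed.

Lemma der_comp f g x df dg : is_derive (g x) 1 f df -> is_derive x 1 g dg ->
  is_derive x 1 (fun s => f (g s)) (df * dg).
Proof. exact: is_derive1_comp. Qed.

Lemma derX (n : nat) x :
  is_derive x 1 (fun y : R => y ^+ n) (n%:R * x ^+ n.-1).
Proof.
apply: DeriveDef; first exact: exprn_derivable.
by rewrite exp_derive /GRing.scale/= mulr1.
Qed.

Lemma der_inv x : x != 0 -> is_derive x 1 (fun y : R => y^-1) (- x ^- 2).
Proof.
move=> x0; apply: (is_derive_eq (@is_deriveV R id x 1 1 x0 (is_derive_id x 1))).
by rewrite /GRing.scale/= mulr1.
Qed.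

Lemma der_expV (n : nat) x : x != 0 ->
  is_derive x 1 (fun y : R => y ^- n) (- n%:R * x ^- n.+1).
Proof.
move=> x0; have xn0 : x ^+ n != 0 by rewrite expf_neq0.
have h := der_comp (g := fun y => y ^+ n) (der_inv xn0) (derX n x).
apply: (is_derive_eq h).
case: n xn0 {h} => [|n] xn0; first by rewrite oppr0 !mul0r mulr0.
by rewrite /= !exprS; field; rewrite x0 /= expf_neq0.
Qed.

Lemma der_sqrt x : 0 < x -> is_derive x 1 Num.sqrt (2 * Num.sqrt x)^-1.
Proof. exact: is_derive1_sqrt. Qed.

Lemma derC (k x : R) : is_derive x 1 (fun=> k : R) (0 : R).
Proof. exact: is_derive_cst. Qed.

Lemma der_id x : is_derive x 1 (fun y : R => y) 1.
Proof. exact: is_derive_id. Qed.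

Lemma der_affine (k m x : R) : is_derive x 1 (fun y : R => k * y + m) k.
Proof.
apply: (is_derive_eq (derD (derM (derC k x) (der_id x)) (derC m x))).
by rewrite mul0r add0r mulr1 addr0.
Qed.

Lemma der_cont f x df : is_derive x 1 f df -> {for x, continuous f}.
Proof. by case=> d _; apply/differentiable_continuous/derivable1_diffP. Qed.

Lemma mvt_bound f (df : R -> R) (u v K : R) : 0 <= K -> u <= v ->
  (forall s, u <= s <= v -> is_derive s 1 f (df s)) ->
  (forall s, u <= s <= v -> `|df s| <= K) -> `|f v - f u| <= K * (v - u).
Proof.
move=> K0 uv dff dfK.
have cf : {within `[u, v], continuous f}.
  apply/subspace_continuousP => s; rewrite /= in_itv/= => suv.
  by apply: cvg_within_filter; exact: der_cont (dff _ suv).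
have [s|c cuv ->] := MVT_segment uv _ cf (df := df).
  by rewrite in_itv/= => /andP[us sv]; apply: dff; rewrite !ltW.
rewrite normrM (ger0_norm (_ : 0 <= v - u)) ?subr_ge0//.
by rewrite ler_wpM2r ?subr_ge0// dfK//; move: cuv; rewrite in_itv.
Qed.

Lemma mvt_bound_sym f (df : R -> R) (I : set R) (K : R) : 0 <= K -> is_interval I ->
  (forall s, I s -> is_derive s 1 f (df s)) ->
  (forall s, I s -> `|df s| <= K) ->
  forall u v, I u -> I v -> `|f v - f u| <= K * `|v - u|.
Proof.
move=> K0 itvI dff dfK u v Iu Iv.
have [uv|/ltW vu] := leP u v.
  rewrite (ger0_norm (_ : 0 <= v - u)) ?subr_ge0//.
  by apply: (mvt_bound (df := df)) => // s suv;
    [apply: dff|apply: dfK]; exact: itvI suv.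
rewrite distrC (distrC v u) (ger0_norm (_ : 0 <= u - v)) ?subr_ge0//.
by apply: (mvt_bound (df := df)) => // s suv;
  [apply: dff|apply: dfK]; exact: itvI suv.
Qed.

(** The mean value bound is used twice, for [df] and then for [f] minus its
    tangent at [x], on the points that are no farther from [x] than [y] is:
    there the derivative of the difference is at most [K * `|y - x|]. *)
Lemma taylor1_bound f (df ddf : R -> R) (I : set R) (K : R) : 0 <= K -> is_interval I ->
  (forall s, I s -> is_derive s 1 f (df s)) ->
  (forall s, I s -> is_derive s 1 df (ddf s)) ->
  (forall s, I s -> `|ddf s| <= K) ->
  forall x y, I x -> I y -> `|f y - f x - (y - x) * df x| <= K * (y - x) ^+ 2.
Proof.
move=> K0 itvI d1 d2 bK x y Ix Iy.
pose J := [set s : R | `|s - x| <= `|y - x| /\ I s].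
have itvJ : is_interval J.
  move=> u v [ux Iu] [vx Iv] s suv; split; last exact: itvI suv.
  move: ux vx suv; rewrite !ler_norml => /andP[u1 u2] /andP[v1 v2] /andP[us sv].
  by apply/andP; split; [rewrite (le_trans u1)|rewrite (le_trans _ v2)] => //;
    rewrite lerD2r.
rewrite (_ : f y - f x - _ = f y + (- df x * y + df x * x) -
  (f x + (- df x * x + df x * x))); last by ring.
have -> : K * (y - x) ^+ 2 = K * `|y - x| * `|y - x|.
  by rewrite -mulrA -expr2 real_normK ?num_real.
apply: (@mvt_bound_sym (fun s => f s + (- df x * s + df x * x))
  (fun s => df s - df x) J) => //.
- by rewrite mulr_ge0.
- by move=> s [_ Is]; apply: derD; [exact: d1|exact: der_affine].
- move=> s [sy Is]; apply: le_trans (_ : K * `|s - x| <= _).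
    exact: (mvt_bound_sym K0 itvI d2 bK).
  by rewrite ler_wpM2l.
- by split=> //; rewrite subrr normr0.
Qed.

End DeriveRules.

(** * Time integrals along a motion of constant comoving momentum *)

Section TimeIntegrals.
Context {R : realType} (A : R -> R).
Implicit Types (s t kap x y k : R) (p : nat).
Hypothesis cA : continuous A.
Hypothesis A1 : forall t, 1 <= A t.

(** [inertia s kap / A s] is the Lorentz factor, at scale [A s], of a
    particle whose momentum is [c * sqrt kap / A s]. *)
Definition inertia (s kap : R) : R := Num.sqrt (A s ^+ 2 + kap).

Lemma A0 s : 0 < A s. Proof. exact: lt_le_trans (A1 s). Qed.

Lemma sq_ge1 s kap : 0 <= kap -> 1 <= A s ^+ 2 + kap.
Proof.
by move=> k0; rewrite -[leLHS]addr0 lerD// expr_ge1// (le_trans _ (A1 s)).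
Qed.

Lemma inertia_ge1 s kap : 0 <= kap -> 1 <= inertia s kap.
Proof. by move=> k0; rewrite -sqrtr1 ler_wsqrtr// sq_ge1. Qed.

Lemma inertia_gt0 s kap : 0 <= kap -> 0 < inertia s kap.
Proof. by move=> k0; exact: lt_le_trans (inertia_ge1 s k0). Qed.

Lemma inertia2 s kap : 0 <= kap -> inertia s kap ^+ 2 = A s ^+ 2 + kap.
Proof. by move=> k0; rewrite sqr_sqrtr// (le_trans _ (sq_ge1 s k0)). Qed.

(** A derivative in [kap] raises the exponent by two, so the negative powers
    form a family closed under differentiation in [kap]. *)
Lemma der_inertiaV p s kap : 0 <= kap ->
  is_derive kap 1 (fun k => inertia s k ^- p) (- (p%:R / 2) * inertia s kap ^- p.+2).
Proof.
move=> k0; have S0 := inertia_gt0 s k0; have S2 := sq_ge1 s k0.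
have d1 : is_derive kap 1 (fun k : R => A s ^+ 2 + k) 1.
  apply: (is_derive_eq (derD (derC (A s ^+ 2) kap) (der_id kap))).
  by rewrite add0r.
have d2 := der_comp (g := fun k => A s ^+ 2 + k)
  (der_sqrt (lt_le_trans ltr01 S2)) d1.
have d3 := der_comp (g := inertia s) (der_expV p (lt0r_neq0 S0)) d2.
apply: (is_derive_eq d3); rewrite -/(inertia s kap).
rewrite [in RHS]exprS; field.
by rewrite (lt0r_neq0 S0) expf_neq0// lt0r_neq0.
Qed.

Lemma inertiaV_le1 p s kap : 0 <= kap -> 0 <= inertia s kap ^- p <= 1.
Proof.
move=> k0; have S1 := inertia_ge1 s k0; have S0 := inertia_gt0 s k0.
by rewrite invr_ge0 exprn_ge0 ?(ltW S0)//= invf_le1 ?exprn_gt0// exprn_ege1.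
Qed.

Lemma itv_ge0 : is_interval [set kap : R | 0 <= kap].
Proof. by move=> x y /= x0 _ z /andP[xz _]; exact: le_trans xz. Qed.

(** Since [A >= 1], all powers are at most [1] and the bound is uniform in
    time. *)
Lemma inertiaV_taylor p s x y : 0 <= x -> 0 <= y ->
  `|inertia s y ^- p - inertia s x ^- p - (y - x) * (- (p%:R / 2) * inertia s x ^- p.+2)|
  <= (p%:R / 2) * (p.+2%:R / 2) * (y - x) ^+ 2.
Proof.
move=> x0 y0; apply: (@taylor1_bound _ (fun k => inertia s k ^- p)
  (fun k => - (p%:R / 2) * inertia s k ^- p.+2)
  (fun k => - (p%:R / 2) * (- (p.+2%:R / 2) * inertia s k ^- p.+4))
  [set k | 0 <= k]).
- by rewrite mulr_ge0// divr_ge0.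
- exact: itv_ge0.
- by move=> k k0; exact: der_inertiaV.
- move=> k k0; have := derM (derC (- (p%:R / 2)) k) (der_inertiaV p.+2 s k0).
  by move=> h; apply: (is_derive_eq h); rewrite mul0r add0r.
- move=> k k0; have /andP[h0 h1] := inertiaV_le1 p.+4 s k0.
  have p0 : 0 <= (p%:R / 2) * (p.+2%:R / 2) :> R by rewrite mulr_ge0// divr_ge0.
  by rewrite mulrA mulrNN normrM (ger0_norm h0) (ger0_norm p0) ler_piMr.
- exact: x0.
- exact: y0.
Qed.

Definition rate p (kap s : R) : R := (A s)^-1 * inertia s kap ^- p.

Lemma cont_inertia (F : set_system (R * R)) {FF : Filter F} (t k : R) :
  fst @ F --> t -> snd @ F --> k ->
  inertia q.1 q.2 @[q --> F] --> inertia t k.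
Proof.
move=> F1 F2; rewrite /inertia.
apply: (@cvg_comp _ _ _ (fun q : R * R => A q.1 ^+ 2 + q.2) Num.sqrt _
  (nbhs (A t ^+ 2 + k))); last exact: sqrt_continuous.
apply: cvgD => //; rewrite !expr2.
have h : A q.1 @[q --> F] --> A t by exact: (cvg_comp _ _ F1 (@cA t)).
exact: cvgM.
Qed.

Lemma cont_rate p (F : set_system (R * R)) {FF : Filter F} (t k : R) :
  0 <= k -> fst @ F --> t -> snd @ F --> k ->
  rate p q.2 q.1 @[q --> F] --> rate p k t.
Proof.
move=> k0 F1 F2; rewrite /rate; apply: cvgM.
  apply: cvgV; first by rewrite lt0r_neq0 ?A0.
  exact: (cvg_comp _ _ F1 (@cA t)).
have Sn0 : inertia t k ^+ p != 0 by rewrite expf_neq0// lt0r_neq0 ?inertia_gt0.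
apply: cvgV => //.
apply: (@cvg_comp _ _ _ (fun q : R * R => inertia q.1 q.2) (fun x => x ^+ p) _
  (nbhs (inertia t k))); first exact: cont_inertia.
exact: exprn_continuous.
Qed.

Lemma continuous_rate p kap : 0 <= kap -> continuous (rate p kap).
Proof.
move=> k0 s.
apply: (@cvg_comp _ _ _ (fun s : R => (s, kap)) (fun q => rate p q.2 q.1)
  _ (nbhs (s, kap))).
  exact: (cvg_pair cvg_id (cvg_cst kap)).
by apply: cont_rate => //; [exact: cvg_fst|exact: cvg_snd].
Qed.

(** The integral of [rate p kap] from [0], taken as a primitive on the times
    after [-1]. For [p = 1] it is the distance travelled per unit of comoving
    momentum; the other exponents come from differentiating this distance in
    [kap]. *)
Definition travel p (kap : R) : R -> R := xget (fun=> 0)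
  [set P | P 0 = 0 /\ forall t : R, -1 < t -> is_derive t 1 P (rate p kap t)].

Lemma travelP p kap : 0 <= kap -> travel p kap 0 = 0 /\ 
  forall t : R, -1 < t -> is_derive t 1 (travel p kap) (rate p kap t).
Proof.
move=> k0; rewrite /travel; case: xgetP => [P _ //|H].
have [P HP] := primitive_exists (continuous_rate (p := p) k0).
by have := H P.
Qed.

Lemma rate_bound p s kap : 0 <= kap -> 0 <= rate p kap s <= 1.
Proof.
move=> k0; have /andP[h0 h1] := inertiaV_le1 p s k0.
have a0 := A0 s; have a1 : (A s)^-1 <= 1 by rewrite invf_le1 ?A1.
have a2 : 0 <= (A s)^-1 by rewrite invr_ge0 ltW.
by rewrite /rate mulr_ge0//= mulr_ile1.
Qed.

(** The Taylor bound of the integrand, integrated from [0] to [t]. *)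
Lemma travel_taylor p t x y : 0 <= t -> 0 <= x -> 0 <= y ->
  `|travel p y t - travel p x t - (y - x) * (- (p%:R / 2) * travel p.+2 x t)|
  <= (p%:R / 2) * (p.+2%:R / 2) * (y - x) ^+ 2 * t.
Proof.
move=> t0 x0 y0; have [Y0 dY] := travelP p y0; have [X0 dX] := travelP p x0.
have [Z0 dZ] := travelP p.+2 x0.
pose k := (y - x) * (p%:R / 2).
have := @mvt_bound _ (fun s => travel p y s + (-1 * travel p x s + k * travel p.+2 x s))
  (fun s => rate p y s + (-1 * rate p x s + k * rate p.+2 x s)) 0 t
  ((p%:R / 2) * (p.+2%:R / 2) * (y - x) ^+ 2) _ t0.
rewrite X0 Y0 Z0 !mulr0 !addr0 !subr0.
have -> : travel p y t - travel p x t - (y - x) * (- (p%:R / 2) * travel p.+2 x t) =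
  travel p y t + (-1 * travel p x t + k * travel p.+2 x t) by rewrite /k; ring.
apply.
- by rewrite mulr_ge0 ?sqr_ge0// mulr_ge0// divr_ge0.
- move=> s /andP[s0 _]; have s1 : -1 < s by rewrite (lt_le_trans _ s0)// ltrN10.
  apply: (is_derive_eq (derD (dY s s1) (derD (derM (derC (-1) s) (dX s s1))
    (derM (derC k s) (dZ s s1))))).
  by rewrite !mul0r !add0r.
- move=> s _.
  have -> : rate p y s + (-1 * rate p x s + k * rate p.+2 x s) =
    (A s)^-1 * (inertia s y ^- p - inertia s x ^- p -
      (y - x) * (- (p%:R / 2) * inertia s x ^- p.+2)) by rewrite /rate /k; ring.
  rewrite normrM ger0_norm ?invr_ge0 ?(ltW (A0 s))//.
  apply: le_trans (inertiaV_taylor p s x0 y0).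
  by rewrite ler_piMl// invf_le1// A0.
Qed.

(** The slope in time is taken at the fixed value [q0.2] of [kap], the slope
    in [kap] at the moved time. Each one is then a one-variable matter, and
    the second converges because [travel_taylor] is locally uniform in time. *)
Lemma slopes_travel p (q0 : R * R) : quadrant q0 ->
  slopes (within quadrant (nbhs q0)) (fun t k => travel p k t) q0
    (rate p q0.2 q0.1) (- (p%:R / 2) * travel p.+2 q0.2 q0.1).
Proof.
case: q0 => t x [/= t0 x0].
have [X0 dX] := travelP p x0.
have t1 : -1 < t by rewrite (lt_le_trans _ t0)// ltrN10.
have /is_derive1_caratheodory[g [fg cg gt]] := dX t t1.
pose c : R := - (p%:R / 2).
exists (fun q => g q.1), (fun q => if q.2 == x then c * travel p.+2 x q.1 else
  (travel p q.2 q.1 - travel p x q.1) / (q.2 - x)); split.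
- by rewrite -gt; apply: (cvg_comp _ _ (@cvg_fst_within _ _ (t, x))); exact: cg.
- have c1 : c * travel p.+2 x q.1 @[q --> within quadrant (nbhs (t, x))] -->
    c * travel p.+2 x t.
    apply: cvgM; first exact: cvg_cst.
    apply: (cvg_comp _ _ (@cvg_fst_within _ _ (t, x))).
    by have [_ d] := travelP p.+2 x0; apply: der_cont (d t _).
  have c2 : (p%:R / 2) * (p.+2%:R / 2) * `|q.2 - x| * q.1
      @[q --> within quadrant (nbhs (t, x))] --> 0.
    rewrite (_ : 0 = (p%:R / 2) * (p.+2%:R / 2) * `|x - x| * t :> R); last first.
      by rewrite subrr normr0 mulr0 mul0r.
    apply: cvgM; last exact: (@cvg_fst_within _ _ (t, x)).
    apply: cvgM; first exact: cvg_cst.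
    apply: cvg_norm; apply: cvgB; last exact: cvg_cst.
    exact: (@cvg_snd_within _ _ (t, x)).
  set B := (B in B @ _ --> _).
  have c3 : B q - c * travel p.+2 x q.1 @[q --> within quadrant (nbhs (t, x))] --> 0.
    apply/cvgrPdist_le => e e0; near=> q.
    have [q1 q2] : quadrant q by near: q; exact: withinT.
    rewrite sub0r normrN /B; case: eqP => [_|/eqP qx].
      by rewrite subrr normr0 ltW.
    have qx0 : q.2 - x != 0 by rewrite subr_eq0.
    have : `|0 - (p%:R / 2) * (p.+2%:R / 2) * `|q.2 - x| * q.1| <= e.
      by near: q; move/cvgrPdist_le : c2; exact.
    rewrite sub0r normrN; apply: le_trans.
    apply: le_trans (_ : (p%:R / 2) * (p.+2%:R / 2) * `|q.2 - x| * q.1 <= _); last exact: ler_norm.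
      have := travel_taylor p q1 x0 q2; rewrite -/c => h.
      rewrite (_ : _ - _ = (travel p q.2 q.1 - travel p x q.1 -
       (q.2 - x) * (c * travel p.+2 x q.1)) / (q.2 - x)); last by field.
      rewrite normrM normfV ler_pdivrMr ?normr_gt0//.
      by rewrite mulrAC -(mulrA _ _ `|_|) -expr2 real_normK ?num_real.
  rewrite -[X in _ --> X](addr0 (c * travel p.+2 x t)).
  have : c * travel p.+2 x q.1 + (B q - c * travel p.+2 x q.1)
    @[q --> within quadrant (nbhs (t, x))] --> c * travel p.+2 x t + 0.
    exact: cvgD.
  apply: cvg_trans; apply: near_eq_cvg.
  by apply: nearW => q /=; rewrite addrC subrK.
- apply: nearW => q /=; rewrite -fg; case: eqP => [->|/eqP qx].
    by rewrite subrr mulr0 addr0.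
  by field; rewrite subr_eq0.
Unshelve. all: by end_near. Qed.

Lemma C1_travel p : C1_with quadrant (fun t k => travel p k t)
  (fun t k => rate p k t) (fun t k => - (p%:R / 2) * travel p.+2 k t).
Proof.
apply/C1_withP; split.
- move=> q [_ q2].
  by apply: cont_rate => //; [exact: cvg_fst_within|exact: cvg_snd_within].
- move=> q qq; apply: cvgM; first exact: cvg_cst.
  exact: (slopes_cvg (@cvg_fst_within _ _ q) (@cvg_snd_within _ _ q) (slopes_travel p.+2 qq)).
- by move=> q; exact: slopes_travel.
Qed.

End TimeIntegrals.

(** * Radial profiles as functions on a line *)

Section Axis.
Context {R : realType} (n : nat) (i : 'I_n).
Implicit Types (s : R).

Definition axis (s : R) : 'rV[R]_n := s *: delta_mx 0 i.

Lemma axisE s j : axis s 0 j = s * (j == i)%:R.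
Proof. by rewrite !mxE eqxx. Qed.

Lemma enorm_axis s : enorm (axis s) = `|s|.
Proof.
rewrite /enorm (bigD1 i)//= big1 => [|j ji].
  by rewrite addr0 axisE eqxx mulr1 sqrtr_sqr.
by rewrite axisE (negbTE ji) mulr0 expr2 mulr0.
Qed.

Lemma continuous_axis : continuous axis.
Proof. by move=> s; apply: cvgZr_tmp; exact: cvg_id. Qed.

Lemma derive_axis (f : 'rV[R]_n -> R) s :
  derivable f (axis s) (delta_mx 0 i) ->
  is_derive s 1 (fun u => f (axis u)) ('D_(delta_mx 0 i) f (axis s)).
Proof.
move=> /derivableP[df ef].
have E (h : R) : axis (h *: 1 + s) = h *: delta_mx 0 i + axis s.
  by have -> : h *: 1 = h :> R by [exact: mulr1]; rewrite /axis scalerDl.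
apply: DeriveDef.
  rewrite /derivable.
  rewrite (_ : (fun h => _) = (fun h : R => h^-1 *: ((f \o shift (axis s)) (h *: delta_mx 0 i) - f (axis s)))) //.
  by apply/funext => h /=; rewrite E.
rewrite /derive.
rewrite (_ : (fun h => _) = (fun h : R => h^-1 *: ((f \o shift (axis s)) (h *: delta_mx 0 i) - f (axis s)))) //.
by apply/funext => h /=; rewrite E.
Qed.

End Axis.

Section Parity.
Context {R : realType}.
Implicit Types (f g : R -> R) (s : R).

Lemma derive_unique f s (u v : R) : is_derive s 1 f u -> is_derive s 1 f v -> u = v.
Proof. by move=> [_ <-] [_ <-]. Qed.

Lemma derive_odd f g : (forall s, f (- s) = - f s) ->
  (forall s, is_derive s 1 f (g s)) -> forall s, g (- s) = g s.
Proof.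
move=> fo df s; apply/esym; apply: (derive_unique (df s)).
have E : f = (fun s => -1 * f (-1 * s + 0)).
  by apply/funext => u; rewrite addr0 !mulN1r fo opprK.
have d := der_comp (g := fun s => -1 * s + 0) (df (-1 * s + 0)) (der_affine (-1) 0 s).
rewrite E; apply: (is_derive_eq (derM (derC (-1) s) d)).
by rewrite addr0 !mulN1r; ring.
Qed.

Lemma derive_even f g : (forall s, f (- s) = f s) ->
  (forall s, is_derive s 1 f (g s)) -> forall s, g (- s) = - g s.
Proof.
move=> fo df s; apply: (derive_unique (df (- s))).
have E : f = (fun s => f (-1 * s + 0)).
  by apply/funext => u; rewrite addr0 !mulN1r fo.
have d := der_comp (g := fun s => -1 * s + 0) (df (-1 * - s + 0)) (der_affine (-1) 0 (- s)).
rewrite E; apply: (is_derive_eq d).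
by rewrite addr0 !mulN1r opprK; ring.
Qed.

Lemma odd0 f : (forall s, f (- s) = - f s) -> f 0 = 0.
Proof. by move=> /(_ 0); rewrite oppr0; lra. Qed.

End Parity.

Section Profiles.
Context {R : realType} (n : nat) (hn : (1 <= n)%N).

(** On a coordinate axis a radial function is the even extension of its
    profile, so this extension inherits the regularity of the function. *)
Lemma scalar_profile (rho0 : R -> R) :
  bounded_Ck 1 (fun x : 'rV[R]_n => radial_scalar rho0 x) ->
  exists k1 : R -> R,
    (forall s : R, is_derive s 1 (fun s => rho0 `|s|) (k1 s)) /\ continuous k1.
Proof.
move=> [_ _ /(_ (Ordinal hn)) [df [cdf _ _]]].
set i := Ordinal hn in df cdf *.
exists (fun s => 'D_(delta_mx 0 i) (fun x : 'rV[R]_n => radial_scalar rho0 x) (axis i s)).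
split=> [s|s].
  have := derive_axis (df (axis i s)).
  by rewrite /radial_scalar; under eq_fun do rewrite enorm_axis.
exact: (cvg_comp _ _ (@continuous_axis _ _ i s) (@cdf _)).
Qed.

(** On the first axis the first component of the field is the odd extension
    of the profile. *)
Lemma vector_profile (v0 : R -> R) :
  (forall i : 'I_n, bounded_Ck 2 (fun x : 'rV[R]_n => radial_vector v0 i x)) ->
  exists h h1 h2 : R -> R,
  [/\ forall s : R, is_derive s 1 h (h1 s),
      forall s : R, is_derive s 1 h1 (h2 s), continuous h2,
      (forall s, h (- s) = - h s) /\ (forall r, 0 < r -> h r = v0 r) &
      exists M : R, forall s, `|h s| <= M /\ `|h1 s| <= M].
Proof.
move=> /(_ (Ordinal hn)) [cf [M bM] /(_ (Ordinal hn)) [df [cdf [M1 bM1]]]].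
set i := Ordinal hn in bM bM1 df cdf *.
move=> /(_ i) [ddf [cddf _ _]].
set e := delta_mx 0 i in bM1 df cdf ddf cddf *.
pose f := fun x : 'rV[R]_n => radial_vector v0 i x.
exists (fun s => f (axis i s)), (fun s => 'D_e f (axis i s)),
  (fun s => 'D_e (fun x => 'D_e f x) (axis i s)).
have fE s : f (axis i s) = v0 `|s| * (s / `|s|).
  by rewrite /f /radial_vector enorm_axis axisE eqxx mulr1.
split.
- by move=> s; exact: derive_axis (df _).
- by move=> s; exact: (derive_axis (f := fun x => 'D_e f x)) (ddf _).
- by move=> s; exact: (cvg_comp _ _ (@continuous_axis _ _ i s) (@cddf _)).
- split=> [s|r r0]; first by rewrite !fE normrN mulNr mulrN.
  by rewrite fE gtr0_norm// divff ?gt_eqF// mulr1.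
- exists (Num.max M M1) => s; rewrite !le_max bM; split => //.
  by rewrite bM1 orbT.
Qed.

End Profiles.

(** * Velocity and momentum *)

Section Momentum.
Context {R : realType} (c : R) (c0 : 0 < c).
Implicit Types y s : R.

(** The reciprocal of the Lorentz factor. *)
Definition lorentz y : R := Num.sqrt (1 - (y / c) ^+ 2).

Definition momentum y : R := y / lorentz y.

Lemma lorentz_arg_gt0 y : `|y| < c -> 0 < 1 - (y / c) ^+ 2.
Proof.
move=> yc; rewrite subr_gt0 -[_ ^+ 2]real_normK ?num_real// expr_lt1//.
by rewrite normrM normfV (gtr0_norm c0) ltr_pdivrMr// mul1r.
Qed.

Lemma lorentz_gt0 y : `|y| < c -> 0 < lorentz y.
Proof. by move=> yc; rewrite sqrtr_gt0 lorentz_arg_gt0. Qed.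

Lemma lorentz2 y : `|y| < c -> lorentz y ^+ 2 = 1 - (y / c) ^+ 2.
Proof. by move=> yc; rewrite sqr_sqrtr// ltW// lorentz_arg_gt0. Qed.

Lemma der_lorentz y : `|y| < c ->
  is_derive y 1 lorentz (- y / (c ^+ 2 * lorentz y)).
Proof.
move=> yc; have S0 := lorentz_gt0 yc; have cn0 := lt0r_neq0 c0.
have d0 : is_derive y 1 (fun y => y * c^-1) (c^-1).
  apply: (is_derive_eq (derM (der_id y) (derC c^-1 y))).
  by rewrite mul1r mulr0 addr0.
have d1 := der_comp (g := fun y => y / c) (derX 2 (y / c)) d0.
have d2 := derD (derC 1 y) (derM (derC (-1) y) d1).
have E : lorentz = (fun y => Num.sqrt (1 + -1 * (y / c) ^+ 2)).
  by apply/funext => u; rewrite mulN1r.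
have S1 : 0 < 1 + -1 * (y / c) ^+ 2 by rewrite mulN1r lorentz_arg_gt0.
have d3 := der_comp (g := fun y => 1 + -1 * (y / c) ^+ 2) (der_sqrt S1) d2.
rewrite E; apply: (is_derive_eq d3).
rewrite /= in E *; rewrite -[Num.sqrt _]/((fun y => Num.sqrt (1 + -1 * (y / c) ^+ 2)) y) -E.
by field; rewrite cn0 (lt0r_neq0 S0).
Qed.

Lemma der_momentum y : `|y| < c ->
  is_derive y 1 momentum (lorentz y ^- 3).
Proof.
move=> yc; have S0 := lorentz_gt0 yc; have cn0 := lt0r_neq0 c0.
have dV := der_comp (g := lorentz) (der_inv (lt0r_neq0 S0)) (der_lorentz yc).
apply: (is_derive_eq (derM (der_id y) dV)).
have n0 := lt0r_neq0 S0; have E : y ^+ 2 = c ^+ 2 * (1 - lorentz y ^+ 2).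
  by rewrite lorentz2//; field.
apply/eqP; rewrite -subr_eq0; apply/eqP.
rewrite (_ : _ - _ = (y ^+ 2 - c ^+ 2 * (1 - lorentz y ^+ 2)) / (c ^+ 2 * lorentz y ^+ 3)).
  by rewrite E subrr mul0r.
by field; rewrite cn0 n0.
Qed.

Lemma der_momentum' y : `|y| < c ->
  is_derive y 1 (fun y => lorentz y ^- 3) (3%:R * y / (c ^+ 2 * lorentz y ^+ 5)).
Proof.
move=> yc; have S0 := lorentz_gt0 yc; have cn0 := lt0r_neq0 c0.
have n0 := lt0r_neq0 S0.
have d := der_comp (g := lorentz) (der_expV 3 n0) (der_lorentz yc).
by apply: (is_derive_eq d); field; rewrite cn0 n0.
Qed.

Lemma cont_lorentz y : `|y| < c -> {for y, continuous lorentz}.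
Proof. by move=> yc; exact: der_cont (der_lorentz yc). Qed.

(** The motion is simplest in terms of the momentum; the velocity is
    recovered from it by this formula. *)
Lemma velocity_of_momentum y : `|y| < c ->
  1 + (momentum y / c) ^+ 2 = lorentz y ^- 2 /\
  y = momentum y / Num.sqrt (1 + (momentum y / c) ^+ 2).
Proof.
move=> yc; have S0 := lorentz_gt0 yc; have cn0 := lt0r_neq0 c0.
have n0 := lt0r_neq0 S0; have E : y ^+ 2 = c ^+ 2 * (1 - lorentz y ^+ 2).
  by rewrite lorentz2//; field.
have H : 1 + (momentum y / c) ^+ 2 = lorentz y ^- 2.
  rewrite /momentum (_ : _ ^+ 2 = y ^+ 2 / (c ^+ 2 * lorentz y ^+ 2)).
    by rewrite E; field; rewrite cn0 n0.
  by field; rewrite cn0 n0.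
split => //; rewrite H -exprVn sqrtr_sqr ger0_norm ?invr_ge0 ?(ltW S0)//.
by rewrite /momentum invrK divfK.
Qed.

Variables (eps M : R) (h h1 h2 : R -> R).
Hypothesis eps0 : 0 < eps.
Hypothesis M0 : 0 <= M.
Hypothesis epsM : eps * M < c.
Hypothesis dh : forall s, is_derive s 1 h (h1 s).
Hypothesis dh1 : forall s, is_derive s 1 h1 (h2 s).
Hypothesis ch2 : continuous h2.
Hypothesis h_odd : forall s, h (- s) = - h s.
Hypothesis bM : forall s, `|h s| <= M /\ `|h1 s| <= M.

Let hc s : `|eps * h s| < c.
Proof.
apply: le_lt_trans epsM; rewrite normrM (gtr0_norm eps0) ler_wpM2l ?(ltW eps0)//.
by have [] := bM s.
Qed.

Let sM : 0 < Num.sqrt (1 - (eps * M / c) ^+ 2).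
Proof.
by rewrite sqrtr_gt0 lorentz_arg_gt0// ger0_norm// mulr_ge0// ltW.
Qed.

Let lM s : Num.sqrt (1 - (eps * M / c) ^+ 2) <= lorentz (eps * h s).
Proof.
rewrite ler_wsqrtr// lerD2l lerN2 -[leLHS]real_normK ?num_real//.
rewrite ler_sqr ?nnegrE ?divr_ge0 ?mulr_ge0// ?(ltW eps0) ?(ltW c0)//.
rewrite normrM normfV (gtr0_norm c0) ler_pM2r ?invr_gt0//.
by rewrite normrM (gtr0_norm eps0) ler_wpM2l ?(ltW eps0)//; have [] := bM s.
Qed.

(** On the velocities up to [eps * M], which is less than [c], the momentum
    is a smooth function of the velocity with positive bounded derivative. So
    [w] inherits from [h] its two derivatives, its bounds and the sign of its
    first derivative. *)
Lemma momentum_profile : exists w w1 w2 : R -> R,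
  [/\ forall s, w s = momentum (eps * h s),
      forall s, is_derive s 1 w (w1 s),
      forall s, is_derive s 1 w1 (w2 s) /\ {for s, continuous w2},
      forall s, exists2 k : R, 0 < k & w1 s = k * h1 s &
      exists K : R, forall s, `|w s| <= K /\ `|w1 s| <= K].
Proof.
have deh s : is_derive s 1 (fun s => eps * h s) (eps * h1 s).
  by apply: (is_derive_eq (derM (derC eps s) (dh s))); rewrite mul0r add0r.
pose w1 s := lorentz (eps * h s) ^- 3 * (eps * h1 s).
pose w2 s := 3%:R * (eps * h s) / (c ^+ 2 * lorentz (eps * h s) ^+ 5) * (eps * h1 s) * (eps * h1 s)
  + lorentz (eps * h s) ^- 3 * (eps * h2 s).
exists (fun s => momentum (eps * h s)), w1, w2; split => //.
- by move=> s; exact: (der_comp (g := fun s => eps * h s) (der_momentum (hc s)) (deh s)).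
- move=> s; split.
    have d := der_comp (g := fun s => eps * h s) (der_momentum' (hc s)) (deh s).
    have d1 : is_derive s 1 (fun s => eps * h1 s) (eps * h2 s).
      by apply: (is_derive_eq (derM (derC eps s) (dh1 s))); rewrite mul0r add0r.
    exact: derM d d1.
  have ch : h u @[u --> s] --> h s by exact: der_cont (dh s).
  have ch1 : h1 u @[u --> s] --> h1 s by exact: der_cont (dh1 s).
  have cl : lorentz (eps * h u) @[u --> s] --> lorentz (eps * h s).
    apply: (@cvg_comp _ _ _ (fun u => eps * h u) lorentz _ (nbhs (eps * h s))).
      by apply: cvgM => //; exact: cvg_cst.
    exact: cont_lorentz.
  have n0 p : lorentz (eps * h s) ^+ p != 0.
    by rewrite expf_neq0// lt0r_neq0// lorentz_gt0.
  have clp p : lorentz (eps * h u) ^+ p @[u --> s] --> lorentz (eps * h s) ^+ p.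
    exact: (cvg_comp _ _ cl (@exprn_continuous R p _)).
  have ce u v : u x @[x --> s] --> v -> eps * u x @[x --> s] --> eps * v.
    by move=> uv; apply: cvgM => //; exact: cvg_cst.
  apply: cvgD; last first.
    by apply: cvgM; [apply: cvgV => //; exact: clp|apply: ce; exact: ch2].
  apply: cvgM; last exact: ce.
  apply: cvgM; last exact: ce.
  apply: cvgM.
    by apply: cvgM; [exact: cvg_cst|exact: ce].
  apply: cvgV; first by rewrite mulf_neq0// expf_neq0// lt0r_neq0.
  by apply: cvgM; [exact: cvg_cst|exact: clp].
- move=> s; exists (lorentz (eps * h s) ^- 3 * eps); last by rewrite /w1 mulrA.
  by rewrite mulr_gt0// invr_gt0 exprn_gt0// lorentz_gt0.
- have l0 := sM; have lL := lM; set l := Num.sqrt _ in l0 lL.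
  exists (eps * M * l^-1 + (l ^+ 3)^-1 * (eps * M)) => s.
  have eM : 0 <= eps * M by rewrite mulr_ge0// ltW.
  have lV p : 0 <= l ^- p by rewrite invr_ge0 exprn_ge0// ltW.
  have [b1 b2] := bM s.
  have L0 := lorentz_gt0 (hc s).
  have e0 := ltW eps0.
  split.
    apply: ler_wpDr; first by rewrite mulr_ge0// lV.
    rewrite /momentum normrM normfV (gtr0_norm L0).
    apply: ler_pM; [exact: normr_ge0|by rewrite invr_ge0 ltW| |].
      by rewrite normrM (gtr0_norm eps0) ler_wpM2l.
    by rewrite lef_pV2// ?posrE// lL.
  apply: ler_wpDl; first by rewrite mulr_ge0// invr_ge0 ltW.
  rewrite /w1 normrM normfV (ger0_norm (exprn_ge0 3 (ltW L0))).
  apply: ler_pM; [by rewrite invr_ge0 exprn_ge0// ltW|exact: normr_ge0| |].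
    by rewrite lef_pV2 ?posrE ?exprn_gt0// lerXn2r ?nnegrE ?(ltW l0) ?(ltW L0)// lL.
  by rewrite normrM (gtr0_norm eps0) ler_wpM2l.
Qed.

End Momentum.

(** * Closure properties of continuously differentiable fields *)

Section MoreC1.
Context {R : realType}.
Implicit Types (D : set (R * R)) (f g : R -> R -> R).

Lemma C1_comp1 D (h h' : R -> R) g gt gr : C1_with D g gt gr ->
  (forall t r, D (t, r) -> is_derive (g t r) 1 h (h' (g t r)) /\
     {for g t r, continuous h'}) ->
  C1_with D (fun t r => h (g t r)) (fun t r => h' (g t r) * gt t r)
    (fun t r => h' (g t r) * gr t r).
Proof.
move=> Cg H; pose I := [set y : R | is_derive y 1 h (h' y) /\ {for y, continuous h'}].
have CI : C1_with [set p : R * R | I p.2] (fun _ y => h y) (fun _ _ => 0) (fun _ y => h' y).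
  by apply: C1_of_snd => y [].
apply: (C1_ext (C1_comp CI Cg H)) => t r _.
by rewrite add0r.
Qed.

Lemma C1_inv D g gt gr : C1_with D g gt gr ->
  (forall t r, D (t, r) -> g t r != 0) ->
  C1_with D (fun t r => (g t r)^-1) (fun t r => - (g t r) ^- 2 * gt t r)
    (fun t r => - (g t r) ^- 2 * gr t r).
Proof.
move=> Cg g0.
apply: (@C1_comp1 D (fun y => y^-1) (fun y => - y ^- 2) g gt gr Cg) => t r Dtr.
split; first exact: der_inv (g0 _ _ Dtr).
apply: cvgN; apply: cvgV; first by rewrite expf_neq0// g0.
exact: exprn_continuous.
Qed.

Lemma C1_sqrt D g gt gr : C1_with D g gt gr ->
  (forall t r, D (t, r) -> 0 < g t r) ->
  C1_with D (fun t r => Num.sqrt (g t r))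
    (fun t r => (2 * Num.sqrt (g t r))^-1 * gt t r)
    (fun t r => (2 * Num.sqrt (g t r))^-1 * gr t r).
Proof.
move=> Cg g0.
apply: (@C1_comp1 D Num.sqrt (fun y => (2 * Num.sqrt y)^-1) g gt gr Cg) => t r Dtr.
have h := g0 _ _ Dtr; split; first exact: der_sqrt.
apply: cvgV; first by rewrite mulf_neq0// gt_eqF ?sqrtr_gt0.
by apply: cvgM; [exact: cvg_cst|exact: sqrt_continuous].
Qed.

Lemma C1_label D (h h' : R -> R) : (forall y : R, is_derive y 1 h (h' y)) ->
  continuous h' ->
  C1_with D (fun _ r => h r) (fun _ _ => 0) (fun _ r => h' r).
Proof.
move=> dh ch; have := @C1_of_snd R setT h h' (fun y _ => dh y) (fun y _ => @ch y).
by apply: C1_sub.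
Qed.

Lemma C1_exists D f ft fr : C1_with D f ft fr -> C1_on D f.
Proof. by move=> ?; exists ft, fr. Qed.

Lemma C1_on_mul D f g : C1_on D f -> C1_on D g ->
  C1_on D (fun t r => f t r * g t r).
Proof.
by move=> [? [? Hf]] [? [? Hg]]; exact: C1_exists (C1_mul Hf Hg).
Qed.

Lemma C1_on_exp D f k : C1_on D f -> C1_on D (fun t r => f t r ^+ k).
Proof.
move=> Cf; elim: k => [|k IH]; first exact: C1_exists (C1_cst D 1).
have := C1_on_mul Cf IH.
by under [X in C1_on D X]eq_fun do under eq_fun do rewrite -exprS.
Qed.

Lemma C1_on_inv D f : C1_on D f -> (forall t r, D (t, r) -> f t r != 0) ->
  C1_on D (fun t r => (f t r)^-1).
Proof. by move=> [? [? Hf]] f0; exact: C1_exists (C1_inv Hf f0). Qed.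

Lemma C1_on_sub D D' f : D' `<=` D -> C1_on D f -> C1_on D' f.
Proof. by move=> DD [? [? Hf]]; exact: C1_exists (C1_sub DD Hf). Qed.

Lemma C1_on_comp (E D : set (R * R)) f g : C1_on E f -> C1_on D g ->
  (forall t r, D (t, r) -> E (t, g t r)) -> C1_on D (fun t r => f t (g t r)).
Proof.
by move=> [? [? Hf]] [? [? Hg]] DE; exact: C1_exists (C1_comp Hf Hg DE).
Qed.

Lemma C1_on_ext D f g : C1_on D f ->
  (forall t r, D (t, r) -> f t r = g t r) -> C1_on D g.
Proof.
move=> [ft [fr Hf]] fg; exists ft, fr; apply: (C1_ext Hf) => t r Dtr.
by rewrite fg.
Qed.

(** With derivatives written as [f * l], the logarithmic derivatives [l] add
    up under products. The density is a product of several factors, each with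
    a simple logarithmic derivative. *)
Lemma ld_mul (f g : R -> R) (t l m : R) : is_derive t 1 f (f t * l) ->
  is_derive t 1 g (g t * m) ->
  is_derive t 1 (fun s => f s * g s) (f t * g t * (l + m)).
Proof. by move=> hf hg; apply: (is_derive_eq (derM hf hg)); ring. Qed.

Lemma ld_inv (f : R -> R) (t l : R) : f t != 0 -> is_derive t 1 f (f t * l) ->
  is_derive t 1 (fun s => (f s)^-1) ((f t)^-1 * (- l)).
Proof.
move=> f0 hf; apply: (is_derive_eq (der_comp (g := f) (der_inv f0) hf)).
by field.
Qed.

Lemma ld_exp (f : R -> R) (t l : R) k : is_derive t 1 f (f t * l) ->
  is_derive t 1 (fun s => f s ^+ k) (f t ^+ k * (k%:R * l)).
Proof.
move=> hf; elim: k => [|k IH].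
  by rewrite mul0r mulr0; exact: derC.
have := ld_mul hf IH; rewrite (_ : l + k%:R * l = k.+1%:R * l); last first.
  by rewrite -addn1 natrD; ring.
rewrite -exprS; under eq_fun do rewrite -exprS.
by [].
Qed.

End MoreC1.

(** * Dividing an odd function by its variable *)

Section Ratio.
Context {R : realType} (w w1 w2 : R -> R).
Hypothesis dw : forall s : R, is_derive s 1 w (w1 s).
Hypothesis dw1 : forall s : R, is_derive s 1 w1 (w2 s).
Hypothesis w_odd : forall s, w (- s) = - w s.

(** The stretching of the flow in the directions orthogonal to the radius
    involves [w s / s], which has to be continuously differentiable up to the
    centre. *)
Definition ratio (s : R) := if s == 0 then w1 0 else w s / s.
Definition ratio1 (s : R) := if s == 0 then 0 else (w1 s - ratio s) / s.

Lemma ratioE s : w s = s * ratio s.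
Proof.
rewrite /ratio; case: eqP => [->|/eqP s0]; first by rewrite mul0r odd0.
by rewrite mulrC divfK.
Qed.

Lemma ratio_even s : ratio (- s) = ratio s.
Proof.
rewrite /ratio oppr_eq0; case: eqP => // /eqP s0.
by rewrite w_odd invrN mulrNN.
Qed.

Let w20 : w2 0 = 0.
Proof. by apply: odd0; apply: derive_even dw1; exact: derive_odd dw. Qed.

Let near0 e : 0 < e -> \forall s \near (0 : R), `|w1 s - w1 0| <= e * `|s|.
Proof.
move=> e0; have /is_derive1_caratheodory[g [fg cg g0]] := dw1 0.
have {}cg : g u @[u --> (0 : R)] --> (0 : R).
  by rewrite -[X in _ --> X]w20 -g0; exact: cg.
move/cvgrPdist_le : cg => /(_ e e0) cg.
near=> s; rewrite fg subr0 normrM ler_wpM2r//.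
by rewrite -normrN -sub0r; near: s.
Unshelve. all: by end_near. Qed.

Let near0_ratio e : 0 < e -> \forall s \near (0 : R), `|ratio s - w1 0| <= e * `|s|.
Proof.
move=> e0; have /nbhs_ballP[d /= d0 hd] := near0 e0.
apply/nbhs_ballP; exists d => //= s sd.
rewrite /ratio; case: eqP => [_|/eqP s0]; first by rewrite subrr normr0 mulr_ge0// ltW.
have bound u : `|u| <= `|s| -> `|w1 u - w1 0| <= e * `|s|.
  move=> us; apply: le_trans (_ : e * `|u| <= _); last by rewrite ler_pM2l.
  apply: hd; move: sd; rewrite /ball/= !sub0r !normrN; exact: le_lt_trans.
have itv : is_interval [set u : R | `|u| <= `|s|].
  move=> x y /= xs ys z /andP[xz zy]; move: xs ys; rewrite !ler_norml.
  by move=> /andP[a1 _] /andP[_ a2]; rewrite (le_trans a1)//= (le_trans zy).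
have es : 0 <= e * `|s| by rewrite mulr_ge0// ltW.
have := @mvt_bound_sym R (fun u => w u + (- w1 0 * u + 0)) (fun u => w1 u - w1 0)
  [set u | `|u| <= `|s|] _ es itv _ bound 0 s.
rewrite /= normr0 lexx normr_ge0 => /(_ _ isT isT).
rewrite (odd0 w_odd) !mulr0 !addr0 subr0 => H.
rewrite (_ : w s / s - w1 0 = (w s + - w1 0 * s) / s); last by field.
rewrite normrM normfV ler_pdivrMr ?normr_gt0//.
apply: le_trans (H _) _.
  by move=> u _; exact: (derD (dw u) (der_affine (- w1 0) 0 u)).
by rewrite subr0.
Qed.

(** The second derivative of the odd function [w] vanishes at [0]. Hence [w1
    s - w1 0], and with it [ratio s - w1 0], is [o(s)]: the extended quotient
    has derivative [0] at [0]. *)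
Lemma der_ratio (s : R) : is_derive s 1 ratio (ratio1 s).
Proof.
have [->|s0] := eqVneq s 0.
  rewrite /ratio1 eqxx; apply/is_derive1_caratheodory.
  exists (fun u => if u == 0 then 0 else (ratio u - w1 0) / u); split.
  - move=> u; rewrite {2}/ratio eqxx subr0; case: eqP => [->|/eqP u0].
      by rewrite /ratio eqxx subrr mulr0.
    by rewrite divfK.
  - apply/cvgrPdist_le => e e0; near=> u; rewrite eqxx; case: eqP => [_|/eqP u0].
      by rewrite subrr normr0 ltW.
    rewrite sub0r normrN normrM normfV ler_pdivrMr ?normr_gt0//.
    by near: u; exact: near0_ratio.
  - by rewrite eqxx.
have d := derM (dw s) (der_inv s0).
have E : {near s, (fun u => w u * u^-1) =1 ratio}.
  near=> u; rewrite /ratio ifF//; apply/negbTE.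
  by near: u; exact: cvgr_neq0 (@cvg_id _ (nbhs s)) s0.
apply: (near_eq_is_derive E).
apply: (is_derive_eq d); rewrite /ratio1 /ratio (negbTE s0).
by field.
Unshelve. all: by end_near. Qed.

Lemma cont_ratio1 : continuous ratio1.
Proof.
move=> s; have [->|s0] := eqVneq s 0.
  apply/cvgrPdist_le => e e0; near=> u.
  rewrite /ratio1 eqxx sub0r normrN; case: eqP => [_|/eqP u0].
    by rewrite normr0 ltW.
  rewrite normrM normfV ler_pdivrMr ?normr_gt0//.
  rewrite (_ : w1 u - ratio u = (w1 u - w1 0) - (ratio u - w1 0)); last by ring.
  rewrite (le_trans (ler_normB _ _))// (splitr e) mulrDl lerD//.
    by near: u; apply: near0; rewrite divr_gt0.
  by near: u; apply: near0_ratio; rewrite divr_gt0.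
have : (w1 u - ratio u) / u @[u --> s] --> ratio1 s.
  rewrite /ratio1 (negbTE s0); apply: cvgM.
    by apply: cvgB; [exact: der_cont (dw1 s)|exact: der_cont (der_ratio s)].
  by apply: cvgV => //; exact: cvg_id.
apply: cvg_trans; apply: near_eq_cvg; near=> u.
rewrite /ratio1 ifF//; apply/negbTE.
by near: u; exact: cvgr_neq0 (@cvg_id _ (nbhs s)) s0.
Unshelve. all: by end_near. Qed.

End Ratio.

(** * The flow in Lagrangian variables *)

(** The data of the motion. The profiles are extended by parity to negative
    labels, so that the centre becomes an interior label; [mom s] is the
    initial momentum of the particle with label [s]. Only [scale_growth]
    remains of the growth of the scale factor: a power at most [1/2] of [1 +
    t]. *)
Record flow (R : realType) := Flow {
  light : R;
  scale : R -> R;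
  scale' : R -> R;
  mom : R -> R;
  mom' : R -> R;
  mom'' : R -> R;
  dens : R -> R;
  dens' : R -> R;
  light_gt0 : 0 < light;
  scale_0 : scale 0 = 1;
  scale_ge1 : forall t, 0 <= t -> 1 <= scale t;
  scale_deriv : forall t, 0 <= t -> has_deriv_within `[0, +oo[ scale t (scale' t);
  scale'_cont : {within `[0, +oo[, continuous scale'};
  scale_growth : exists2 C : R, 0 < C &
    forall t, 0 <= t -> scale t ^+ 2 <= C * (1 + t);
  mom_deriv : forall s : R, is_derive s 1 mom (mom' s);
  mom'_deriv : forall s : R, is_derive s 1 mom' (mom'' s);
  mom''_cont : continuous mom'';
  mom_odd : forall s, mom (- s) = - mom s;
  mom_bound : exists K : R, forall s, `|mom s| <= K /\ `|mom' s| <= K;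
  dens_deriv : forall s : R, is_derive s 1 dens (dens' s);
  dens'_cont : continuous dens';
  dens_even : forall s, dens (- s) = dens s;
  dens_gt0 : forall s, 0 < dens s
}.

Definition halfplane {R : realType} : set (R * R) := [set p | 0 <= p.1].

Section Lagrange.
Context {R : realType} (G : flow R).
Implicit Types (s t : R).
Local Notation c := (light G).
Local Notation a := (scale G).
Local Notation a' := (scale' G).
Local Notation w := (mom G).
Local Notation w' := (mom' G).

(** The scale factor, frozen before the initial time: the time integrals are
    primitives on a neighbourhood of [0]. *)
Definition clock t : R := a (Num.max 0 t).

Lemma clockE t : 0 <= t -> clock t = a t.
Proof. by move=> t0; rewrite /clock max_r. Qed.

Lemma clock_ge1 t : 1 <= clock t.
Proof. by rewrite /clock scale_ge1// le_max lexx. Qed.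

Lemma clock_gt0 t : 0 < clock t.
Proof. exact: lt_le_trans (clock_ge1 t). Qed.

Lemma clock_neq0 t : clock t != 0.
Proof. by rewrite lt0r_neq0// clock_gt0. Qed.

Lemma clock_cont : continuous clock.
Proof.
move=> t; have c1 : Num.max 0 u @[u --> t] --> Num.max 0 t.
  by apply: (@continuous_max _ _ (fun=> 0) id); [exact: cvg_cst|exact: cvg_id].
have m0 : 0 <= Num.max 0 t by rewrite le_max lexx.
have h := hdw_cvg (@scale_deriv R G _ m0).
apply: (cvg_comp _ _ _ h); apply: cvg_into c1 _.
by apply: (@nearW _ (nbhs t)) => u; rewrite /= in_itv/= andbT le_max lexx.
Qed.

Lemma C1_clock : C1_with halfplane (fun t _ => clock t) (fun t _ => a' t) (fun _ _ => 0).
Proof.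
have h : C1_with [set p : R * R | p.1 \in `[0, +oo[]
    (fun t _ => a t) (fun t _ => a' t) (fun _ _ => 0).
  apply: (@C1_of_fst R `[0, +oo[%classic).
    by move=> t; rewrite /= in_itv/= andbT; exact: (@scale_deriv R G t).
  exact: scale'_cont.
apply: (C1_ext (C1_sub _ h)) => [[t r]|t r]; rewrite /halfplane/= ?in_itv/= ?andbT//.
by move=> t0; rewrite clockE.
Qed.

Definition kap s : R := (w s / c) ^+ 2.
Definition kap' s : R := 2 * (w s / c) * (w' s / c).

Lemma kap_ge0 s : 0 <= kap s. Proof. exact: sqr_ge0. Qed.

Lemma der_kap s : is_derive s 1 kap (kap' s).
Proof.
have d : is_derive s 1 (fun s => w s / c) (w' s / c).
  apply: (is_derive_eq (derM (mom_deriv G s) (derC c^-1 s))).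
  by rewrite mulr0 addr0.
apply: (is_derive_eq (der_comp (g := fun s => w s / c) (derX 2 (w s / c)) d)).
by rewrite expr1.
Qed.

Lemma mom_cont : continuous w.
Proof. by move=> s; exact: der_cont (mom_deriv G s). Qed.

Lemma mom'_cont : continuous w'.
Proof. by move=> s; exact: der_cont (mom'_deriv G s). Qed.

Lemma kap'_cont : continuous kap'.
Proof.
move=> s; apply: cvgM; last by apply: cvgM; [exact: mom'_cont|exact: cvg_cst].
by apply: cvgM; [exact: cvg_cst|apply: cvgM; [exact: mom_cont|exact: cvg_cst]].
Qed.

Definition drift p t s : R := travel clock p (kap s) t.
Definition drate p t s : R := rate clock p (kap s) t.

Lemma C1_drift p : C1_with halfplane (drift p) (drate p)
  (fun t s => - (p%:R / 2) * drift p.+2 t s * kap' s).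
Proof.
have h := C1_travel clock_cont clock_ge1 p.
have k := C1_label halfplane der_kap kap'_cont.
apply: (C1_ext (C1_comp h k _)) => [t r t0|t r t0]; first by split => //; exact: kap_ge0.
by split => //; rewrite mulr0 addr0.
Qed.

Lemma drift0 p s : drift p 0 s = 0.
Proof. by have [] := travelP clock_cont clock_ge1 p (kap_ge0 s). Qed.

(** The scale factor times the Lorentz factor of the particle. *)
Definition gam t s : R := inertia clock t (kap s).

Lemma gam_ge1 t s : 1 <= gam t s. Proof. exact: inertia_ge1 (clock_ge1) _ _ (kap_ge0 s). Qed.
Lemma gam_gt0 t s : 0 < gam t s. Proof. exact: lt_le_trans (gam_ge1 t s). Qed.
Lemma gam_neq0 t s : gam t s != 0. Proof. by rewrite lt0r_neq0// gam_gt0. Qed.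
Lemma gam2 t s : gam t s ^+ 2 = clock t ^+ 2 + kap s.
Proof. exact: inertia2 clock_ge1 _ _ (kap_ge0 s). Qed.

Lemma drateE p t s : drate p t s = (clock t)^-1 * gam t s ^- p.
Proof. by []. Qed.

Lemma C1_kap : C1_with halfplane (fun _ s => kap s) (fun _ _ => 0) (fun _ s => kap' s).
Proof. exact: C1_label der_kap kap'_cont. Qed.

Lemma C1_gam : C1_with halfplane gam (fun t s => clock t * a' t / gam t s)
  (fun t s => kap' s / (2 * gam t s)).
Proof.
have C2 := C1_add (C1_mul C1_clock C1_clock) C1_kap.
have h := C1_sqrt C2; apply: (C1_ext (h _)) => t s t0.
  by rewrite -expr2 -gam2 exprn_gt0// gam_gt0.
rewrite -expr2 -/(inertia clock t (kap s)) -/(gam t s).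
by split => //; field; rewrite gam_neq0.
Qed.

Lemma C1_mom : C1_with halfplane (fun _ s => w s) (fun _ _ => 0) (fun _ s => w' s).
Proof. exact: C1_label (mom_deriv G) mom'_cont. Qed.

Lemma C1_mom' : C1_with halfplane (fun _ s => w' s) (fun _ _ => 0) (fun _ s => mom'' G s).
Proof. exact: C1_label (mom'_deriv G) (@mom''_cont _ G). Qed.

Lemma cont_label (E : set (R * R)) (f : R -> R -> R) T s : cont2 E f ->
  (forall t, 0 <= t <= T -> E (t, s)) -> {within `[0, T], continuous (fun t => f t s)}.
Proof.
move=> cf Es; apply: (cont_curve cf (f := id) (g := fun=> s)).
- by move=> u; rewrite /= in_itv/=; exact: Es.
- by apply: continuous_subspaceT => u; exact: cvg_id.
- by apply/subspace_continuousP => u _; exact: cvg_cst.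
Qed.

(** The momentum of a particle decays like [1 / a], so that its velocity is
    [w / gam] and its radius changes at the rate [w / (a * gam)]. *)
Definition path t s : R := s + w s * drift 1 t s.
(** The derivative of [path] in the label; neighbouring particles collide
    where it vanishes. *)
Definition stretch t s : R := 1 + w' s * (drift 1 t s - kap s * drift 3 t s).

Lemma C1_path : C1_with halfplane path
  (fun t s => w s / (clock t * gam t s)) stretch.
Proof.
apply: (C1_ext (C1_add (C1_snd halfplane) (C1_mul C1_mom (C1_drift 1)))) => t s t0.
have cn0 := lt0r_neq0 (light_gt0 G).
split=> //; first by rewrite drateE; field; rewrite clock_neq0 gam_neq0.
by rewrite /stretch /kap /kap'; field.
Qed.

Definition stretcht t s : R := w' s * clock t / gam t s ^+ 3.

(** The two drift terms combine because [gam ^ 2 - kap] is the square of the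
    scale factor. *)
Lemma C1_stretch : exists stretchs, C1_with halfplane stretch stretcht stretchs.
Proof.
have h := C1_add (C1_cst halfplane 1) (C1_mul C1_mom' (C1_add (C1_drift 1)
  (C1_mul (C1_cst halfplane (-1)) (C1_mul C1_kap (C1_drift 3))))).
eexists; apply: (C1_ext h) => t s t0; split; [|shelve|by []].
by rewrite /stretch; ring.
Unshelve.
rewrite !drateE /stretcht !mul0r !add0r.
have -> : kap s = gam t s ^+ 2 - clock t ^+ 2 by rewrite gam2; ring.
by field; rewrite clock_neq0 gam_neq0.
Qed.

Lemma path0 s : path 0 s = s.
Proof. by rewrite /path drift0 mulr0 addr0. Qed.

Lemma stretch0 s : stretch 0 s = 1.
Proof. by rewrite /stretch !drift0 mulr0 subr0 mulr0 addr0. Qed.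

Local Notation z := (ratio w w').
Local Notation z' := (ratio1 w w').

(** [path t s / s] up to the centre: the stretching of the flow in the
    directions orthogonal to the radius. *)
Definition spread t s : R := 1 + z s * drift 1 t s.

Lemma momE s : w s = s * z s.
Proof. exact: ratioE (@mom_odd _ G) s. Qed.

Lemma pathE t s : path t s = s * spread t s.
Proof. by rewrite /path /spread momE; ring. Qed.

Lemma path_at0 t : path t 0 = 0.
Proof. by rewrite pathE mul0r. Qed.

Lemma mom0 : w 0 = 0. Proof. by rewrite momE mul0r. Qed.

Lemma kap0 : kap 0 = 0. Proof. by rewrite /kap mom0 mul0r expr0n. Qed.

Lemma spread_at0 t : spread t 0 = stretch t 0.
Proof. by rewrite /spread /stretch kap0 mul0r subr0 /ratio eqxx. Qed.

Definition spreadt t s : R := z s / (clock t * gam t s).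

Lemma C1_spread : exists spreads, C1_with halfplane spread spreadt spreads.
Proof.
have hz := C1_label halfplane (der_ratio (mom_deriv G) (mom'_deriv G) (@mom_odd _ G))
  (cont_ratio1 (mom_deriv G) (mom'_deriv G) (@mom_odd _ G)).
eexists; apply: (C1_ext (C1_add (C1_cst halfplane 1) (C1_mul hz (C1_drift 1)))).
move=> t s t0; split; [by []|shelve|by []].
Unshelve.
by rewrite drateE /spreadt mul0r !add0r; field; rewrite clock_neq0 gam_neq0.
Qed.

Definition vel t s : R := w s / gam t s.
Definition velt t s : R := - w s * clock t * a' t / gam t s ^+ 3.
Definition vels t s : R := w' s * clock t ^+ 2 / gam t s ^+ 3.

Lemma C1_vel : C1_with halfplane vel velt vels.
Proof.
have h := C1_mul C1_mom (C1_inv C1_gam (fun t s _ => gam_neq0 t s)).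
apply: (C1_ext h) => t s t0; split => //.
  by rewrite /velt; field; rewrite gam_neq0.
have cn0 := lt0r_neq0 (light_gt0 G).
have -> : vels t s = w' s * (gam t s ^+ 2 - kap s) / gam t s ^+ 3.
  by rewrite /vels gam2; congr (_ * _ / _); ring.
by rewrite /kap /kap'; field; rewrite gam_neq0.
Qed.

Lemma vel_sq t s : c ^+ 2 - vel t s ^+ 2 = c ^+ 2 * clock t ^+ 2 / gam t s ^+ 2.
Proof.
have cn0 := lt0r_neq0 (light_gt0 G).
have -> : clock t ^+ 2 = gam t s ^+ 2 - kap s by rewrite gam2; ring.
by rewrite /vel /kap; field; rewrite gam_neq0.
Qed.

Lemma vel_lt t s : `|vel t s| < c.
Proof.
have c0 := light_gt0 G.
have : 0 < c ^+ 2 - vel t s ^+ 2.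
  rewrite vel_sq divr_gt0// ?exprn_gt0 ?gam_gt0// mulr_gt0// exprn_gt0//.
  exact: clock_gt0.
rewrite subr_gt0 -[vel t s ^+ 2]real_normK ?num_real// ltr_sqr ?nnegrE//.
exact: ltW.
Qed.

(** The momentum equation along a path, once the mass equation has been
    subtracted from it. *)
Lemma velt_ode t s : clock t * velt t s + a' t * vel t s * (1 - vel t s ^+ 2 / c ^+ 2) = 0.
Proof.
have cn0 := lt0r_neq0 (light_gt0 G).
have -> : 1 - vel t s ^+ 2 / c ^+ 2 = (c ^+ 2 - vel t s ^+ 2) / c ^+ 2 by field.
by rewrite vel_sq /velt /vel; field; rewrite cn0 gam_neq0.
Qed.

Lemma patht_vel t s : w s / (clock t * gam t s) = vel t s / clock t.
Proof. by rewrite /vel; field; rewrite clock_neq0 gam_neq0. Qed.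

(** The initial density, multiplied by the ratio of the initial Lorentz
    factor to the current one and divided by the dilution caused by the
    expansion, by the transverse stretching and by the radial stretching. *)
Definition rhol (n : nat) t s : R :=
  dens G s * Num.sqrt (1 + kap s) * clock t /
  (clock t ^+ n * gam t s * spread t s ^+ n.-1 * stretch t s).

(** The quantity [rho / (c ^ 2 - v ^ 2)] of the conservation laws, along a
    path. *)
Definition massl n t s : R := rhol n t s / (c ^+ 2 - vel t s ^+ 2).

Lemma C1_rhol n (E : set (R * R)) : E `<=` halfplane ->
  (forall t s, E (t, s) -> 0 < spread t s /\ 0 < stretch t s) ->
  C1_on E (rhol n).
Proof.
move=> EH pos.
have sub f ft fr : C1_with halfplane f ft fr -> C1_on E f.
  by move=> H; exact: C1_exists (C1_sub EH H).
have cc := sub _ _ _ C1_clock.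
have cd := sub _ _ _ (C1_label halfplane (dens_deriv G) (@dens'_cont _ G)).
have cg := sub _ _ _ C1_gam.
have cs : C1_on E (fun t s : R => Num.sqrt (1 + kap s)).
  apply: sub; apply: C1_sqrt (C1_add (C1_cst halfplane 1) C1_kap) _ => t s _.
  by rewrite ltr_wpDr// kap_ge0.
have [? /sub cS] := C1_stretch; have [? /sub cQ] := C1_spread.
apply: C1_on_mul; first by apply: C1_on_mul => //; exact: C1_on_mul.
apply: C1_on_inv.
  apply: C1_on_mul => //; apply: C1_on_mul; last exact: C1_on_exp.
  by apply: C1_on_mul => //; exact: C1_on_exp.
move=> t s /pos[Q0 J0].
by rewrite !mulf_neq0 ?expf_neq0 ?clock_neq0 ?gam_neq0 ?lt0r_neq0.
Qed.

Lemma C1_dt (f ft fr : R -> R -> R) t s : C1_with halfplane f ft fr -> 0 < t ->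
  is_derive t 1 (fun t => f t s) (ft t s).
Proof.
move=> Cf t0; have t0' := ltW t0.
have A t1 : `[0, +oo[%classic t1 -> halfplane (t1, s).
  by rewrite /= in_itv/= andbT.
have tA : `[0, +oo[%classic t by rewrite /= in_itv/= andbT.
have := hdw_curve Cf tA A (@hdw_id _ _ t) (@hdw_cst _ _ s t).
rewrite mulr1 mulr0 addr0; apply: hdw_is_derive.
near=> u; rewrite /= in_itv/= andbT ltW//.
by near: u; exact: lt_nbhsr.
Unshelve. all: by end_near. Qed.

(** The mass equation along a path: [vels / stretch] is the radial derivative
    of the velocity, and [z / (gam * spread)] is the velocity divided by the
    radius, so the first two terms are the divergence of the velocity field.
    The identity is the sum of the logarithmic derivatives of the factors of
    [massl]. *)
Lemma massl_ode n t s : 0 < t -> 0 < spread t s -> 0 < stretch t s ->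
  is_derive t 1 (fun t => massl n t s)
    (- massl n t s * (vels t s / stretch t s / clock t
      + n.-1%:R * (z s / (gam t s * spread t s)) / clock t
      + n%:R * a' t / clock t + a' t * vel t s ^+ 2 / (c ^+ 2 * clock t))).
Proof.
move=> t0 Q0 J0; have cn0 := lt0r_neq0 (light_gt0 G).
have [Qn Jn] := (lt0r_neq0 Q0, lt0r_neq0 J0).
have [An gn] := (clock_neq0 t, gam_neq0 t s).
have [JS CJ] := C1_stretch; have [QS CQ] := C1_spread.
have lA : is_derive t 1 clock (clock t * (a' t / clock t)).
  by rewrite mulrC divfK//; exact: (C1_dt 0 C1_clock t0).
have lg : is_derive t 1 (fun t => gam t s) (gam t s * (clock t * a' t / gam t s ^+ 2)).
  by apply: (is_derive_eq (C1_dt s C1_gam t0)); field.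
have lQ : is_derive t 1 (fun t => spread t s) (spread t s * (spreadt t s / spread t s)).
  by rewrite mulrC divfK//; exact: C1_dt s CQ t0.
have lJ : is_derive t 1 (fun t => stretch t s) (stretch t s * (stretcht t s / stretch t s)).
  by rewrite mulrC divfK//; exact: C1_dt s CJ t0.
have v0 : c ^+ 2 - vel t s ^+ 2 != 0.
  by rewrite vel_sq !mulf_neq0 ?invr_neq0 ?expf_neq0.
have lv : is_derive t 1 (fun t => c ^+ 2 - vel t s ^+ 2)
    ((c ^+ 2 - vel t s ^+ 2) * (- (2 * vel t s * velt t s) / (c ^+ 2 - vel t s ^+ 2))).
  have d := der_comp (g := fun t => vel t s) (derX 2 (vel t s)) (C1_dt s C1_vel t0).
  have E : (fun t => c ^+ 2 - vel t s ^+ 2) = (fun t => c ^+ 2 + -1 * vel t s ^+ 2).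
    by apply/funext => u; rewrite mulN1r.
  rewrite {1}E; apply: (is_derive_eq (derD (derC (c ^+ 2) t) (derM (derC (-1) t) d))).
  by rewrite expr1; field.
have lc : is_derive t 1 (fun=> dens G s * Num.sqrt (1 + kap s))
    (dens G s * Num.sqrt (1 + kap s) * 0) by rewrite mulr0; exact: derC.
have Dn0 : clock t ^+ n * gam t s * spread t s ^+ n.-1 * stretch t s != 0.
  by rewrite !mulf_neq0 ?expf_neq0.
have D1 := ld_mul (f := fun t => clock t ^+ n * gam t s * spread t s ^+ n.-1)
  (ld_mul (f := fun t => clock t ^+ n * gam t s) (ld_mul (f := fun t => clock t ^+ n)
   (ld_exp n lA) lg) (ld_exp n.-1 lQ)) lJ.
have D2 := ld_inv (f := fun t => clock t ^+ n * gam t s * spread t s ^+ n.-1 * stretch t s) Dn0 D1.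
have D3 := ld_mul (f := fun t => dens G s * Num.sqrt (1 + kap s) * clock t) (ld_mul lc lA) D2.
have D4 := ld_mul (f := fun t => rhol n t s) D3 (ld_inv (f := fun t => c ^+ 2 - vel t s ^+ 2) v0 lv).
apply: (is_derive_eq D4).
rewrite -/(rhol n t s) -/(massl n t s) [RHS]mulNr -[RHS]mulrN; congr (_ * _).
have E1 : - (2 * vel t s * velt t s) / (c ^+ 2 - vel t s ^+ 2) =
    2 * (vel t s ^+ 2 * a' t) / (c ^+ 2 * clock t).
  by rewrite vel_sq /velt /vel; field; rewrite cn0 An gn.
have E2 : vel t s ^+ 2 = c ^+ 2 * (gam t s ^+ 2 - clock t ^+ 2) / gam t s ^+ 2.
  have <- : kap s = gam t s ^+ 2 - clock t ^+ 2 by rewrite gam2; ring.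
  by rewrite /vel /kap; field; rewrite cn0 gn.
rewrite E1 E2 /stretcht /spreadt /vels.
by field; rewrite cn0 An gn Qn Jn.
Qed.

(** The stretch of a label with [w' < 0] vanishes exactly when [squeeze]
    reaches [- 1 / w']. *)
Definition squeeze t s : R := drift 1 t s - kap s * drift 3 t s.

Lemma stretchE t s : stretch t s = 1 + w' s * squeeze t s.
Proof. by []. Qed.

Lemma der_drift p t s : 0 <= t -> is_derive t 1 (fun t => drift p t s) (drate p t s).
Proof.
move=> t0; have [_ d] := travelP clock_cont clock_ge1 p (kap_ge0 s).
by apply: d; rewrite (lt_le_trans _ t0)// ltrN10.
Qed.

Lemma der_squeeze t s : 0 <= t ->
  is_derive t 1 (fun t => squeeze t s) (clock t / gam t s ^+ 3).
Proof.
move=> t0; have E : (fun t => squeeze t s) = (fun t => drift 1 t s + - kap s * drift 3 t s).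
  by apply/funext => u; rewrite mulNr.
rewrite E; apply: (is_derive_eq (derD (der_drift 1 s t0)
  (derM (derC (- kap s) t) (der_drift 3 s t0)))).
rewrite !drateE (_ : kap s = gam t s ^+ 2 - clock t ^+ 2); last by rewrite gam2; ring.
by field; rewrite clock_neq0 gam_neq0.
Qed.

Lemma clock_le_gam t s : clock t <= gam t s.
Proof.
rewrite -ler_sqr ?nnegrE ?(ltW (clock_gt0 _)) ?(ltW (gam_gt0 _ _))//.
by rewrite gam2 lerDl kap_ge0.
Qed.

Lemma squeeze_rate t s : 0 < clock t / gam t s ^+ 3 <= 1.
Proof.
have [A0 g0] := (clock_gt0 t, gam_gt0 t s).
rewrite divr_gt0 ?exprn_gt0//= ler_pdivrMr ?exprn_gt0// mul1r.
rewrite (le_trans (clock_le_gam t s))// exprS ler_peMr ?(ltW g0)//.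
by rewrite exprn_ege1// gam_ge1.
Qed.

Lemma squeeze0 s : squeeze 0 s = 0.
Proof. by rewrite /squeeze !drift0 mulr0 subr0. Qed.

Lemma squeeze_cont (u v s : R) : 0 <= u -> {within `[u, v], continuous (fun t => squeeze t s)}.
Proof.
move=> u0; apply/subspace_continuousP => t; rewrite /= in_itv/= => /andP[ut _].
apply: cvg_within_filter; apply: der_cont (der_squeeze s _).
exact: le_trans ut.
Qed.

Lemma squeeze_incr (u v s : R) : 0 <= u -> u < v -> squeeze u s < squeeze v s.
Proof.
move=> u0 uv.
have [|x] := @MVT R (fun t => squeeze t s) (fun t => clock t / gam t s ^+ 3) u v uv _
  (@squeeze_cont u v s u0).
  move=> x; rewrite in_itv/= => /andP[ux _]; apply: der_squeeze.
  by rewrite ltW// (le_lt_trans u0).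
rewrite in_itv/= => _ E; rewrite -subr_gt0 E mulr_gt0 ?subr_gt0//.
by have /andP[] := squeeze_rate x s.
Qed.

Lemma squeeze_lip (u v s : R) : 0 <= u -> u <= v ->
  `|squeeze v s - squeeze u s| <= v - u.
Proof.
move=> u0 uv; rewrite -[v - u]mul1r.
apply: (@mvt_bound R (fun t => squeeze t s) (fun t => clock t / gam t s ^+ 3)) => //.
- by move=> x /andP[ux _]; apply: der_squeeze; exact: le_trans ux.
- move=> x _; have /andP[h0 h1] := squeeze_rate x s.
  by rewrite ger0_norm// ltW.
Qed.

Lemma squeeze_ge0 t s : 0 <= t -> 0 <= squeeze t s.
Proof.
rewrite le_eqVlt => /orP[/eqP <-|t0]; first by rewrite squeeze0.
by rewrite ltW// -[X in X < _](squeeze0 s) squeeze_incr.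
Qed.

(** Since [gam] is at most a constant times the scale factor, the rate of
    [squeeze] is at least a constant times [1 / a ^ 2], hence by
    [scale_growth] at least a constant times [1 / (1 + t)], whose integral is
    a logarithm. A faster expansion could prevent the collapse at this point. *)
Lemma squeeze_unbounded s (M : R) : exists2 t : R, 0 < t & M <= squeeze t s.
Proof.
have [C C0 HC] := scale_growth G.
have k0 := kap_ge0 s; pose q := Num.sqrt (1 + kap s).
have q1 : 1 <= q by rewrite -[leLHS]sqrtr1 ler_wsqrtr// lerDl.
have q0 : 0 < q by exact: lt_le_trans q1.
pose k := (q ^+ 3 * C)^-1.
have kk : 0 < k by rewrite invr_gt0 mulr_gt0// exprn_gt0.
have lb t : 0 <= t -> k * (1 + t)^-1 <= clock t / gam t s ^+ 3.
  move=> t0; have [A0 g0] := (clock_gt0 t, gam_gt0 t s).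
  have gq : gam t s <= q * clock t.
    have h1 := ltW q0; have h2 := ltW A0; have h3 := ltW g0.
    rewrite -ler_sqr ?nnegrE ?mulr_ge0// gam2 exprMn sqr_sqrtr ?addr_ge0//.
    by rewrite mulrDl mul1r lerD2l ler_peMr// exprn_ege1// clock_ge1.
  have t1 : 0 < 1 + t by rewrite ltr_pwDl.
  rewrite /k -invfM ler_pdivlMr ?exprn_gt0// ler_pdivrMl ?mulr_gt0 ?exprn_gt0//.
  apply: le_trans (_ : (q * clock t) ^+ 3 <= _).
    by rewrite lerXn2r ?nnegrE ?mulr_ge0 ?(ltW q0) ?(ltW A0) ?(ltW g0).
  rewrite exprMn exprSr -!mulrA ler_pM2l ?exprn_gt0// !mulrA ler_pM2r//.
  rewrite -!mulrA !ler_pM2l//.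
  by have := HC t t0; rewrite clockE// expr2.
have inc t : 0 <= t -> k * ln (1 + t) <= squeeze t s.
  move=> t0.
  have dl (x : R) : 0 <= x -> is_derive x 1 (fun x => squeeze x s + - k * ln (1 + x))
      (clock x / gam x s ^+ 3 - k * (1 + x)^-1).
    move=> x0; have x1 : 0 < 1 + x by rewrite ltr_pwDl.
    have d1 : is_derive x 1 (fun x => 1 + x) 1.
      by apply: (is_derive_eq (derD (derC 1 x) (der_id x))); rewrite add0r.
    have d2 := der_comp (g := fun x => 1 + x) (is_derive1_ln x1) d1.
    apply: (is_derive_eq (derD (der_squeeze s x0) (derM (derC (- k) x) d2))).
    by rewrite mulr1; ring.
  have cl : {within `[0, t], continuous (fun x => squeeze x s + - k * ln (1 + x))}.
    apply/subspace_continuousP => x; rewrite /= in_itv/= => /andP[x0 _].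
    by apply: cvg_within_filter; apply: der_cont (dl x x0).
  have [x|x] := MVT_segment t0 (df := fun x => clock x / gam x s ^+ 3 - k * (1 + x)^-1) _ cl.
    by rewrite in_itv/= => /andP[x0 _]; apply: dl; rewrite ltW.
  rewrite in_itv/= => /andP[x0 _].
  rewrite squeeze0 addr0 ln1 mulr0 add0r !subr0 => E.
  have : 0 <= squeeze t s + - k * ln (1 + t).
    by rewrite E mulr_ge0// subr_ge0 lb.
  by rewrite mulNr subr_ge0.
exists (expR (`|M| / k)); first exact: expR_gt0.
have e0 := expR_gt0 (`|M| / k).
apply: le_trans (inc _ (ltW e0)); apply: le_trans (ler_norm M) _.
rewrite -ler_pdivrMl// mulrC -[leLHS]expRK ler_ln ?posrE ?ltr_pwDl ?(ltW e0)//.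
by rewrite lerDr.
Qed.

Lemma path_bound : exists2 K : R, 0 < K & forall t s, 0 <= t -> `|path t s - s| <= K * t.
Proof.
have [K HK] := mom_bound G.
have K0 : 0 <= K by have [h _] := HK 0; exact: le_trans h.
exists (K + 1) => [|t s t0]; first by rewrite ltr_wpDl.
have db : `|drift 1 t s| <= t.
  have := @mvt_bound R (fun t => drift 1 t s) (fun t => drate 1 t s) 0 t 1 ler01 t0.
  rewrite drift0 !subr0 mul1r; apply => [x /andP[x0 _]|x _]; first exact: der_drift.
  by have /andP[h0 h1] := rate_bound clock_ge1 1 x (kap_ge0 s); rewrite ger0_norm.
have [h _] := HK s; rewrite /path addrAC subrr add0r normrM ler_pM//.
by rewrite (le_trans h)// lerDl.
Qed.

Lemma kap_even s : kap (- s) = kap s.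
Proof. by rewrite /kap mom_odd mulNr sqrrN. Qed.

Lemma mom'_even s : w' (- s) = w' s.
Proof. exact: (derive_odd (@mom_odd _ G) (mom_deriv G)). Qed.

(** Evenness in the label is what makes the density differentiable across the
    origin. *)
Lemma rhol_even n t s : rhol n t (- s) = rhol n t s.
Proof.
rewrite /rhol /stretch /spread /gam /drift kap_even mom'_even dens_even.
by rewrite ratio_even//; exact: mom_odd.
Qed.

Lemma gam0 s : gam 0 s = Num.sqrt (1 + kap s).
Proof. by rewrite /gam /inertia clockE// scale_0 expr1n. Qed.

Lemma rhol0 n s : rhol n 0 s = dens G s.
Proof.
rewrite /rhol /spread drift0 mulr0 addr0 stretch0 gam0 clockE// scale_0 !expr1n.
rewrite !mul1r !mulr1 mulfK//.
by rewrite lt0r_neq0// sqrtr_gt0 ltr_wpDr// kap_ge0.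
Qed.

Lemma vel0 s : vel 0 s = w s / Num.sqrt (1 + kap s).
Proof. by rewrite /vel gam0. Qed.

Lemma vel_at0 t : vel t 0 = 0.
Proof. by rewrite /vel mom0 mul0r. Qed.

End Lagrange.

(** * Inverting the flow *)

Section Inverse.
Context {R : realType}.

(** Implicit differentiation of [F t (g t r) = r]. The increments of [F]
    along the graph of [g] are increments of [r], so Carathéodory's identity
    for [F] can be solved for the increment of [g]; continuity of [g] makes
    the resulting slopes converge. *)
Lemma C1_inverse (D H : set (R * R)) (F Ft Fr g : R -> R -> R) :
  C1_with H F Ft Fr -> cont2 D g ->
  (forall t r, D (t, r) -> [/\ H (t, g t r), F t (g t r) = r & Fr t (g t r) != 0]) ->
  C1_with D g (fun t r => - Ft t (g t r) / Fr t (g t r))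
    (fun t r => (Fr t (g t r))^-1).
Proof.
move=> /C1_withP[cFt cFr sF] cg DH.
have DH1 t r : D (t, r) -> H (t, g t r) by case/DH.
have cv p (Dp : D p) := cvg_graph cg DH1 Dp.
have Hp p : D p -> H (p.1, g p.1 p.2).
  by move=> Dp; apply: DH1; rewrite -surjective_pairing.
have Fr0 p : D p -> Fr p.1 (g p.1 p.2) != 0.
  by case: p => t r Dp; have [] := DH _ _ Dp.
have cFt' : cont2 D (fun t r => Ft t (g t r)).
  by move=> p Dp; exact: (cvg_comp _ _ (cv p Dp) (cFt _ (Hp p Dp))).
have cFr' : cont2 D (fun t r => Fr t (g t r)).
  by move=> p Dp; exact: (cvg_comp _ _ (cv p Dp) (cFr _ (Hp p Dp))).
apply/C1_withP; split.
- move=> p Dp; apply: cvgM; first by apply: cvgN; exact: cFt'.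
  by apply: cvgV; [exact: Fr0|exact: cFr'].
- by move=> p Dp; apply: cvgV; [exact: Fr0|exact: cFr'].
move=> p Dp; have [A [B [Ax By AB]]] := sF _ (Hp _ Dp).
have cA : A (q.1, g q.1 q.2) @[q --> within D (nbhs p)] --> Ft p.1 (g p.1 p.2).
  exact: (cvg_comp _ _ (cv p Dp) Ax).
have cB : B (q.1, g q.1 q.2) @[q --> within D (nbhs p)] --> Fr p.1 (g p.1 p.2).
  exact: (cvg_comp _ _ (cv p Dp) By).
exists (fun q => - A (q.1, g q.1 q.2) / B (q.1, g q.1 q.2)),
  (fun q => (B (q.1, g q.1 q.2))^-1); split.
- by apply: cvgM; [exact: cvgN|apply: cvgV => //; exact: Fr0].
- by apply: cvgV => //; exact: Fr0.
have := cv p Dp _ AB; rewrite /= nbhs_simpl/= => {}AB.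
near=> q.
have Dq : D q by near: q; exact: withinT.
have B0 : B (q.1, g q.1 q.2) != 0 by near: q; exact: cvgr_neq0 cB (Fr0 _ Dp).
have E : F q.1 (g q.1 q.2) - F p.1 (g p.1 p.2) =
   A (q.1, g q.1 q.2) * (q.1 - p.1) + B (q.1, g q.1 q.2) * (g q.1 q.2 - g p.1 p.2).
  by near: q; exact: AB.
have Fg u : D u -> F u.1 (g u.1 u.2) = u.2.
  by case: u => t r Du; have [] := DH _ _ Du.
rewrite !Fg// in E.
apply: (mulfI B0).
transitivity (q.2 - p.2 - A (q.1, g q.1 q.2) * (q.1 - p.1)); first by rewrite E; ring.
by field.
Unshelve. all: by end_near. Qed.

End Inverse.

Section Labels.
Context {R : realType} (G : flow R).
Implicit Types (t r s : R) (E : set (R * R)).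
Local Notation c := (light G).
Local Notation w := (mom G).
Local Notation w' := (mom' G).
Local Notation path := (path G).
Local Notation stretch := (stretch G).
Local Notation spread := (spread G).

(** Regions of labels over which the flow is invertible. Being closed under
    smaller labels, with positive stretch, they make [path t] increasing on
    their time slices; being closed under earlier times, they contain the
    past of their particles. *)
Record label_set E : Prop := LabelSet {
  ls_quadrant : E `<=` quadrant;
  ls_open : forall p, E p -> \forall q \near p, quadrant q -> E q;
  ls_down : forall t s t' s', E (t, s) -> 0 <= t' <= t -> 0 <= s' <= s -> E (t', s');
  ls_init : forall s, 0 <= s -> E (0, s);
  ls_stretch : forall t s, E (t, s) -> 0 < stretch t s }.

Definition swept E : set (R * R) :=
  [set p | exists s, E (p.1, s) /\ path p.1 s = p.2].

(** The label of the particle that is at radius [r] at time [t]. *)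
Definition lab E t r : R := xget 0 [set s | E (t, s) /\ path t s = r].

Lemma der_path t s : 0 <= t -> is_derive s 1 (path t) (stretch t s).
Proof.
move=> t0; have A (u : R) : setT u -> @halfplane R (t, u) by [].
have := hdw_curve (C1_path G) (I : setT s) A (@hdw_cst _ _ t s) (@hdw_id _ _ s).
rewrite mulr0 mulr1 add0r; apply: hdw_is_derive; exact: filterT.
Qed.

Lemma path_mvt t (u v : R) : 0 <= t -> u < v ->
  exists2 x, u < x < v & path t v - path t u = stretch t x * (v - u).
Proof.
move=> t0 uv; have [|x] := MVT uv (df := stretch t) (fun x _ => der_path x t0).
  apply/subspace_continuousP => x _; apply: cvg_within_filter.
  exact: der_cont (der_path x t0).
by rewrite in_itv/= => xuv E; exists x.
Qed.

Variable E : set (R * R).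
Hypothesis LE : label_set E.

Lemma ls_ge0 t s : E (t, s) -> 0 <= t /\ 0 <= s.
Proof. by move=> /(ls_quadrant LE). Qed.

Lemma ls_between t s x : E (t, s) -> 0 <= x <= s -> E (t, x).
Proof.
move=> Ets xs; apply: (ls_down LE Ets) => //.
by rewrite lexx andbT; have [] := ls_ge0 Ets.
Qed.

Lemma path_incr t (u v : R) : 0 <= u -> u < v -> E (t, v) -> path t u < path t v.
Proof.
move=> u0 uv Ev; have [t0 _] := ls_ge0 Ev; have [x /andP[ux xv] eq] := path_mvt t0 uv.
rewrite -subr_gt0 eq mulr_gt0 ?subr_gt0//; apply: (ls_stretch LE).
by apply: ls_between Ev _; rewrite (ltW xv) andbT (le_trans u0)// ltW.
Qed.

(** [s * spread t s] is [path t s], which increases from [0]. *)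
Lemma ls_spread t s : E (t, s) -> 0 < spread t s.
Proof.
move=> Es; have [t0 s0] := ls_ge0 Es.
move: s0; rewrite le_eqVlt => /orP[/eqP s0|s0].
  by rewrite -s0 spread_at0; apply: (ls_stretch LE); rewrite s0.
have := path_incr (lexx 0) s0 Es.
by rewrite path_at0 pathE pmulr_rgt0.
Qed.

Lemma path_ge0 t s : E (t, s) -> 0 <= path t s.
Proof.
move=> Es; have [t0 s0] := ls_ge0 Es.
by rewrite pathE mulr_ge0// ltW// ls_spread.
Qed.

Lemma path_inj t (u v : R) : E (t, u) -> E (t, v) -> path t u = path t v -> u = v.
Proof.
move=> Eu Ev uv; have [_ u0] := ls_ge0 Eu; have [_ v0] := ls_ge0 Ev.
case: (ltgtP u v) => // h.
  by have := path_incr u0 h Ev; rewrite uv ltxx.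
by have := path_incr v0 h Eu; rewrite uv ltxx.
Qed.

Lemma labP t r : swept E (t, r) -> E (t, lab E t r) /\ path t (lab E t r) = r.
Proof.
by move=> [s /= [Es ps]]; rewrite /lab; case: xgetP => [x _ //|/(_ s) []].
Qed.

Lemma sweptP t s : E (t, s) -> swept E (t, path t s).
Proof. by move=> Es; exists s. Qed.

Lemma lab_path t s : E (t, s) -> lab E t (path t s) = s.
Proof.
by move=> Es; have [h1 h2] := labP (sweptP Es); exact: path_inj h2.
Qed.

Lemma swept_quadrant : swept E `<=` quadrant.
Proof.
move=> [t r] /labP[Es <-]; have [t0 s0] := ls_ge0 Es.
by split => //=; exact: path_ge0.
Qed.

Lemma path_cont2 : cont2 halfplane path. Proof. exact: C1_cont (C1_path G). Qed.

Lemma near_path (F : set_system (R * R)) {FF : Filter F} (p : R * R) s :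
  fst @ F --> p.1 -> (\forall q \near F, 0 <= q.1) -> 0 <= p.1 ->
  path q.1 s @[q --> F] --> path p.1 s.
Proof.
move=> F1 Fq p0.
have cv : (fun q : R * R => (q.1, s)) @ F --> within halfplane (nbhs (p.1, s)).
  by apply: cvg_into => //; exact: (cvg_pair F1 (cvg_cst s)).
exact: (cvg_comp _ _ cv (@path_cont2 (p.1, s) p0)).
Qed.

Lemma near_label t s : E (t, s) -> \forall q \near (t, s), 0 <= q.1 -> 0 <= q.2 -> E q.
Proof. by move=> /(ls_open LE); apply: filterS => q h q1 q2; exact: h. Qed.

Lemma near_label_fst t s (p : R * R) : p.1 = t -> E (t, s) ->
  \forall q \near p, 0 <= q.1 -> E (q.1, s).
Proof.
move=> pt Es; have [t0 s0] := ls_ge0 Es.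
have cvp : (fun q : R * R => (q.1, s)) @ p --> (t, s).
  by rewrite -pt; exact: (cvg_pair (@cvg_fst _ _ (nbhs p.1) (nbhs p.2) _) (cvg_cst s)).
have := cvp _ (near_label Es); rewrite /= nbhs_simpl/=.
by apply: filterS => q h q0; exact: h.
Qed.

(** Relative openness leaves room above every label, which lets the label of
    a nearby position be bracketed from above. *)
Lemma label_above t s e : E (t, s) -> 0 < e ->
  exists2 s', s < s' <= s + e & E (t, s').
Proof.
move=> Es e0; have [t0 s0] := ls_ge0 Es.
have cvp : (fun u : R => (t, u)) @ s --> (t, s) by exact: (cvg_pair (cvg_cst t) cvg_id).
have := cvp _ (near_label Es); rewrite /= nbhs_simpl/= => /nbhs_ballP[d /= d0 hd].
pose m := Num.min (d / 2) e.
have m0 : 0 < m by rewrite lt_min e0 divr_gt0.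
exists (s + m); first by rewrite ltrDl m0/= lerD2l ge_min lexx orbT.
apply: hd => //=; last by rewrite addr_ge0// ltW.
rewrite /ball/= opprD addNKr normrN gtr0_norm// gt_min.
by rewrite ltr_pdivrMr// ltr_pMr// ltr1n.
Qed.

Lemma swept_above (p : R * R) s : p.1 >= 0 -> E (p.1, s) -> p.2 < path p.1 s ->
  \forall q \near p, 0 <= q.1 -> E (q.1, s) /\ q.2 < path q.1 s.
Proof.
move=> p0 Es ps.
have h1 := near_label_fst (erefl p.1) Es.
have h2 : \forall q \near within halfplane (nbhs p), 0 < path q.1 s - q.2.
  have cv : path q.1 s - q.2 @[q --> within halfplane (nbhs p)] --> path p.1 s - p.2.
    apply: cvgB; last exact: cvg_snd_within.
    apply: (near_path (p := p)) => //; [exact: cvg_fst_within|exact: (withinT halfplane (nbhs_filter p))].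
  by apply: (cvgr_gt _ cv); rewrite subr_gt0.
move: h2; rewrite near_withinE => h2.
apply: filterS2 h1 h2 => q h1 h2 q0; split; first exact: h1.
by have := h2 q0; rewrite subr_gt0.
Qed.

(** Monotonicity replaces the inverse function theorem: positions close to
    [(t0, r0)] lie between those of two fixed labels around [s0], which
    therefore bracket their own labels. *)
Lemma lab_cont : cont2 (swept E) (lab E).
Proof.
move=> [t0 r0] Dp /=; have [Es ps] := labP Dp; set s0 := lab E t0 r0 in Es ps *.
have [tge sge] := ls_ge0 Es.
apply/cvgrPdist_le => e e0.
have [sp /andP[sp1 sp2] Esp] := label_above Es e0.
have H1 := @swept_above (t0, r0) sp tge Esp.
have {}H1 := H1 ltac:(by rewrite /= -ps; exact: path_incr).
pose sm := Num.max 0 (s0 - e).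
have {}H1 : \forall q \near within (swept E) (nbhs (t0, r0)), lab E q.1 q.2 < sp.
  rewrite near_withinE; apply: filterS H1 => -[t r] /= H Dq.
  have [Eq pq] := labP Dq; have [q0 _] := ls_ge0 Eq; have [Esp' lt] := H q0.
  rewrite ltNge; apply/negP => le; move: lt; rewrite -pq.
  move: le; rewrite le_eqVlt => /orP[/eqP <-|le]; first by rewrite ltxx.
  by rewrite ltNge ltW// path_incr//; have [_] := ls_ge0 Esp'.
have H2 : \forall q \near within (swept E) (nbhs (t0, r0)), sm <= lab E q.1 q.2.
  (* Nothing lies below the central label, which is its own lower bracket. *)
  have [s00|s0pos] := eqVneq s0 0.
    have -> : sm = 0 by rewrite /sm s00 sub0r max_l// oppr_le0 ltW.
    near=> q; have Dq : swept E q by near: q; exact: withinT.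
    by move: Dq; rewrite [X in swept E X]surjective_pairing => /labP[/ls_ge0[]].
  have sm0 : 0 <= sm by rewrite le_max lexx.
  have sms : sm < s0 by rewrite gt_max lt0r s0pos sge/= ltrBlDr ltrDl.
  have Em : E (t0, sm) by apply: ls_between Es _; rewrite sm0 ltW.
  have cv : q.2 - path q.1 sm @[q --> within (swept E) (nbhs (t0, r0))] --> r0 - path t0 sm.
    apply: cvgB; first exact: (@cvg_snd_within _ _ (t0, r0)).
    apply: (near_path (p := (t0, r0))) => //; first exact: cvg_fst_within.
    near=> q; have Dq : swept E q by near: q; exact: withinT.
    by have [] := swept_quadrant Dq.
  have : \forall q \near within (swept E) (nbhs (t0, r0)), 0 < q.2 - path q.1 sm.
    by apply: (cvgr_gt _ cv); rewrite subr_gt0 -ps path_incr.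
  rewrite !near_withinE; have H3 := @near_label_fst t0 sm (t0, r0) erefl Em.
  apply: filterS2 H3 => -[t r] /= H3 H Dq.
  have [Eq pq] := labP Dq; have [q0 l0] := ls_ge0 Eq.
  rewrite leNgt; apply/negP => lt; have := H Dq; rewrite -{1}pq subr_gt0.
  by rewrite ltNge ltW//; apply: path_incr => //; exact: H3.
near=> q.
have h1 : lab E q.1 q.2 < sp by near: q; exact: H1.
have h2 : sm <= lab E q.1 q.2 by near: q; exact: H2.
rewrite distrC ler_norml; apply/andP; split.
  rewrite lerBrDr addrC (le_trans _ h2)// /sm le_max lexx orbT//.
by rewrite lerBlDl (le_trans (ltW h1)).
Unshelve. all: by end_near. Qed.

(** The intermediate value theorem, between the centre and a label slightly
    above the given one. *)
Lemma swept_open p : swept E p -> \forall q \near p, quadrant q -> swept E q.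
Proof.
case: p => t0 r0 Dp; have [Es ps] := labP Dp; have [tge sge] := ls_ge0 Es.
have [sp /andP[sp1 sp2] Esp] := label_above Es ltr01.
have := @swept_above (t0, r0) sp tge Esp ltac:(by rewrite /= -ps; exact: path_incr).
apply: filterS => -[t r] /= H [/= q0 r0'].
have [Eq lt] := H q0; have [_ sp0] := ls_ge0 Eq.
have cp : {within `[0, sp], continuous (path t)}.
  apply/subspace_continuousP => x _; apply: cvg_within_filter.
  exact: der_cont (der_path x q0).
have [|s] := IVT sp0 cp (v := r).
  by rewrite path_at0 ge_min r0'/= le_max (ltW lt) orbT.
rewrite in_itv/= => s01 <-; exists s; split => //=.
exact: ls_between Eq _.
Qed.

Lemma C1_lab : C1_with (swept E) (lab E)
  (fun t r => - vel G t (lab E t r) / clock G t / stretch t (lab E t r))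
  (fun t r => (stretch t (lab E t r))^-1).
Proof.
have H t r : swept E (t, r) -> [/\ halfplane (t, lab E t r),
    path t (lab E t r) = r & stretch t (lab E t r) != 0].
  move=> Dtr; have [Es ps] := labP Dtr; have [t0 s0] := ls_ge0 Es; split => //.
  by rewrite lt0r_neq0//; exact: ls_stretch Es.
apply: (C1_ext (C1_inverse (C1_path G) lab_cont H)) => t r Dtr.
by split; rewrite ?patht_vel ?mulNr.
Qed.

(** * The flow in Eulerian variables *)

Definition erho n t r : R := rhol G n t (lab E t r).
Definition evel t r : R := vel G t (lab E t r).
Definition evelt t r : R := velt G t (lab E t r) + vels G t (lab E t r) *
  (- vel G t (lab E t r) / clock G t / stretch t (lab E t r)).
Definition evelr t r : R := vels G t (lab E t r) / stretch t (lab E t r).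

Lemma lab_half t r : swept E (t, r) -> halfplane (t, lab E t r).
Proof. by move=> /labP[/ls_ge0[]]. Qed.

Lemma C1_evel : C1_with (swept E) evel evelt evelr.
Proof. exact: C1_comp (C1_vel G) C1_lab lab_half. Qed.

Lemma C1_erho n : C1_on (swept E) (erho n).
Proof.
have h : C1_on E (rhol G n).
  apply: C1_rhol => [[t s] /ls_ge0[]//|t s Es].
  by split; [exact: ls_spread|exact: ls_stretch Es].
apply: (C1_on_comp h (C1_exists C1_lab)) => t r Dtr.
by have [] := labP Dtr.
Qed.

Lemma evel_lt t r : `|evel t r| < c. Proof. exact: vel_lt. Qed.

Lemma evel_path t s : E (t, s) -> evel t (path t s) = vel G t s.
Proof. by move=> Es; rewrite /evel lab_path. Qed.

Lemma erho_path n t s : E (t, s) -> erho n t (path t s) = rhol G n t s.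
Proof. by move=> Es; rewrite /erho lab_path. Qed.

Lemma evelr_path t s : E (t, s) -> evelr t (path t s) = vels G t s / stretch t s.
Proof. by move=> Es; rewrite /evelr lab_path. Qed.

Lemma lab0 r : 0 <= r -> lab E 0 r = r.
Proof. by move=> r0; rewrite -{1}[r](path0 G) lab_path//; exact: ls_init. Qed.

Lemma lab_at0 t r : swept E (t, r) -> lab E t 0 = 0.
Proof.
move=> /labP[Es _]; have [t0 s0] := ls_ge0 Es.
rewrite -{1}(path_at0 G t) lab_path//.
by apply: ls_between Es _; rewrite lexx.
Qed.

Lemma swept_init r : 0 <= r -> swept E (0, r).
Proof. by move=> r0; exists r; split; [exact: ls_init|exact: path0]. Qed.

End Labels.

(** * Relatively open regions of the quadrant *)

Section RelativelyOpen.
Context {R : realType}.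
Implicit Types (D : set (R * R)) (t r : R).

Definition relopen D := D `<=` quadrant /\
  forall p, D p -> \forall q \near p, quadrant q -> D q.

Variables (D : set (R * R)) (f ft fr : R -> R -> R).
Hypothesis oD : relopen D.
Hypothesis Cf : C1_with D f ft fr.

Lemma relopen_r t r : D (t, r) -> \forall u \near r, 0 <= u -> D (t, u).
Proof.
move=> Dtr; have [t0 _] := oD.1 _ Dtr.
have cvp : (fun u : R => (t, u)) @ r --> (t, r) by exact: (cvg_pair (cvg_cst t) cvg_id).
have := cvp _ (oD.2 _ Dtr); rewrite /= nbhs_simpl/=.
by apply: filterS => u h u0; exact: h.
Qed.

Lemma relopen_t t r : D (t, r) -> \forall u \near t, 0 <= u -> D (u, r).
Proof.
move=> Dtr; have [_ r0] := oD.1 _ Dtr.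
have cvp : (fun u : R => (u, r)) @ t --> (t, r) by exact: (cvg_pair cvg_id (cvg_cst r)).
have := cvp _ (oD.2 _ Dtr); rewrite /= nbhs_simpl/=.
by apply: filterS => u h u0; exact: h.
Qed.

Lemma hdw_r t r : D (t, r) ->
  has_deriv_within [set u | D (t, u)] (f t) r (fr t r).
Proof.
move=> Dtr; have := hdw_curve Cf (A := [set u | D (t, u)]) Dtr (fun u h => h)
  (@hdw_cst _ _ t r) (@hdw_id _ _ r).
by rewrite mulr0 add0r mulr1.
Qed.

Lemma hdw_t t r : D (t, r) ->
  has_deriv_within [set u | D (u, r)] (fun u => f u r) t (ft t r).
Proof.
move=> Dtr; have := hdw_curve Cf (A := [set u | D (u, r)]) Dtr (fun u h => h)
  (@hdw_id _ _ t) (@hdw_cst _ _ r t).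
by rewrite mulr0 addr0 mulr1.
Qed.

Lemma der_r t r : D (t, r) -> 0 < r -> is_derive r 1 (f t) (fr t r).
Proof.
move=> Dtr r0; apply: hdw_is_derive (hdw_r Dtr).
apply: filterS2 (relopen_r Dtr) (lt_nbhsr r0) => u h u0; apply: h; exact: ltW.
Qed.

Lemma der_t t r : D (t, r) -> 0 < t -> is_derive t 1 (fun u => f u r) (ft t r).
Proof.
move=> Dtr t0; apply: hdw_is_derive (hdw_t Dtr).
apply: filterS2 (relopen_t Dtr) (lt_nbhsr t0) => u h u0; apply: h; exact: ltW.
Qed.

End RelativelyOpen.

(** * Radial functions on the Euclidean space *)

Section Lines.
Context {R : realType} (n : nat).
Implicit Types (x y : 'rV[R]_n) (i j : 'I_n) (h : R).
Local Notation e_ i := (delta_mx 0 i : 'rV[R]_n).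

Definition line x i h : 'rV[R]_n := h *: e_ i + x.

Lemma lineE x i h j : line x i h 0 j = h * (i == j)%:R + x 0 j.
Proof. by rewrite !mxE eqxx/= eq_sym. Qed.

Lemma line_derive (f : 'rV[R]_n -> R) x i (d : R) :
  is_derive (0 : R) 1 (fun h => f (line x i h)) d -> is_derive x (e_ i) f d.
Proof.
have E h : line x i (h *: 1 + 0) = h *: e_ i + x.
  by rewrite /line addr0; congr (_ *: _ + _); exact: mulr1.
have E0 : line x i 0 = x by rewrite /line scale0r add0r.
have F : (fun h : R => h^-1 *: (((fun h => f (line x i h)) \o shift 0) (h *: 1) - f (line x i 0))) =
  (fun h : R => h^-1 *: ((f \o shift x) (h *: e_ i) - f x)).
  by apply/funext => h /=; rewrite E E0.
move=> [df ef]; apply: DeriveDef; first by move: df; rewrite /derivable F.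
by rewrite -ef /derive F.
Qed.

Lemma enorm_ge0 x : 0 <= enorm x. Proof. exact: sqrtr_ge0. Qed.

Lemma enorm_sq x : enorm x ^+ 2 = \sum_(i < n) x 0 i ^+ 2.
Proof. by rewrite sqr_sqrtr// sumr_ge0// => i _; exact: sqr_ge0. Qed.

Lemma enorm_eq0 x : enorm x = 0 -> x = 0.
Proof.
move=> x0; have := enorm_sq x; rewrite x0 expr0n/= => /esym/eqP.
rewrite psumr_eq0 => [/allP H|i _]; last exact: sqr_ge0.
apply/rowP => i; have := H i (mem_index_enum i).
by rewrite mxE/= sqrf_eq0 => /eqP.
Qed.

Lemma enorm0 : enorm (0 : 'rV[R]_n) = 0.
Proof.
by rewrite /enorm big1 ?sqrtr0// => i _; rewrite mxE expr0n.
Qed.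

Lemma enorm_line x i h : enorm (line x i h) = Num.sqrt (enorm x ^+ 2 + (2 * x 0 i * h + h * h)).
Proof.
rewrite enorm_sq /enorm; congr Num.sqrt.
rewrite (bigD1 i)//= [in RHS](bigD1 i)//= lineE eqxx mulr1.
under eq_bigr => j ji do rewrite lineE eq_sym (negbTE ji) mulr0 add0r.
by ring.
Qed.

Lemma der_enorm x i : 0 < enorm x ->
  is_derive (0 : R) 1 (fun h => enorm (line x i h)) (x 0 i / enorm x).
Proof.
move=> x0; have -> : (fun h => enorm (line x i h)) =
  (fun h => Num.sqrt (enorm x ^+ 2 + (2 * x 0 i * h + h * h))).
  by apply/funext => h; exact: enorm_line.
have d : is_derive (0 : R) 1 (fun h => enorm x ^+ 2 + (2 * x 0 i * h + h * h)) (2 * x 0 i).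
  apply: (is_derive_eq (derD (derC (enorm x ^+ 2) 0) (derD (derM (derC (2 * x 0 i) 0) (der_id 0))
    (derM (der_id 0) (der_id 0))))).
  by ring.
have p : 0 < enorm x ^+ 2 + (2 * x 0 i * 0 + 0 * 0).
  by rewrite !mulr0 !addr0 exprn_gt0.
apply: (is_derive_eq (der_comp (g := fun h => enorm x ^+ 2 + (2 * x 0 i * h + h * h))
   (der_sqrt p) d)).
rewrite !mulr0 !addr0 sqrtr_sqr gtr0_norm//.
by field; rewrite gt_eqF.
Qed.

Lemma line0 x i : line x i 0 = x. Proof. by rewrite /line scale0r add0r. Qed.

Lemma near_line x i : 0 < enorm x -> \forall h \near (0 : R), enorm (line x i h) != 0.
Proof.
move=> x0; have c : {for 0, continuous (fun h : R => enorm (line x i h))}.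
  exact: der_cont (der_enorm i x0).
by apply: cvgr_neq0 c _; rewrite line0 gt_eqF.
Qed.

Lemma der_radial x i (g : R -> R) (d : R) : 0 < enorm x -> is_derive (enorm x) 1 g d ->
  is_derive (0 : R) 1 (fun h => g (enorm (line x i h))) (d * (x 0 i / enorm x)).
Proof.
move=> x0 dg; have dg' : is_derive (enorm (line x i 0)) 1 g d by rewrite line0.
exact: (der_comp (g := fun h => enorm (line x i h)) dg' (der_enorm i x0)).
Qed.

Lemma der_direction x i j : 0 < enorm x ->
  is_derive (0 : R) 1 (fun h => line x i h 0 j / enorm (line x i h))
    ((i == j)%:R / enorm x - x 0 j * x 0 i / enorm x ^+ 3).
Proof.
move=> x0; have E : (fun h => line x i h 0 j) = (fun h => (i == j)%:R * h + x 0 j).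
  by apply/funext => h; rewrite lineE mulrC.
have d1 : is_derive (0 : R) 1 (fun h => line x i h 0 j) (i == j)%:R.
  by rewrite E; exact: der_affine.
have xn0 := lt0r_neq0 x0.
have d2 := der_radial i x0 (der_inv xn0).
apply: (is_derive_eq (derM d1 d2)).
by rewrite line0; field.
Qed.

(** The partial derivatives in the equations are all of the form summed here,
    as functions of the direction of differentiation. *)
Lemma sum_quadratic x (i : 'I_n) (al be gm : R) :
  \sum_(j < n) (al + be * ((j == i)%:R * x 0 j) + gm * x 0 j ^+ 2) =
  n%:R * al + be * x 0 i + gm * enorm x ^+ 2.
Proof.
rewrite big_split/= big_split/= sumr_const card_ord -!mulr_sumr -enorm_sq.
congr (_ + _ + _); first by rewrite mulr_natl.
rewrite (bigD1 i)//= eqxx mul1r big1 ?addr0// => j /negbTE ->.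
by rewrite mul0r.
Qed.

Lemma sum_direction x : 0 < enorm x -> \sum_(i < n) (x 0 i / enorm x) ^+ 2 = 1.
Proof.
move=> x0; under eq_bigr do rewrite expr_div_n.
by rewrite -mulr_suml -enorm_sq divff// expf_neq0// gt_eqF.
Qed.

Lemma near_norm0 (P : set R) : (\forall u \near within `[0, +oo[ (nbhs (0 : R)), P u) ->
  \forall h \near (0 : R), P `|h|.
Proof.
move=> /near_within_nbhs HP.
have c0 : `|h| @[h --> (0 : R)] --> (0 : R).
  by rewrite -[X in _ --> X](@normr0 _ R); apply: cvg_norm; exact: cvg_id.
have := c0 _ HP; rewrite /= nbhs_simpl/=; apply: filterS => h.
by apply; rewrite /= in_itv/= normr_ge0.
Qed.

Lemma cvg_norm0 (q : R -> R) (d : R) : q @ within `[0, +oo[ (nbhs (0 : R)) --> d ->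
  q `|h| @[h --> (0 : R)] --> d.
Proof.
move=> /cvgrPdist_le qd; apply/cvgrPdist_le => e e0.
exact: (near_norm0 (P := fun u => `|d - q u| <= e)) (qd e e0).
Qed.

(** On a line through the origin a radial vector field is the odd reflection
    of its profile, and reflection turns the one-sided derivative at the
    centre into a two-sided one. *)
Lemma der_center_odd (g : R -> R) (d : R) : g 0 = 0 ->
  has_deriv_within `[0, +oo[ g 0 d ->
  is_derive (0 : R) 1 (fun h => g `|h| * (h / `|h|)) d.
Proof.
move=> g0 /hdwP[q [qd gq]]; apply: (@hdw_is_derive _ setT); first exact: filterT.
apply/hdwP; exists (fun h => q `|h|); split.
  by apply: cvg_within_filter; exact: cvg_norm0.
apply/near_within_nbhs; apply: filterS (near_norm0 gq) => h /= gh _.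
have {}gh : g `|h| = q `|h| * `|h| by move: gh; rewrite g0 !subr0.
rewrite gh mul0r mulr0 !subr0.
have [->|h0] := eqVneq h 0; first by rewrite normr0 !mulr0 mul0r.
by rewrite -mulrA; congr (_ * _); field; rewrite normr_eq0.
Qed.

(** The even reflection of a profile is differentiable at the centre when its
    one-sided slope there is zero. *)
Lemma der_center_flat (g : R -> R) : has_deriv_within `[0, +oo[ g 0 0 ->
  is_derive (0 : R) 1 (fun h => g `|h|) 0.
Proof.
move=> /hdwP[q [qd gq]]; apply: (@hdw_is_derive _ setT); first exact: filterT.
apply/hdwP; exists (fun h => q `|h| * Num.sg h); split.
  apply: cvg_within_filter; apply/norm_cvg0P.
  have : `|q `|h| | @[h --> (0 : R)] --> (0 : R).
    by rewrite -[X in _ --> X](@normr0 _ R); apply: cvg_norm; exact: cvg_norm0.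
  move=> /cvgrPdist_le H; apply/cvgrPdist_le => e e0.
  apply: filterS (H e e0) => h /=; rewrite !sub0r !normrN !normr_id.
  apply: le_trans; rewrite normrM ler_piMr//.
  by rewrite normr_sg; case: (h != 0).
apply/near_within_nbhs; apply: filterS (near_norm0 gq) => h /= + _.
by rewrite normr0 !subr0 => ->; rewrite -mulrA -normrEsg.
Qed.

End Lines.

(** * The equations in polar form *)

Section Mass.
Context {R : realType} (c : R) (c0 : 0 < c) (rho v : R -> R -> R).

Definition mass (t r : R) : R := rho t r / (c ^+ 2 - v t r ^+ 2).

Lemma subluminal_gt0 (u : R) : `|u| < c -> 0 < c ^+ 2 - u ^+ 2.
Proof.
move=> uc; rewrite subr_gt0 -[u ^+ 2]real_normK ?num_real//.
by rewrite ltr_sqr ?nnegrE// ltW.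
Qed.

Lemma mass_rho t r : `|v t r| < c -> rho t r = mass t r * (c ^+ 2 - v t r ^+ 2).
Proof. by move=> vc; rewrite divfK// lt0r_neq0// subluminal_gt0. Qed.

Lemma C1_mass (D : set (R * R)) : C1_on D rho -> C1_on D v ->
  (forall t r, D (t, r) -> `|v t r| < c) -> C1_on D mass.
Proof.
move=> Cr [vt [vr Cv]] vc; apply: C1_on_mul => //.
apply: C1_on_inv; last by move=> t r /vc ?; rewrite lt0r_neq0// subluminal_gt0.
have h := C1_add (C1_cst D (c ^+ 2)) (C1_mul (C1_cst D (-1)) (C1_mul Cv Cv)).
by apply: C1_on_ext (C1_exists h) _ => t r _; rewrite mulN1r -expr2.
Qed.

End Mass.

Section RadialEquations.
Context {R : realType} (n : nat).
Implicit Types (x y : 'rV[R]_n) (i j : 'I_n) (t r : R).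
Variables (c : R) (a a' : R -> R) (D : set (R * R)).
Variables (rho v mt mr vt vr : R -> R -> R).
Local Notation m := (mass c rho v).
Hypothesis oD : relopen D.
Hypothesis da : forall t, 0 < t -> is_derive t 1 a (a' t).
Hypothesis Cm : C1_with D m mt mr.
Hypothesis Cv : C1_with D v vt vr.

Lemma density_termE t x : 0 < enorm x ->
  @density_term R n c rho v t x = m t (enorm x).
Proof.
move=> x0; rewrite /density_term /radial_scalar; congr (_ / (_ - _)).
rewrite /radial_vector; under eq_bigr do rewrite exprMn.
by rewrite -mulr_sumr sum_direction// mulr1.
Qed.

(** The left-hand side of the mass equation off the centre: the divergence of
    the radial field of profile [f] is [f' + (n - 1) f / r]. *)
Definition mass_residue t r : R :=
  a' t * m t r + a t * mt t r + (mr t r * v t r + m t r * vr t r)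
  + n.-1%:R * (m t r * v t r) / r + (n%:R * a' t * m t r - a' t * rho t r / c ^+ 2).

Definition momentum_residue t r : R :=
  a' t * (m t r * v t r) + a t * (mt t r * v t r + m t r * vt t r)
  + (mr t r * v t r ^+ 2 + 2 * (m t r * v t r * vr t r))
  + n.-1%:R * (m t r * v t r ^+ 2) / r + n%:R * a' t * (m t r * v t r).

Variables (t : R) (x : 'rV[R]_n).
Hypothesis t0 : 0 < t.
Hypothesis x0 : 0 < enorm x.
Hypothesis Dx : D (t, enorm x).
Hypothesis n0 : (0 < n)%N.

Let nE : n%:R = 1 + n.-1%:R :> R.
Proof. by rewrite -{1}(prednK n0) -addn1 natrD addrC. Qed.

Lemma mass_equation_radial :
  mass_equation c a a' rho v t x <-> mass_residue t (enorm x) = 0.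
Proof.
rewrite /mass_equation; have r0 := x0; have Dr := Dx; set r := enorm x in r0 Dr *.
have rn0 := lt0r_neq0 r0.
have dt : derive1 (fun s => a s * density_term c rho v s x) t =
    a' t * m t r + a t * mt t r.
  rewrite derive1E; apply: derive_val.
  under eq_fun do rewrite density_termE//.
  exact: (derM (da t0) (der_t oD Cm Dr t0)).
have ds i : 'D_(delta_mx 0 i) (fun y => density_term c rho v t y * radial_vector (v t) i y) x =
    m t r * v t r / r + 0 * ((i == Ordinal n0)%:R * x 0 i) +
    ((mr t r * v t r + m t r * vr t r) / r ^+ 2 - m t r * v t r / r ^+ 3) * x 0 i ^+ 2.
  apply: derive_val; apply: line_derive.
  have dP := derM (der_r oD Cm Dr r0) (der_r oD Cv Dr r0).
  have d := derM (der_radial (g := fun u => m t u * v t u) i x0 dP) (der_direction i i x0).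
  rewrite line0 -/r eqxx /= in d.
  apply: (@near_eq_is_derive _ _ _ (fun h => m t (enorm (line x i h)) * v t (enorm (line x i h))
     * (line x i h 0 i / enorm (line x i h)))).
    near=> h; rewrite density_termE ?mulrA// lt0r enorm_ge0 andbT.
    by near: h; exact: near_line.
  by apply: (is_derive_eq d); rewrite mul0r addr0; field.
rewrite dt (eq_bigr _ (fun i _ => ds i)) density_termE// /radial_scalar -/r.
rewrite sum_quadratic -/r /mass_residue nE.
set A := (A in A = 0 <-> _); set B := (B in _ <-> B = 0).
suff -> : A = B by [].
by rewrite /A /B; move: (c ^+ 2)^-1 => k; field.
Unshelve. all: by end_near. Qed.

Lemma momentum_equation_radial i :
  momentum_equation c a a' rho v i t x <->
  x 0 i / enorm x * momentum_residue t (enorm x) = 0.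
Proof.
rewrite /momentum_equation; have r0 := x0; have Dr := Dx; set r := enorm x in r0 Dr *.
have rn0 := lt0r_neq0 r0.
have dt : derive1 (fun s => a s * density_term c rho v s x * radial_vector (v s) i x) t =
    (a' t * (m t r * v t r) + a t * (mt t r * v t r + m t r * vt t r)) * (x 0 i / r).
  rewrite derive1E; apply: derive_val.
  have E : (fun s => a s * density_term c rho v s x * radial_vector (v s) i x) =
    (fun s => a s * (m s r * v s r) * (x 0 i / r)).
    by apply/funext => s; rewrite density_termE// /radial_vector -/r; ring.
  rewrite E; apply: (is_derive_eq (derM (derM (da t0)
    (derM (der_t oD Cm Dr t0) (der_t oD Cv Dr t0))) (derC (x 0 i / r) t))).
  by rewrite mulr0 addr0.
have ds j : 'D_(delta_mx 0 j) (fun y => density_term c rho v t y * radial_vector (v t) i y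
      * radial_vector (v t) j y) x =
    m t r * v t r ^+ 2 * x 0 i / r ^+ 2 + m t r * v t r ^+ 2 / r ^+ 2 * ((j == i)%:R * x 0 j) +
    ((mr t r * v t r ^+ 2 + 2 * (m t r * v t r * vr t r)) * x 0 i / r ^+ 3
      - 2 * (m t r * v t r ^+ 2 * x 0 i / r ^+ 4)) * x 0 j ^+ 2.
  apply: derive_val; apply: line_derive.
  have dP := derM (der_r oD Cm Dr r0) (derM (der_r oD Cv Dr r0) (der_r oD Cv Dr r0)).
  have d := derM (derM (der_radial (g := fun u => m t u * (v t u * v t u)) j x0 dP)
    (der_direction j i x0)) (der_direction j j x0).
  rewrite line0 -/r eqxx /= in d.
  apply: (@near_eq_is_derive _ _ _ (fun h => m t (enorm (line x j h)) *
     (v t (enorm (line x j h)) * v t (enorm (line x j h)))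
     * (line x j h 0 i / enorm (line x j h)) * (line x j h 0 j / enorm (line x j h)))).
    near=> h; rewrite density_termE /radial_vector; first by ring.
    rewrite lt0r enorm_ge0 andbT.
    by near: h; exact: near_line.
  by apply: (is_derive_eq d); field.
rewrite dt (eq_bigr _ (fun j _ => ds j)) density_termE// /radial_vector -/r.
rewrite sum_quadratic -/r /momentum_residue.
set A := (A in A = 0 <-> _); set B := (B in _ <-> B = 0).
suff -> : A = B by [].
by rewrite /A /B nE; field; rewrite rn0.
Unshelve. all: by end_near. Qed.

End RadialEquations.

(** * The explicit fields off the centre *)

Section Residues.
Context {R : realType} (n : nat) (c : R) (a a' : R -> R).
Variables (rho v mt mr vt vr : R -> R -> R).
Local Notation m := (mass c rho v).

(** The momentum equation is [v] times the mass equation, plus [m] times an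
    equation that involves the velocity only. The whole problem decouples
    through this identity. *)
Lemma momentum_residueE t r : c != 0 -> rho t r = m t r * (c ^+ 2 - v t r ^+ 2) ->
  momentum_residue n c a a' rho v mt mr vt vr t r =
  v t r * mass_residue n c a a' rho v mt mr vr t r +
  m t r * (a t * vt t r + v t r * vr t r + a' t * v t r * (1 - v t r ^+ 2 / c ^+ 2)).
Proof.
by move=> c0 E; rewrite /momentum_residue /mass_residue E; move: r^-1 => ri; field.
Qed.

End Residues.

Section Center.
Context {R : realType} (D : set (R * R)) (f ft fr : R -> R -> R).
Hypothesis oD : relopen D.
Hypothesis Cf : C1_with D f ft fr.

Lemma hdw_near (A B : set R) (g : R -> R) (s l : R) :
  (\forall u \near s, B u -> A u) -> has_deriv_within A g s l -> has_deriv_within B g s l.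
Proof.
move=> BA; apply: cvg_trans => P /near_within_dnbhs H; apply/near_within_dnbhs.
by apply: filterS2 H BA => u h1 h2 us Bu; apply: h1 => //; exact: h2.
Qed.

Lemma hdw_center t : D (t, 0) -> has_deriv_within `[0, +oo[ (f t) 0 (fr t 0).
Proof.
move=> Dt; apply: hdw_near (hdw_r Cf Dt).
by apply: filterS (relopen_r oD Dt) => u h; rewrite /= in_itv/= andbT.
Qed.

End Center.

Section Solution.
Context {R : realType} (G : flow R) (E : set (R * R)).
Hypothesis LE : label_set G E.
Implicit Types (t r s : R).
Local Notation c := (light G).
Local Notation a := (scale G).
Local Notation a' := (scale' G).
Local Notation w := (mom G).
Local Notation w' := (mom' G).
Local Notation z := (ratio w w').
Local Notation D := (swept G E).
Variables (n : nat) (n0 : (0 < n)%N).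

Lemma swept_relopen : relopen D.
Proof. by split; [exact: swept_quadrant|exact: swept_open]. Qed.

Lemma scale_der t : 0 < t -> is_derive t 1 a (a' t).
Proof.
move=> t0; apply: hdw_is_derive (@scale_deriv _ G t (ltW t0)).
by apply: filterS (lt_nbhsr t0) => u u0; rewrite /= in_itv/= andbT ltW.
Qed.

Lemma label_nbhs t s : E (t, s) -> 0 < t -> nbhs t [set u | E (u, s)].
Proof.
move=> Es t0; have [_ s0] := ls_ge0 LE Es.
have cvp : (fun u : R => (u, s)) @ t --> (t, s) by exact: (cvg_pair cvg_id (cvg_cst s)).
have := cvp _ (near_label LE Es); rewrite /= nbhs_simpl/=.
by move=> h; apply: filterS2 h (lt_nbhsr t0) => u h u0; apply: h => //; exact: ltW.
Qed.

(** The equations are statements about material derivatives, and the material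
    derivative of a field is the time derivative of its Lagrangian
    expression. *)
Lemma along_path (f ft fr : R -> R -> R) (g : R -> R) (dg : R) t s :
  C1_with D f ft fr -> E (t, s) -> 0 < t ->
  (forall u, E (u, s) -> f u (path G u s) = g u) -> is_derive t 1 g dg ->
  ft t (path G t s) + fr t (path G t s) * (vel G t s / a t) = dg.
Proof.
move=> Cf Es t0 fg dg'; have nb := label_nbhs Es t0.
have dp : is_derive t 1 (fun u => path G u s) (vel G t s / a t).
  rewrite -clockE ?(ltW t0)// -patht_vel; exact: C1_dt s (C1_path G) t0.
have H := hdw_curve Cf (A := [set u | E (u, s)]) Es (fun u Eu => @sweptP R G E u s Eu)
  (@hdw_id _ _ t) (is_derive_hdw _ dp).
rewrite mulr1 in H; apply: derive_unique dg'.
apply: near_eq_is_derive (hdw_is_derive nb H).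
by apply: filterS nb => u /fg.
Qed.

Local Notation em := (mass c (erho G E n) (evel G E)).

Lemma C1_em : exists mt mr, C1_with D em mt mr.
Proof.
apply: (C1_mass (light_gt0 G)) (C1_erho LE n) (C1_exists (C1_evel LE)) _ => t r _.
exact: evel_lt.
Qed.

Lemma em_path t s : E (t, s) -> em t (path G t s) = massl G n t s.
Proof. by move=> Es; rewrite /em /massl erho_path// evel_path. Qed.

Variables (mt mr : R -> R -> R).
Hypothesis Cm : C1_with D em mt mr.
Local Notation vt := (evelt G E).
Local Notation vr := (evelr G E).

Lemma vr_path t s : E (t, s) -> vr t (path G t s) = vels G t s / stretch G t s.
Proof. exact: evelr_path. Qed.

Lemma em_ode t s : E (t, s) -> 0 < t ->
  a t * mt t (path G t s) + vel G t s * mr t (path G t s) =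
  - massl G n t s * (vels G t s / stretch G t s
     + n.-1%:R * (z s / (gam G t s * spread G t s))
     + n%:R * a' t + a' t * vel G t s ^+ 2 / c ^+ 2).
Proof.
move=> Es t0; have Q0 := ls_spread LE Es; have J0 := ls_stretch LE Es.
have := along_path Cm Es t0 (fun u => @em_path u s) (massl_ode n t0 Q0 J0).
have an0 : a t != 0 by rewrite -clockE ?(ltW t0)// clock_neq0.
have cn0 := lt0r_neq0 (light_gt0 G).
rewrite clockE ?(ltW t0)// => H.
rewrite (_ : a t * _ + _ = a t * (mt t (path G t s) +
   mr t (path G t s) * (vel G t s / a t))); last by field.
rewrite H; move: (stretch G t s)^-1 (gam G t s * _)^-1 => j q.
by field; rewrite cn0 an0.
Qed.

Lemma evel_ode t s : E (t, s) -> 0 < t ->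
  a t * vt t (path G t s) + vel G t s * vr t (path G t s) +
  a' t * vel G t s * (1 - vel G t s ^+ 2 / c ^+ 2) = 0.
Proof.
move=> Es t0.
have := along_path (C1_evel LE) Es t0 (fun u Eu => evel_path LE Eu) (C1_dt s (C1_vel G) t0).
have an0 : a t != 0 by rewrite -clockE ?(ltW t0)// clock_neq0.
move=> H; rewrite -[RHS](velt_ode G t s) clockE ?(ltW t0)//; congr (_ + _).
by rewrite -H; field.
Qed.

(** Off the centre [vel / path] is [z / (gam * spread)], because [vel] and
    [path] both contain the factor [s]; then the equation is [em_ode]. *)
Lemma mass_residue_explicit t r : D (t, r) -> 0 < t -> 0 < r ->
  mass_residue n c a a' (erho G E n) (evel G E) mt mr vr t r = 0.
Proof.
move=> Dtr t0 r0; have [Es pr] := labP Dtr.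
set s := lab G E t r in Es pr *.
have s0 : s != 0.
  by apply: contraTneq r0 => s0; rewrite -pr s0 path_at0 ltxx.
have cn0 := lt0r_neq0 (light_gt0 G).
have H := em_ode Es t0.
have rhoE : erho G E n t r = massl G n t s * (c ^+ 2 - vel G t s ^+ 2).
  by rewrite -(em_path Es) -(evel_path LE Es) pr -mass_rho//; [exact: light_gt0|exact: evel_lt].
have vE : evel G E t r = vel G t s by rewrite -(evel_path LE Es) pr.
have mE : em t r = massl G n t s by rewrite -(em_path Es) pr.
have vrE : vr t r = vels G t s / stretch G t s by rewrite -(vr_path Es) pr.
have vr' : vel G t s / r = z s / (gam G t s * spread G t s).
  rewrite -pr pathE /vel momE; field.
  by rewrite gam_neq0 s0 (lt0r_neq0 (ls_spread LE Es)).
rewrite pr in H; rewrite /mass_residue rhoE vE mE vrE.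
rewrite (_ : n.-1%:R * (massl G n t s * vel G t s) / r =
  n.-1%:R * (massl G n t s * (vel G t s / r))); last by rewrite !mulrA.
rewrite vr'.
rewrite [LHS](_ : _ = (a t * mt t r + vel G t s * mr t r) +
  (a' t * massl G n t s + massl G n t s * (vels G t s / stretch G t s) +
   n.-1%:R * (massl G n t s * (z s / (gam G t s * spread G t s))) +
   (n%:R * a' t * massl G n t s - a' t * (massl G n t s * (c ^+ 2 - vel G t s ^+ 2)) / c ^+ 2))); last by ring.
rewrite H; move: (vels G t s / stretch G t s) (z s / _) => j q.
by field.
Qed.

Lemma momentum_residue_explicit t r : D (t, r) -> 0 < t -> 0 < r ->
  momentum_residue n c a a' (erho G E n) (evel G E) mt mr vt vr t r = 0.
Proof.
move=> Dtr t0 r0; have [Es pr] := labP Dtr.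
have cn0 := lt0r_neq0 (light_gt0 G).
rewrite (@momentum_residueE R n c a a' (erho G E n))//; last first.
  by apply: mass_rho; [exact: light_gt0|exact: evel_lt].
rewrite mass_residue_explicit// mulr0 add0r.
have := evel_ode Es t0; rewrite -(evel_path LE Es) pr => ->.
by rewrite mulr0.
Qed.

End Solution.

(** * The explicit solution up to the centre *)

Lemma hdw_comp {R : realType} (A : set R) (f g : R -> R) (s l k : R) :
  is_derive (g s) 1 f l -> has_deriv_within A g s k ->
  has_deriv_within A (fun u => f (g u)) s (l * k).
Proof.
move=> /is_derive1_caratheodory[q [fq cq ql]] hg.
have [p [pk gp]] := (hdwP _ _ _ _).1 hg.
apply/hdwP; exists (fun u => q (g u) * p u); split.
  apply: cvgM => //; rewrite -ql; exact: (cvg_comp _ _ (hdw_cvg hg) cq).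
by apply: filterS gp => u h; rewrite fq h mulrA.
Qed.

Lemma hdw_unique_right {R : realType} (A : set R) (f : R -> R) (s l k : R) :
  (\forall u \near s, s < u -> A u) ->
  has_deriv_within A f s l -> has_deriv_within A f s k -> l = k.
Proof.
move=> HA; have sub g : has_deriv_within A f s g -> (f u - f s) / (u - s) @[u --> s^'+] --> g.
  apply: cvg_trans => P /near_within_dnbhs H; rewrite /= /at_right /within/=.
  apply: filterS2 H HA => u h1 h2 su; apply: h1; last exact: h2.
  by rewrite gt_eqF.
by move=> /sub h1 /sub h2; exact: (cvg_unique _ h1 h2).
Qed.

Section Solution.
Context {R : realType} (G : flow R) (E : set (R * R)).
Hypothesis LE : label_set G E.
Implicit Types (t r s : R).
Local Notation c := (light G).
Local Notation a := (scale G).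
Local Notation a' := (scale' G).
Local Notation w := (mom G).
Local Notation w' := (mom' G).
Local Notation z := (ratio w w').
Local Notation D := (swept G E).
Variables (n : nat) (n0 : (0 < n)%N).
Local Notation rho := (erho G E n).
Local Notation v := (evel G E).
Local Notation m := (mass c rho v).
Local Notation vt := (evelt G E).
Local Notation vr := (evelr G E).

Let oD := swept_relopen LE.

Lemma evel_center t r : D (t, r) -> v t 0 = 0.
Proof. by move=> Dtr; rewrite /evel (lab_at0 LE Dtr) vel_at0. Qed.

(** An even function that is differentiable at [0] has derivative [0] there. *)
Lemma rhol_flat t : 0 <= t -> 0 < spread G t 0 -> 0 < stretch G t 0 ->
  is_derive (0 : R) 1 (rhol G n t) 0.
Proof.
move=> t0 Q0 J0.
pose E' := [set p : R * R | halfplane p /\ (0 < spread G p.1 p.2 /\ 0 < stretch G p.1 p.2)].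
have [ft [fr Cf]] : C1_on E' (rhol G n).
  by apply: C1_rhol => [p []//|u s [_]].
have E0 : [set u | E' (t, u)] 0 by [].
have H := hdw_curve Cf E0 (fun u h => h) (@hdw_cst _ _ t 0) (@hdw_id _ _ 0).
have cont (f : R -> R -> R) ft' fr' : C1_with halfplane f ft' fr' -> 0 < f t 0 ->
    \forall u \near (0 : R), 0 < f t u.
  move=> Cf' f0.
  have d := hdw_curve Cf' (A := setT) (I : setT 0) (f := fun=> t) (g := id)
    (fun u _ => t0) (@hdw_cst _ _ t 0) (@hdw_id _ _ 0).
  have nT : nbhs (0 : R) [set: R] by exact: filterT.
  have cv : f t u @[u --> (0 : R)] --> f t 0 := der_cont (hdw_is_derive nT d).
  exact: (cvgr_gt (f t 0) cv 0 f0).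
have [? /cont cQ] := C1_spread G; have [? /cont cJ] := C1_stretch G.
have nb : nbhs (0 : R) [set u | E' (t, u)].
  by apply: filterS2 (cQ Q0) (cJ J0) => u h1 h2; split.
have d := hdw_is_derive nb H; rewrite mulr0 add0r mulr1 in d.
have ev : (fun s => rhol G n t (-1 * s + 0)) = rhol G n t.
  by apply/funext => s; rewrite addr0 mulN1r rhol_even.
have aff := der_affine (-1) 0 (0 : R).
have d' : is_derive ((-1) * 0 + 0 : R) 1 (rhol G n t) (fr t 0) by rewrite mulr0 addr0.
have := der_comp (g := fun s => -1 * s + 0) d' aff.
rewrite ev => d2; have := derive_unique d d2.
move=> e; have e0 : fr t 0 = 0 by move: e; lra.
by rewrite e0 in d.
Qed.

Lemma erho_flat t : D (t, 0) -> has_deriv_within `[0, +oo[ (rho t) 0 0.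
Proof.
move=> Dt; have [Es _] := labP Dt; rewrite (lab_at0 LE Dt) in Es.
have [t0 _] := ls_ge0 LE Es.
have d := rhol_flat t0 (ls_spread LE Es) (ls_stretch LE Es).
have l0 : lab G E t 0 = 0 := lab_at0 LE Dt.
have d' : is_derive (lab G E t 0) 1 (rhol G n t) 0 by rewrite l0.
have := hdw_comp d' (hdw_center oD (C1_lab LE) Dt).
by rewrite mul0r.
Qed.

Lemma C1_erho_flat : exists rt rr, C1_with D rho rt rr /\
  forall t, D (t, 0) -> rr t 0 = 0.
Proof.
have [rt [rr Cr]] : C1_on D rho := C1_erho LE n; exists rt, rr; split => // t Dt.
apply: hdw_unique_right (hdw_center oD Cr Dt) (erho_flat Dt).
by apply: (@nearW _ (nbhs (0 : R))) => u u0; rewrite /= in_itv/= ltW.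
Qed.

Lemma line_center (i : 'I_n) h : enorm (line (0 : 'rV[R]_n) i h) = `|h|.
Proof. by rewrite enorm_line enorm0 expr0n mxE mulr0 mul0r !add0r -expr2 sqrtr_sqr. Qed.

Lemma erho_derivable t (x : 'rV[R]_n) j : D (t, enorm x) ->
  derivable (radial_scalar (rho t)) x (delta_mx 0 j).
Proof.
move=> Dx; have [rt [rr [Cr flat]]] := C1_erho_flat.
have [x0|x0] := eqVneq (enorm x) 0.
  rewrite (enorm_eq0 x0) enorm0 in Dx *.
  have [] // : is_derive (0 : 'rV[R]_n) (delta_mx 0 j) (radial_scalar (rho t)) 0.
  apply: line_derive; rewrite /radial_scalar.
  under eq_fun do rewrite line_center.
  exact: der_center_flat (erho_flat Dx).
have xp : 0 < enorm x by rewrite lt0r x0 enorm_ge0.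
have d := line_derive (f := radial_scalar (rho t)) (der_radial j xp (der_r oD Cr Dx xp)).
by case: d.
Qed.

Lemma direction_center (i j : 'I_n) h (g : R -> R) :
  g (enorm (line 0 j h)) * (line (0 : 'rV[R]_n) j h 0 i / enorm (line 0 j h)) =
  (j == i)%:R * (g `|h| * (h / `|h|)).
Proof. by rewrite line_center lineE mxE addr0; ring. Qed.

Lemma evel_derivable t (x : 'rV[R]_n) i j : D (t, enorm x) ->
  derivable (radial_vector (v t) i) x (delta_mx 0 j).
Proof.
move=> Dx; have Cv := C1_evel LE.
have [x0|x0] := eqVneq (enorm x) 0.
  rewrite (enorm_eq0 x0) enorm0 in Dx *.
  have d := der_center_odd (evel_center Dx) (hdw_center oD Cv Dx).
  have d1 := derM (derC (j == i)%:R 0) d.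
  suff H : (fun h => radial_vector (v t) i (line (0 : 'rV[R]_n) j h)) =
      (fun h => (j == i)%:R * (v t `|h| * (h / `|h|))).
    by rewrite -H in d1; case: (line_derive d1).
  by apply/funext => h; rewrite /radial_vector direction_center.
have xp : 0 < enorm x by rewrite lt0r x0 enorm_ge0.
have d := derM (der_radial j xp (der_r oD Cv Dx xp)) (der_direction j i xp).
by case: (line_derive (f := radial_vector (v t) i) d).
Qed.

(** At the centre the particle with label [0] is at rest, [v / r] becomes
    [v_r] and the divergence becomes [n * v_r]; this matches [em_ode],
    because [spread] and [stretch] agree at the label [0]. *)
Lemma mass_equation_center t : D (t, 0) -> 0 < t ->
  mass_equation c a a' rho v t (0 : 'rV[R]_n).
Proof.
move=> Dt t0; have [mt [mr Cm]] := C1_em LE n; have Cv := C1_evel LE.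
have [Es _] := labP Dt; rewrite (lab_at0 LE Dt) in Es.
have cn0 := lt0r_neq0 (light_gt0 G).
have v0 := evel_center Dt.
have rv0 s i : radial_vector (v s) i (0 : 'rV[R]_n) = 0.
  by rewrite /radial_vector mxE mul0r mulr0.
have dens0 s : v s 0 = 0 -> density_term c rho v s (0 : 'rV[R]_n) = m s 0.
  move=> vs; rewrite /density_term /radial_scalar enorm0 big1 => [|i _].
    by rewrite /mass vs expr0n subr0.
  by rewrite rv0 expr0n.
have dt : derive1 (fun s => a s * density_term c rho v s (0 : 'rV[R]_n)) t =
    a' t * m t 0 + a t * mt t 0.
  rewrite derive1E; apply: derive_val.
  apply: (@near_eq_is_derive _ _ _ (fun s => a s * m s 0)).
    apply: filterS2 (relopen_t oD Dt) (lt_nbhsr t0) => s h s0.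
    by rewrite dens0// (evel_center (h (ltW s0))).
  exact: derM (scale_der G t0) (der_t oD Cm Dt t0).
have ds i : 'D_(delta_mx 0 i) (fun y : 'rV[R]_n => density_term c rho v t y * radial_vector (v t) i y) 0 =
    m t 0 * vr t 0.
  apply: derive_val; apply: line_derive.
  have g0 : m t 0 * v t 0 = 0 by rewrite v0 mulr0.
  have d := der_center_odd (g := fun u => m t u * v t u) g0 (hdw_center oD (C1_mul Cm Cv) Dt).
  rewrite v0 mulr0 add0r in d.
  apply: (near_eq_is_derive _ d); apply: (@nearW _ (nbhs (0 : R))) => h.
  have [->|h0] := eqVneq h 0; first by rewrite mul0r mulr0 line0 rv0 mulr0.
  have hp : 0 < enorm (line (0 : 'rV[R]_n) i h) by rewrite line_center normr_gt0.
  rewrite density_termE// /radial_vector direction_center eqxx mul1r line_center.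
  by rewrite -mulrA.
have H := em_ode LE Cm Es t0; have Q0 := ls_spread LE Es.
rewrite path_at0 vel_at0 mul0r addr0 expr0n/= mulr0 mul0r addr0 in H.
have mE : m t 0 = massl G n t 0 by rewrite -(em_path LE n Es) path_at0.
have vrE : vr t 0 = vels G t 0 / stretch G t 0 by rewrite -(vr_path LE Es) path_at0.
have zE : z 0 / (gam G t 0 * spread G t 0) = vr t 0.
  rewrite vrE /vels spread_at0 {1}/ratio eqxx.
  have E2 : clock G t ^+ 2 = gam G t 0 ^+ 2 by rewrite gam2 kap0 addr0.
  by rewrite E2; field; rewrite gam_neq0 lt0r_neq0// (ls_stretch LE Es).
rewrite zE -vrE -mE in H.
rewrite /mass_equation dt (eq_bigr _ (fun i _ => ds i)) sumr_const card_ord dens0//.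
rewrite /radial_scalar enorm0 H.
have -> : rho t 0 = m t 0 * c ^+ 2.
  by rewrite /mass v0 expr0n subr0 divfK// expf_neq0.
have nE : n%:R = 1 + n.-1%:R :> R by rewrite -{1}(prednK n0) -addn1 natrD addrC.
by rewrite -[(_ * _) *+ n]mulr_natl nE; field.
Qed.

(** The velocity vanishes at the centre, so the momentum flux vanishes there
    to second order. *)
Lemma momentum_equation_center t i : D (t, 0) -> 0 < t ->
  momentum_equation c a a' rho v i t (0 : 'rV[R]_n).
Proof.
move=> Dt t0; have [mt [mr Cm]] := C1_em LE n; have Cv := C1_evel LE.
have v0 := evel_center Dt.
have rv0 s i' : radial_vector (v s) i' (0 : 'rV[R]_n) = 0.
  by rewrite /radial_vector mxE mul0r mulr0.
have dt : derive1 (fun s => a s * density_term c rho v s (0 : 'rV[R]_n) * radial_vector (v s) i 0) t = 0.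
  rewrite derive1E; under eq_fun do rewrite rv0 mulr0.
  exact: derive_cst.
have ds j : 'D_(delta_mx 0 j) (fun y : 'rV[R]_n => density_term c rho v t y * radial_vector (v t) i y
    * radial_vector (v t) j y) 0 = 0.
  apply: derive_val; apply: line_derive.
  have d := hdw_center oD (C1_mul Cm (C1_mul Cv Cv)) Dt.
  rewrite !v0 !(mulr0, mul0r, addr0) in d.
  have d1 := derM (derC (j == i)%:R 0) (der_center_flat d).
  rewrite !(mulr0, mul0r, addr0) in d1.
  apply: (near_eq_is_derive _ d1); apply: (@nearW _ (nbhs (0 : R))) => h.
  have [->|h0] := eqVneq h 0; first by rewrite normr0 v0 !mulr0 line0 rv0 mulr0 mul0r.
  have hp : 0 < enorm (line (0 : 'rV[R]_n) j h) by rewrite line_center normr_gt0.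
  rewrite density_termE// /radial_vector !direction_center eqxx mul1r line_center.
  have hh : (h / `|h|) * (h / `|h|) = 1.
    by rewrite -expr2 expr_div_n real_normK ?num_real// divff// sqrf_eq0.
  rewrite -[LHS]mulr1 -hh; ring.
rewrite /momentum_equation dt big1 => [|j _]; last exact: ds.
by rewrite rv0 mulr0 !addr0.
Qed.

Variables (rho0 v0 : R -> R) (eps : R).
Hypothesis initial_density : forall r, 0 <= r -> eps * rho0 r = dens G r.
Hypothesis initial_velocity : forall r, 0 < r -> eps * v0 r = vel G 0 r.

Theorem explicit_solution : classical_solution n c a a' rho0 v0 eps D rho v.
Proof.
have [mt [mr Cm]] := C1_em LE n; have Cv := C1_evel LE.
have D0 r : 0 <= r -> D (0, r) by move=> r0; exact: swept_init.
split.
- exact: C1_erho.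
- exact: C1_exists Cv.
- by move=> t r _; exact: evel_lt.
- by move=> t x Dx j; exact: erho_derivable.
- by move=> t x Dx i j; exact: evel_derivable.
- move=> t x t0 Dx; have [x0|x0] := eqVneq (enorm x) 0.
    by rewrite (enorm_eq0 x0) enorm0 in Dx *; exact: mass_equation_center.
  have xp : 0 < enorm x by rewrite lt0r x0 enorm_ge0.
  apply/(mass_equation_radial oD (@scale_der R G) Cm Cv t0 xp Dx n0) => //.
  exact: mass_residue_explicit.
- move=> t x t0 Dx i; have [x0|x0] := eqVneq (enorm x) 0.
    by rewrite (enorm_eq0 x0) enorm0 in Dx *; exact: momentum_equation_center.
  have xp : 0 < enorm x by rewrite lt0r x0 enorm_ge0.
  apply/(momentum_equation_radial oD (@scale_der R G) Cm Cv t0 xp Dx n0) => //.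
  by rewrite (momentum_residue_explicit LE Cm)// mulr0.
- move=> x; rewrite /radial_scalar initial_density ?enorm_ge0//.
  by rewrite /erho lab0 ?enorm_ge0// rhol0.
- move=> x i; rewrite /radial_vector [RHS]mulrA.
  have [x0|x0] := eqVneq (enorm x) 0; first by rewrite x0 invr0 mulr0 [in RHS]mulr0 !mulr0.
  have xp : 0 < enorm x by rewrite lt0r x0 enorm_ge0.
  by rewrite initial_velocity// /evel lab0 ?enorm_ge0.
Qed.

Lemma explicit_trajectory s t : E (t, s) ->
  trajectory a v D `[0, t] (fun u => path G u s).
Proof.
move=> Es u; rewrite /= in_itv/= => /andP[u0 ut].
have Eu : E (u, s).
  by apply: (ls_down LE Es); rewrite ?u0//= lexx andbT; have [] := ls_ge0 LE Es.
split; first exact: sweptP.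
rewrite (evel_path LE Eu) -clockE// -patht_vel.
have H : halfplane (u, s) by [].
have := hdw_curve (C1_path G) (A := `[0, t]) (f := id) (g := fun=> s) (s := u) _ _
  (@hdw_id _ _ u) (@hdw_cst _ _ s u).
rewrite mulr1 mulr0 addr0; apply.
  by rewrite /= in_itv/= u0.
by move=> x; rewrite /= in_itv/= => /andP[].
Qed.

Theorem explicit_development : development n c a a' rho0 v0 eps D rho v.
Proof.
split.
(* The largest open set that meets the quadrant inside [D]. *)
- exists (D `|` ~` quadrant)^°; first exact: open_interior.
  apply/seteqP; split => p.
    move=> Dp; split; first exact: oD.1.
    rewrite /interior; apply: filterS (oD.2 _ Dp) => q h.
    by have [/h|] := pselect (quadrant q); [left|right].
  by move=> [qp /interior_subset[]].
- by move=> r r0; exact: swept_init.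
- exact: explicit_solution.
- move=> t r Dtr; have [Es pr] := labP Dtr.
  exists (fun u => path G u (lab G E t r)); split => //.
  exact: explicit_trajectory.
Qed.

End Solution.

(** * Arbitrary solutions along a curve *)

Section Calculus.
Context {R : realType}.
Implicit Types (f g : R -> R) (s t T : R).

Lemma first_nonpos (T : R) f : 0 <= T -> {within `[0, T], continuous f} -> 0 < f 0 ->
  (exists2 s, 0 <= s <= T & f s <= 0) ->
  exists2 tau, 0 < tau <= T & f tau <= 0 /\ forall s, 0 <= s < tau -> 0 < f s.
Proof.
move=> T0 /subspace_continuousP cf f0 [s1 s1T fs1].
pose Z := [set s | 0 <= s <= T /\ f s <= 0].
have Z1 : Z s1 by [].
have lbZ : lbound Z 0 by move=> s [/andP[]].
have hZ : has_inf Z by split; [exists s1|exists 0].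
pose tau := inf Z.
have tau0 : 0 <= tau by apply: lb_le_inf => //; exists s1.
have tauT : tau <= T.
  by apply: le_trans (ge_inf _ Z1) _; [exists 0|case/andP: s1T].
have before s : 0 <= s < tau -> 0 < f s.
  move=> /andP[s0 st]; rewrite ltNge; apply/negP => fs.
  have : tau <= s.
    apply: ge_inf; first by exists 0.
    by split=> //; rewrite s0 (le_trans (ltW st)).
  by rewrite leNgt st.
have ftau : f tau <= 0.
  rewrite leNgt; apply/negP => ft.
  have tI : `[0, T]%classic tau by rewrite /= in_itv/= tau0.
  have : \forall u \near within `[0, T] (nbhs tau), 0 < f u.
    by apply: (cvgr_gt _ (cf _ tI)).
  move=> /near_within_nbhs /nbhs_ballP[d /= d0 hd].
  have [z [zT fz] zd] := inf_adherent d0 hZ.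
  have tz : tau <= z by apply: ge_inf => //; exists 0.
  have := hd z; rewrite /ball/= => /(_ _ _).
  rewrite distrC ger0_norm ?subr_ge0// ltrBlDl => /(_ zd).
  by rewrite in_itv/= => /(_ zT); rewrite ltNge fz.
exists tau => //; rewrite tauT andbT lt0r tau0 andbT.
by apply: contraTneq ftau => ->; rewrite -ltNge.
Qed.

Lemma hdw_ext (A : set R) f g s l : A s -> (forall u, A u -> f u = g u) ->
  has_deriv_within A f s l -> has_deriv_within A g s l.
Proof.
move=> As fg; apply: cvg_trans => P /near_within_dnbhs H; apply/near_within_dnbhs.
by apply: filterS H => u h us Au; rewrite /= -(fg u Au) -(fg s As); exact: h.
Qed.

Lemma hdw_within (A : set R) f (df : R -> R) :
  (forall s, A s -> has_deriv_within A f s (df s)) -> {within A, continuous f}.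
Proof. by move=> H; apply/subspace_continuousP => s /H /hdw_cvg. Qed.

Lemma hdw_itv_derive (T : R) f s l : s \in `]0, T[ ->
  has_deriv_within `[0, T] f s l -> is_derive s 1 f l.
Proof.
rewrite in_itv/= => /andP[s0 sT]; apply: hdw_is_derive.
apply: filterS2 (lt_nbhsr s0) (lt_nbhsl sT) => u u0 uT.
by rewrite /= in_itv/= !ltW.
Qed.

Lemma within_sub (T T' : R) f : T' <= T -> {within `[0, T], continuous f} ->
  {within `[0, T'], continuous f}.
Proof.
move=> TT; apply: continuous_subspaceW => s; rewrite /= !in_itv/= => /andP[-> /=].
by move=> h; exact: le_trans TT.
Qed.

Lemma within_const (A : set R) (k : R) : {within A, continuous (fun=> k)}.
Proof. by apply/subspace_continuousP => s _; exact: cvg_cst. Qed.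

Lemma withinD (A : set R) f g : {within A, continuous f} -> {within A, continuous g} ->
  {within A, continuous (fun s => f s + g s)}.
Proof.
move=> /subspace_continuousP cf /subspace_continuousP cg; apply/subspace_continuousP => s As.
by apply: cvgD; [exact: cf|exact: cg].
Qed.

Lemma withinM (A : set R) f g : {within A, continuous f} -> {within A, continuous g} ->
  {within A, continuous (fun s => f s * g s)}.
Proof.
move=> /subspace_continuousP cf /subspace_continuousP cg; apply/subspace_continuousP => s As.
by apply: cvgM; [exact: cf|exact: cg].
Qed.

Lemma withinV (A : set R) f : {within A, continuous f} -> (forall s, A s -> f s != 0) ->
  {within A, continuous (fun s => (f s)^-1)}.
Proof.
move=> /subspace_continuousP cf f0; apply/subspace_continuousP => s As.
by apply: cvgV; [exact: f0|exact: cf].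
Qed.

End Calculus.

Section Restriction.
Context {R : realType}.

Lemma classical_solution_sub n (c : R) a a' rho0 v0 eps (D D' : set (R * R)) rho v :
  D' `<=` D -> classical_solution n c a a' rho0 v0 eps D rho v ->
  classical_solution n c a a' rho0 v0 eps D' rho v.
Proof.
move=> DD [h1 h2 h3 h4 h5 h6 h7 h8 h9]; split => //.
- exact: C1_on_sub h1.
- exact: C1_on_sub h2.
- by move=> t r /DD; exact: h3.
- by move=> t x /DD; exact: h4.
- by move=> t x /DD; exact: h5.
- by move=> t x t0 /DD; exact: h6.
- by move=> t x t0 /DD; exact: h7.
Qed.

End Restriction.

Section AnySolution.
Context {R : realType} (G : flow R).
Implicit Types (t r s : R).
Local Notation c := (light G).
Local Notation a := (scale G).
Local Notation a' := (scale' G).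
Variables (n : nat) (n0 : (0 < n)%N).
Variables (rho0 v0 : R -> R) (eps : R).
Hypothesis initial_density : forall r, 0 <= r -> eps * rho0 r = dens G r.
Hypothesis initial_velocity : forall r, 0 < r -> eps * v0 r = vel G 0 r.
Variables (D : set (R * R)) (rho v : R -> R -> R).
Hypothesis oD : relopen D.
Hypothesis sol : classical_solution n c a a' rho0 v0 eps D rho v.

Local Notation mm := (mass c rho v).

Lemma mm_rho t r : D (t, r) -> rho t r = mm t r * (c ^+ 2 - v t r ^+ 2).
Proof.
by move=> Dtr; apply: mass_rho; [exact: light_gt0|exact: (sol_subluminal sol Dtr)].
Qed.

Lemma C1_mm : C1_on D mm.
Proof.
apply: (C1_mass (light_gt0 G)) (sol_rho_C1 sol) (sol_v_C1 sol) _ => t r Dtr.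
exact: (sol_subluminal sol Dtr).
Qed.

Let i0 : 'I_n := Ordinal n0.

Lemma initial_rho r : 0 <= r -> rho 0 r = dens G r.
Proof.
move=> r0; have := sol_rho_init sol (axis i0 r).
by rewrite /radial_scalar enorm_axis ger0_norm// initial_density.
Qed.

Lemma initial_v r : 0 < r -> v 0 r = vel G 0 r.
Proof.
move=> r0; have := sol_v_init sol (axis i0 r) i0.
rewrite /radial_vector enorm_axis gtr0_norm// axisE eqxx mulr1 divff ?gt_eqF//.
by rewrite !mulr1 initial_velocity.
Qed.

Variables (mt mr vt vr : R -> R -> R).
Hypothesis Cm : C1_with D mm mt mr.
Hypothesis Cv : C1_with D v vt vr.

Lemma solution_mass t r : D (t, r) -> 0 < t -> 0 < r ->
  a t * mt t r + v t r * mr t r =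
  - mm t r * (vr t r + n.-1%:R * (v t r / r) + n%:R * a' t + a' t * v t r ^+ 2 / c ^+ 2).
Proof.
move=> Dtr t0 r0; have cn0 := lt0r_neq0 (light_gt0 G).
have er : enorm (axis i0 r) = r by rewrite enorm_axis gtr0_norm.
have rx : 0 < enorm (axis i0 r) by rewrite er.
have Dx : D (t, enorm (axis i0 r)) by rewrite er.
have := (mass_equation_radial oD (@scale_der R G) Cm Cv t0 rx Dx n0).1
  (sol_mass sol t0 Dx).
rewrite er /mass_residue (mm_rho Dtr) => H.
apply/eqP; rewrite -subr_eq0; apply/eqP; rewrite -[RHS]H.
by field; rewrite cn0 gt_eqF.
Qed.

Lemma solution_momentum t r : D (t, r) -> 0 < t -> 0 < r ->
  mm t r * (a t * vt t r + v t r * vr t r + a' t * v t r * (1 - v t r ^+ 2 / c ^+ 2)) = 0.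
Proof.
move=> Dtr t0 r0; have cn0 := lt0r_neq0 (light_gt0 G).
have er : enorm (axis i0 r) = r by rewrite enorm_axis gtr0_norm.
have rx : 0 < enorm (axis i0 r) by rewrite er.
have Dx : D (t, enorm (axis i0 r)) by rewrite er.
have H1 := (mass_equation_radial oD (@scale_der R G) Cm Cv t0 rx Dx n0).1
  (sol_mass sol t0 Dx).
have := (momentum_equation_radial oD (@scale_der R G) Cm Cv t0 rx Dx n0 i0).1
  (sol_momentum sol t0 Dx i0).
rewrite er in H1 *; rewrite axisE eqxx mulr1 divff ?gt_eqF// mul1r.
rewrite (@momentum_residueE R n c a a' rho)//; last exact: mm_rho.
by rewrite H1 mulr0 add0r.
Qed.

Lemma cont_along T f (g : R -> R) : cont2 D f -> {within `[0, T], continuous g} ->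
  (forall s, 0 <= s <= T -> D (s, g s)) -> {within `[0, T], continuous (fun s => f s (g s))}.
Proof.
move=> cf cg Dg; apply: (cont_curve cf (f := id) (g := g)); last exact: cg.
  by move=> s; rewrite /= in_itv/=; exact: Dg.
by apply: continuous_subspaceT => s; exact: cvg_id.
Qed.

Lemma segment_sub (T : R) : `[0, T]%classic `<=` `[0, +oo[%classic.
Proof. by move=> s; rewrite /= !in_itv/= andbT => /andP[]. Qed.

Lemma scale_within T : {within `[0, T], continuous a}.
Proof.
apply: (continuous_subspaceW (@segment_sub T)).
by apply: (hdw_within (df := a')) => s; rewrite /= in_itv/= andbT; exact: scale_deriv.
Qed.

Lemma scale'_within T : {within `[0, T], continuous a'}.
Proof. exact: (continuous_subspaceW (@segment_sub T) (@scale'_cont _ G)). Qed.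

Lemma scale_gt0 t : 0 <= t -> 0 < a t.
Proof. by move=> t0; exact: lt_le_trans ltr01 (@scale_ge1 R G t t0). Qed.

(** For [th = 0] the curve [g] is a trajectory of the given solution; for [th
    = 1] it is the path of the explicit flow. Let [u] be the difference [v -
    vel] along [g] and [m] the mass. Where [m] is nonzero, subtracting the
    two equations of motion gives [u' = - b u], and [u] remains zero. Where
    [u] is zero, the curve has the velocity of the fluid and the mass
    equation reads [m' = - q m], so that [m] remains positive. Each fact
    needs the other, and they are tied at the first time at which [m] fails
    to be positive: before that time both hold, and then [m] is positive at
    that time as well. *)
Lemma transport T (g : R -> R) (th al : R) : 0 <= T ->
  (forall s, 0 <= s <= T -> D (s, g s) /\ 0 < g s) ->
  (forall s, 0 <= s <= T -> has_deriv_within `[0, T] g s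
     ((v s (g s) - th * (v s (g s) - vel G s al)) / a s)) ->
  g 0 = al -> forall s, 0 <= s <= T -> v s (g s) = vel G s al /\ 0 < rho s (g s).
Proof.
move=> T0 Dg dg g0.
have cg : {within `[0, T], continuous g}.
  by apply: hdw_within => s; rewrite /= in_itv/=; exact: dg.
have DgI s : 0 <= s <= T -> D (s, g s) by move=> /Dg[].
have cY : {within `[0, T], continuous (fun s => v s (g s))}.
  exact: cont_along (C1_cont Cv) cg DgI.
have cM : {within `[0, T], continuous (fun s => mm s (g s))}.
  exact: cont_along (C1_cont Cm) cg DgI.
have cvr : {within `[0, T], continuous (fun s => vr s (g s))}.
  have [_ h _] := (C1_withP D v vt vr).1 Cv; exact: cont_along h cg DgI.
have ca := @scale_within T; have ca' := @scale'_within T; have cV := cont_label (C1_cont (C1_vel G)) (s := al) (T := T) (fun s h => proj1 (andP h)).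
have a0 s : `[0, T]%classic s -> a s != 0.
  by rewrite /= in_itv/= => /andP[s0 _]; rewrite gt_eqF// scale_gt0.
have gn0 s : `[0, T]%classic s -> g s != 0.
  by rewrite /= in_itv/= => /Dg[_ ?]; rewrite gt_eqF.
pose u s := v s (g s) + -1 * vel G s al.
(* The coefficients of [u' = - b u] and [m' = - q m]. The quadratic
   expression in [b] is the quotient of [v^3 - vel^3] by [v - vel]. *)
pose b s := (th * vr s (g s) + a' s * (1 + -1 * ((v s (g s) * v s (g s) +
  v s (g s) * vel G s al + vel G s al * vel G s al) * c ^- 2))) * (a s)^-1.
pose q s := (vr s (g s) + n.-1%:R * (v s (g s) * (g s)^-1) + n%:R * a' s +
  a' s * (v s (g s) * v s (g s)) * c ^- 2) * (a s)^-1.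
have cu : {within `[0, T], continuous u}.
  by apply: withinD => //; apply: withinM => //; exact: within_const.
have cV2 := withinM cV cV; have cYV := withinM cY cV; have cYY := withinM cY cY.
have cai := withinV ca a0; have cgi := withinV cg gn0.
have cc k : {within `[0, T], continuous (fun=> k : R)} by exact: within_const.
have cb : {within `[0, T], continuous b}.
  apply: withinM => //; apply: withinD; first exact: withinM.
  apply: withinM => //; apply: withinD => //; apply: withinM => //.
  by apply: withinM => //; apply: withinD => //; exact: withinD.
have cq : {within `[0, T], continuous q}.
  apply: withinM => //; apply: withinD.
    apply: withinD; last exact: withinM.
    by apply: withinD => //; apply: withinM => //; exact: withinM.
  by apply: withinM => //; exact: withinM.
have cn0 := lt0r_neq0 (light_gt0 G).
have g0pos : 0 < g 0 by apply: (Dg 0 _).2; rewrite lexx.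
have u0 : u 0 = 0 by rewrite /u initial_v// g0; ring.
have M0 : 0 < mm 0 (g 0).
  have D0 : D (0, g 0) by apply: DgI; rewrite lexx.
  apply: divr_gt0; last exact: (subluminal_gt0 (light_gt0 G) (sol_subluminal sol D0)).
  by rewrite initial_rho ?dens_gt0// ltW.
have inI (s : R) : s \in `]0, T[ -> [/\ 0 < s, 0 <= s <= T & s \in `]0, T[].
  by move=> sI; split => //; move: sI; rewrite in_itv/= => /andP[h1 h2] //; rewrite !ltW.
have dY s : s \in `]0, T[ -> is_derive s 1 (fun s => v s (g s))
    (vt s (g s) + vr s (g s) * ((v s (g s) - th * (v s (g s) - vel G s al)) / a s)).
  move=> /inI[s0 sT sI]; apply: (hdw_itv_derive sI).
  have sA : `[0, T]%classic s by rewrite /= in_itv.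
  have := hdw_curve Cv sA _ (@hdw_id _ _ s) (dg s sT); rewrite mulr1; apply.
  by move=> x; rewrite /= in_itv/=; exact: DgI.
have dM s : s \in `]0, T[ -> is_derive s 1 (fun s => mm s (g s))
    (mt s (g s) + mr s (g s) * ((v s (g s) - th * (v s (g s) - vel G s al)) / a s)).
  move=> /inI[s0 sT sI]; apply: (hdw_itv_derive sI).
  have sA : `[0, T]%classic s by rewrite /= in_itv.
  have := hdw_curve Cm sA _ (@hdw_id _ _ s) (dg s sT); rewrite mulr1; apply.
  by move=> x; rewrite /= in_itv/=; exact: DgI.
have du s : s \in `]0, T[ -> mm s (g s) != 0 -> is_derive s 1 u (- b s * u s).
  move=> sI Mn0; have [s0 sT _] := inI s sI.
  have [Ds gs0] := Dg s sT.
  have an0 : a s != 0 by rewrite gt_eqF// scale_gt0// ltW.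
  have dV := C1_dt al (C1_vel G) s0.
  apply: (is_derive_eq (derD (dY s sI) (derM (derC (-1) s) dV))).
  have Hm := solution_momentum Ds s0 gs0.
  have {}Hm : a s * vt s (g s) + v s (g s) * vr s (g s) +
     a' s * v s (g s) * (1 - v s (g s) ^+ 2 / c ^+ 2) = 0.
    by move/eqP: Hm; rewrite mulf_eq0 (negbTE Mn0) => /eqP.
  have HV := velt_ode G s al; rewrite clockE ?(ltW s0)// in HV.
  have E1 : vt s (g s) = - (v s (g s) * vr s (g s) +
     a' s * v s (g s) * (1 - v s (g s) ^+ 2 / c ^+ 2)) / a s.
    apply: (mulfI an0); rewrite [RHS]mulrC divfK//; lra.
  have E2 : velt G s al = - (a' s * vel G s al * (1 - vel G s al ^+ 2 / c ^+ 2)) / a s.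
    apply: (mulfI an0); rewrite [RHS]mulrC divfK//; lra.
  rewrite E1 E2 /b /u; field; by rewrite an0 cn0.
have uzero sg : 0 <= sg <= T -> (forall s, 0 < s < sg -> 0 < mm s (g s)) -> u sg = 0.
  move=> /andP[sg0 sgT] Mpos.
  have [|e _ ->] := linear_ode sg0 (within_sub sgT cu) (within_sub sgT cb); last first.
    by rewrite u0 mulr0.
  move=> s; rewrite in_itv/= => /andP[s0 ss]; apply: du.
    by rewrite in_itv/= s0 (lt_le_trans ss).
  by rewrite gt_eqF// Mpos// s0.
(* The first nonpositive value of the mass would be a positive multiple of
   the initial mass. *)
have Mpos : forall s, 0 <= s <= T -> 0 < mm s (g s).
  move=> s1 s1T; rewrite ltNge; apply/negP => Ms1.
  have [|tau /andP[tau0 tauT] [Mtau Mb]] := first_nonpos T0 cM M0.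
    by exists s1.
  have [|e e0] := linear_ode (ltW tau0) (within_sub tauT cM) (within_sub tauT cq).
    move=> s; rewrite in_itv/= => /andP[s0 ss].
    have sI : s \in `]0, T[ by rewrite in_itv/= s0 (lt_le_trans ss).
    have [_ sT _] := inI s sI; have [Ds gs0] := Dg s sT.
    have us : u s = 0.
      apply: uzero => // x /andP[x0 xs]; apply: Mb; rewrite (ltW x0)/=.
      exact: lt_trans xs ss.
    have {}us : v s (g s) - vel G s al = 0 by rewrite -us /u mulN1r.
    have an0 : a s != 0 by rewrite gt_eqF// scale_gt0// ltW.
    apply: (is_derive_eq (dM s sI)); rewrite us mulr0 subr0.
    have Hm := solution_mass Ds s0 gs0.
    have -> : mt s (g s) + mr s (g s) * (v s (g s) / a s) =
      (a s * mt s (g s) + v s (g s) * mr s (g s)) / a s by field.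
    by rewrite Hm /q; field; rewrite an0 cn0 gt_eqF.
  move=> Et; move: Mtau; rewrite Et leNgt; by rewrite mulr_gt0.
move=> s sT; have [Ds _] := Dg s sT.
split; last by rewrite mm_rho// mulr_gt0 ?Mpos//; exact: (subluminal_gt0 (light_gt0 G) (sol_subluminal sol Ds)).
have := uzero s sT; rewrite /u mulN1r => H; apply/eqP; rewrite -subr_eq0; apply/eqP; apply: H.
move=> x /andP[x0 xs]; apply: Mpos; rewrite (ltW x0)/=.
by move: sT => /andP[_]; apply: le_trans; exact: ltW.
Qed.

End AnySolution.

(** * Uniqueness *)

Section Uniqueness.
Context {R : realType} (G : flow R).
Implicit Types (t r s : R).
Local Notation c := (light G).
Local Notation a := (scale G).
Local Notation a' := (scale' G).
Variables (n : nat) (n0 : (0 < n)%N).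
Variables (rho0 v0 : R -> R) (eps : R).
Hypothesis initial_density : forall r, 0 <= r -> eps * rho0 r = dens G r.
Hypothesis initial_velocity : forall r, 0 < r -> eps * v0 r = vel G 0 r.
Variables (D : set (R * R)) (rho v : R -> R -> R).
Hypothesis oD : relopen D.
Hypothesis sol : classical_solution n c a a' rho0 v0 eps D rho v.
Variable E : set (R * R).
Hypothesis LE : label_set G E.
Hypothesis DE : D `<=` swept G E.
Hypothesis back : forall t r, D (t, r) -> 0 < r ->
  forall s, 0 <= s <= t -> D (s, path G s (lab G E t r)).

Lemma cvg_at_right0 (f : R -> R -> R) t : cont2 D f -> D (t, 0) ->
  f t u @[u --> (0 : R)^'+] --> f t 0.
Proof.
move=> cf Dt; have [t0 _] := oD.1 _ Dt.
have cv : (fun u : R => (t, u)) @ (0 : R)^'+ --> within D (nbhs (t, 0)).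
  have ci : (fun u : R => u) @ (0 : R)^'+ --> (0 : R).
    by apply: cvg_within_filter; exact: cvg_id.
  apply: cvg_into; first exact: (cvg_pair (cvg_cst t) ci).
  rewrite /at_right /prop_near1 /= /within /=.
  by apply: filterS (relopen_r oD Dt) => u h u0; apply: h; exact: ltW.
exact: (cvg_comp _ _ cv (cf _ Dt)).
Qed.

(** The reduced equations hold off the centre; continuity extends the
    agreement of two fields to it. *)
Lemma eq_at_center (f g : R -> R -> R) t : cont2 D f -> cont2 D g -> D (t, 0) ->
  (forall u, 0 < u -> D (t, u) -> f t u = g t u) -> f t 0 = g t 0.
Proof.
move=> cf cg Dt fg; have cf0 := cvg_at_right0 cf Dt; have cg0 := cvg_at_right0 cg Dt.
have cf1 : f t u @[u --> (0 : R)^'+] --> g t 0.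
  move: cg0; apply: cvg_trans; apply: near_eq_cvg.
  rewrite /at_right /prop_near1 /= /within /=; apply: filterS (relopen_r oD Dt) => u h u0.
  by rewrite fg//; apply: h; exact: ltW.
exact: (cvg_unique _ cf0 cf1).
Qed.

Lemma lab_gt0 t r : D (t, r) -> 0 < r -> 0 < lab G E t r.
Proof.
move=> /DE /labP[/(ls_ge0 LE)[_ s0] pr] r0; rewrite lt0r s0 andbT.
by apply: contraTneq r0 => s0'; rewrite -pr s0' path_at0 ltxx.
Qed.

Lemma path_gt0 t s : E (t, s) -> 0 < s -> 0 < path G t s.
Proof. by move=> Es s0; have := path_incr LE (lexx 0) s0 Es; rewrite path_at0. Qed.

Lemma ls_before t s u : E (t, s) -> 0 <= u <= t -> E (u, s).
Proof.
move=> Es ut; apply: (ls_down LE Es ut); rewrite lexx andbT.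
by have [] := ls_ge0 LE Es.
Qed.

Lemma v_eq_path t r : D (t, r) -> 0 < r -> forall s, 0 <= s <= t ->
  v s (path G s (lab G E t r)) = vel G s (lab G E t r).
Proof.
move=> Dtr r0 s st; have [Es pr] := labP (DE Dtr); have al0 := lab_gt0 Dtr r0.
set al := lab G E t r in Es pr al0 *.
have [mt [mr Cm]] := C1_mm sol; have [vt [vr Cv]] := sol_v_C1 sol.
have [t0 _] := oD.1 _ Dtr.
apply: (proj1 (transport n0 initial_density initial_velocity oD sol Cm Cv
  (g := fun u => path G u al) (th := 1) (al := al) t0 _ _ _ st)).
- move=> u ut; split; first exact: back.
  by apply: path_gt0 al0; exact: ls_before Es ut.
- move=> u ut; rewrite mul1r subKr.
  have uI : `[0, t]%classic u by rewrite /= in_itv.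
  have [_] := explicit_trajectory LE Es uI.
  by rewrite evel_path//; exact: ls_before Es ut.
- exact: path0.
Qed.

Lemma solution_v t r : D (t, r) -> v t r = evel G E t r.
Proof.
have pos u x : 0 < x -> D (u, x) -> v u x = evel G E u x.
  move=> x0 Dux; have [u0 _] := oD.1 _ Dux; have [Es px] := labP (DE Dux).
  rewrite -{1}px v_eq_path// ?u0 ?lexx//.
move=> Dtr; have [_] := oD.1 _ Dtr; rewrite /= le_eqVlt => /orP[/eqP r0|r0].
  rewrite -r0 in Dtr *; have [vt [vr Cv]] := sol_v_C1 sol.
  apply: eq_at_center => // [||u u0 Du]; [exact: C1_cont Cv| |exact: pos].
  exact: C1_cont (C1_sub DE (C1_evel LE)).
exact: pos.
Qed.

Lemma solution_vr vt vr t r : C1_with D v vt vr -> D (t, r) -> vr t r = evelr G E t r.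
Proof.
move=> Cv Dtr; have Ce := C1_sub DE (C1_evel LE).
have [_ r0] := oD.1 _ Dtr.
apply: (@hdw_unique_right R [set u | D (t, u)] (evel G E t) r).
- apply: filterS (relopen_r oD Dtr) => u h ru; apply: h.
  by rewrite (le_trans r0)// ltW.
- apply: hdw_ext (hdw_r Cv Dtr) => //.
  by move=> u Du; exact: solution_v.
- exact: (hdw_r Ce Dtr).
Qed.

(** Once the velocities agree, the masses of the two solutions satisfy the
    same linear equation along the paths, and so does their difference. *)
Lemma solution_rho t r : D (t, r) -> rho t r = erho G E n t r.
Proof.
have esol := explicit_solution LE n0 initial_density initial_velocity.
have oS := swept_relopen LE.
have [mt [mr Cm]] := C1_mm sol; have [vt [vr Cv]] := sol_v_C1 sol.
have [et [er Ce]] := C1_mm esol; have Cev := C1_evel LE.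
have pos u x : 0 < x -> D (u, x) -> rho u x = erho G E n u x.
  move=> x0 Dux; have [u0 _] := oD.1 _ Dux; have [Es px] := labP (DE Dux).
  have al0 := lab_gt0 Dux x0; have bk := back Dux x0.
  set al := lab G E u x in Es px al0 bk *.
  pose e := mass c (erho G E n) (evel G E).
  pose y s := mass c rho v s (path G s al) + -1 * e s (path G s al).
  pose q s := (vr s (path G s al) + n.-1%:R * (v s (path G s al) * (path G s al)^-1)
    + n%:R * a' s + a' s * (v s (path G s al) * v s (path G s al)) * c ^- 2) * (a s)^-1.
  have dp s : 0 <= s <= u -> has_deriv_within `[0, u] (fun s => path G s al) s
      (vel G s al / a s).
    move=> su; have sI : `[0, u]%classic s by rewrite /= in_itv.
    have [_] := explicit_trajectory LE Es sI.
    by rewrite evel_path//; exact: ls_before Es su.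
  have pp s : 0 <= s <= u -> 0 < path G s al.
    by move=> su; apply: path_gt0 al0; exact: ls_before Es su.
  have cp : {within `[0, u], continuous (fun s => path G s al)}.
    by apply: hdw_within => s; rewrite /= in_itv/=; exact: dp.
  have cont f : cont2 D f -> {within `[0, u], continuous (fun s => f s (path G s al))}.
    by move=> cf; exact: cont_along cf cp bk.
  have conte f : cont2 (swept G E) f -> {within `[0, u], continuous (fun s => f s (path G s al))}.
    by move=> cf; apply: cont_along cf cp _ => s su; apply: DE; exact: bk.
  have cc k : {within `[0, u], continuous (fun=> k : R)} by exact: within_const.
  have cv := cont _ (C1_cont Cv).
  have cvr : {within `[0, u], continuous (fun s => vr s (path G s al))}.
    by have [_ h _] := (C1_withP D v vt vr).1 Cv; exact: cont.
  have a0 s : `[0, u]%classic s -> a s != 0.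
    by rewrite /= in_itv/= => /andP[s0 _]; rewrite gt_eqF// scale_gt0.
  have pn0 s : `[0, u]%classic s -> path G s al != 0.
    by rewrite /= in_itv/= => /pp ?; rewrite gt_eqF.
  have ca := @scale_within R G u; have ca' := @scale'_within R G u.
  have cq : {within `[0, u], continuous q}.
    have cvv := withinM cv cv; have cai := withinV ca a0; have cpi := withinV cp pn0.
    apply: withinM => //; apply: withinD.
      apply: withinD; last exact: withinM.
      by apply: withinD => //; apply: withinM => //; exact: withinM.
    by apply: withinM => //; exact: withinM.
  have cy : {within `[0, u], continuous y}.
    apply: withinD; first exact: cont (C1_cont Cm).
    by apply: withinM => //; exact: conte (C1_cont Ce).
  have dy s : s \in `]0, u[ -> is_derive s 1 y (- q s * y s).
    move=> sI; have := sI; rewrite in_itv/= => /andP[s0 s1].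
    have su : 0 <= s <= u by rewrite !ltW.
    have Ds := bk s su; have Ss := DE Ds; have ps := pp s su.
    have sA : `[0, u]%classic s by rewrite /= in_itv.
    have vs : v s (path G s al) = vel G s al by exact: v_eq_path.
    have Dm : is_derive s 1 (fun s => mass c rho v s (path G s al))
        (mt s (path G s al) + mr s (path G s al) * (vel G s al / a s)).
      apply: (hdw_itv_derive sI).
      have := hdw_curve Cm sA _ (@hdw_id _ _ s) (dp s su); rewrite mulr1; apply.
      by move=> z; rewrite /= in_itv/=; exact: bk.
    have De : is_derive s 1 (fun s => e s (path G s al))
        (et s (path G s al) + er s (path G s al) * (vel G s al / a s)).
      apply: (hdw_itv_derive sI).
      have := hdw_curve Ce sA _ (@hdw_id _ _ s) (dp s su); rewrite mulr1; apply.
      by move=> z; rewrite /= in_itv/= => zu; apply: DE; exact: bk.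
    have an0 : a s != 0 by rewrite gt_eqF// scale_gt0// ltW.
    have cn0 := lt0r_neq0 (light_gt0 G).
    apply: (is_derive_eq (derD Dm (derM (derC (-1) s) De))).
    have H1 := solution_mass n0 oD sol Cm Cv Ds s0 ps.
    have H2 := solution_mass n0 oS esol Ce Cev Ss s0 ps.
    rewrite -(solution_v Ds) -(solution_vr Cv Ds) -/e in H2.
    have comb (mt1 mr1 : R) : mt1 + mr1 * (vel G s al / a s) =
       (a s * mt1 + v s (path G s al) * mr1) / a s by rewrite vs; field.
    rewrite !comb H1 H2 /q /y mul0r add0r mulrA.
    by field; rewrite an0 cn0 gt_eqF.
  have [b b0] := linear_ode u0 cy cq dy.
  have y0 : y 0 = 0.
    rewrite /y /e /mass path0 (initial_rho n0 initial_density sol) ?(ltW al0)//.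
    rewrite (initial_rho n0 initial_density esol) ?(ltW al0)//.
    rewrite (initial_v n0 initial_velocity sol)// (initial_v n0 initial_velocity esol)//.
    by rewrite mulN1r subrr.
  rewrite y0 mulr0 /y px mulN1r => /eqP; rewrite subr_eq0 => /eqP H.
  rewrite (mm_rho sol Dux) (mm_rho esol (DE Dux)) H; congr (_ * (_ - _ ^+ 2)).
  exact: solution_v.
move=> Dtr; have [_] := oD.1 _ Dtr; rewrite /= le_eqVlt => /orP[/eqP r0|r0].
  rewrite -r0 in Dtr *; have [rt [rr Cr]] := sol_rho_C1 sol.
  have [ft [fr Cf]] := C1_erho LE n.
  apply: eq_at_center => // [||w w0 Dw]; [exact: C1_cont Cr| |exact: pos].
  exact: C1_cont (C1_sub DE Cf).
exact: pos.
Qed.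

End Uniqueness.

(** * Trajectories of arbitrary developments *)

Section Trajectories.
Context {R : realType} (G : flow R).
Implicit Types (t r s : R).
Local Notation c := (light G).
Local Notation a := (scale G).
Local Notation a' := (scale' G).
Variables (n : nat) (n0 : (0 < n)%N).
Variables (rho0 v0 : R -> R) (eps : R).
Hypothesis initial_density : forall r, 0 <= r -> eps * rho0 r = dens G r.
Hypothesis initial_velocity : forall r, 0 < r -> eps * v0 r = vel G 0 r.
Variables (D : set (R * R)) (rho v : R -> R -> R).
Hypothesis oD : relopen D.
Hypothesis sol : classical_solution n c a a' rho0 v0 eps D rho v.

(** The vector field is differentiable along an axis through the origin,
    hence continuous along it, and its radial form takes the value [0] at the
    origin. *)
Lemma velocity_center t : D (t, 0) -> v t 0 = 0.
Proof.
move=> Dt; pose i0 : 'I_n := Ordinal n0.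
have [vt [vr Cv]] := sol_v_C1 sol.
have D0 : D (t, enorm (0 : 'rV[R]_n)) by rewrite enorm0.
have E0 : axis i0 0 = 0 :> 'rV[R]_n by rewrite /axis scale0r.
have dv : derivable (radial_vector (v t) i0) (0 : 'rV[R]_n) (delta_mx 0 i0) by exact: (sol_v_derivable sol D0).
rewrite -E0 in dv; have d := derive_axis dv.
have cf : radial_vector (v t) i0 (axis i0 h) @[h --> (0 : R)] -->
    radial_vector (v t) i0 (axis i0 (0 : R)) := der_cont d.
have cr : v t h @[h --> (0 : R)^'+] --> (0 : R).
  have : radial_vector (v t) i0 (axis i0 h) @[h --> (0 : R)^'+] --> (0 : R).
    move: cf; rewrite {2}/radial_vector E0 mxE mul0r mulr0 => cf.
    exact: cvg_within_filter cf.
  apply: cvg_trans; apply: near_eq_cvg.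
  rewrite /at_right /prop_near1 /= /within /=.
  apply: (@nearW _ (nbhs (0 : R))) => h h0.
  rewrite /radial_vector enorm_axis axisE eqxx mulr1 gtr0_norm// divff ?mulr1//.
  by rewrite gt_eqF.
exact: (cvg_unique _ (cvg_at_right0 oD (C1_cont Cv) Dt) cr).
Qed.

Lemma velocity_bound t : D (t, 0) -> exists K d : R, [/\ 0 < K, 0 < d &
  forall s u, 0 <= s -> `|s - t| < d -> 0 <= u < d -> v s u <= K * u].
Proof.
move=> Dt; have [vt [vr Cv]] := sol_v_C1 sol.
have [_ cvr _] := (C1_withP D v vt vr).1 Cv.
pose K := `|vr t 0| + 1.
have K0 : 0 < K by rewrite ltr_wpDl.
have h1 : \forall q \near within D (nbhs (t, 0)), vr q.1 q.2 < K.
  apply: (cvgr_lt _ (cvr _ Dt)); rewrite /=.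
  by rewrite (le_lt_trans (ler_norm _))// ltrDl.
move: h1; rewrite near_withinE => h1.
have h2 : nbhs (t, 0) [set q | (D q -> vr q.1 q.2 < K) /\ (quadrant q -> D q)].
  exact: filterI h1 (oD.2 _ Dt).
have [d /= d0 hd] := (nbhs_ballP (t, 0) _).1 h2.
exists K, d; split => // s u s0 sd /andP[u0 ud].
have inD x : 0 <= x <= u -> D (s, x) /\ vr s x < K.
  move=> /andP[x0 xu]; have [] := hd (s, x).
    by split; rewrite /= /ball/= distrC// subr0 ger0_norm// (le_lt_trans xu).
  by move=> k2 k3; have Dsx := k3 (conj s0 x0); split => //; exact: k2.
have Ds0 : D (s, 0) by apply: (inD 0 _).1; rewrite lexx.
have [||x] := MVT_segment u0 (f := v s) (df := vr s).
- move=> x; rewrite in_itv/= => /andP[x0 xu]; apply: (der_r oD Cv) => //.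
  by apply: (inD x _).1; rewrite !ltW.
- apply: (@hdw_within R `[0, u] (v s) (vr s)) => x; rewrite /= in_itv/= => xu.
  apply: hdw_sub (hdw_r Cv (inD x xu).1) => y; rewrite /= in_itv/=.
  by move=> yu; exact: (inD y yu).1.
rewrite in_itv/= => xu; rewrite velocity_center// !subr0 => ->.
by rewrite ler_wpM2r// ltW//; exact: (inD x xu).2.
Qed.

(** A trajectory cannot leave the centre. Near the centre the velocity is at
    most [K * r], so that [r * exp (- K * t)] does not increase along a
    trajectory that has just left the centre, whereas it would have to grow
    from [0]. *)
Lemma trajectory_gt0 t g : 0 <= t -> trajectory a v D `[0, t] g -> 0 < g t ->
  forall s, 0 <= s <= t -> 0 < g s.
Proof.
move=> t0 traj gt s1 s1t; rewrite ltNge; apply/negP => gs1.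
have tr s : 0 <= s <= t -> D (s, g s) /\ has_deriv_within `[0, t] g s (v s (g s) / a s).
  by move=> st; apply: traj; rewrite /= in_itv.
have cg : {within `[0, t], continuous g}.
  by apply: hdw_within => s; rewrite /= in_itv/= => /tr[_]; exact.
have /subspace_continuousP cg' := cg.
have cgr : {within `[0, t], continuous (fun s => g (t - s))}.
  apply/subspace_continuousP => s sI; have := sI; rewrite /= in_itv/= => /andP[s0 st].
  have tsI : `[0, t]%classic (t - s) by rewrite /= in_itv/= subr_ge0 st gerBl.
  have cs := cg' _ tsI.
  have cv : (fun u => t - u) @ within `[0, t] (nbhs s) --> within `[0, t] (nbhs (t - s)).
    apply: cvg_into.
      by apply: cvgB; [exact: cvg_cst|apply: cvg_within_filter; exact: cvg_id].
    near=> u; have : `[0, t]%classic u by near: u; exact: withinT.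
    by rewrite /= !in_itv/= => /andP[u0 ut]; rewrite subr_ge0 ut gerBl.
  exact: (cvg_comp _ _ cv cs).
have [||tau /andP[tau0 taut] [gtau gb]] := first_nonpos t0 cgr.
- by rewrite subr0.
- exists (t - s1); last by rewrite subKr.
  by move: s1t => /andP[h1 h2]; rewrite subr_ge0 h2 gerBl.
(* The last time at the centre, found by running time backwards from [t]. *)
pose s0 := t - tau.
have s00 : 0 <= s0 by rewrite subr_ge0.
have s0t : s0 < t by rewrite /s0 ltrBlDr ltrDl.
have [Ds0 _] : D (s0, g s0) /\ _ := tr s0 ltac:(by rewrite s00 ltW).
have gs0 : g s0 = 0.
  by apply/eqP; rewrite eq_le gtau/=; have [_] := oD.1 _ Ds0.
rewrite gs0 in Ds0.
have after s : s0 < s <= t -> 0 < g s.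
  move=> /andP[h1 h2]; rewrite -[s](subKr t); apply: gb.
  by rewrite subr_ge0 h2/= ltrBlDr -ltrBlDl.
have [K [d [K0 d0 vK]]] := velocity_bound Ds0.
have s0I : `[0, t]%classic s0 by rewrite /= in_itv/= s00 ltW.
have near_small : \forall s \near s0, 0 <= s <= t -> g s < d.
  have h : g s @[s --> within `[0, t] (nbhs s0)] --> g s0 := cg' _ s0I.
  have : \forall s \near within `[0, t] (nbhs s0), g s < d.
    by apply: (cvgr_lt _ h); rewrite gs0.
  by move=> /near_within_nbhs; apply: filterS => s hs st; apply: hs; rewrite /= in_itv.
have /nbhs_ballP[d1 /= d10 hd1] := near_small.
pose del := Num.min (t - s0) (Num.min (d / 2) (d1 / 2)).
have del0 : 0 < del by rewrite !lt_min subr_gt0 s0t !divr_gt0.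
pose s2 := s0 + del.
have s2t : s2 <= t by rewrite /s2 -lerBrDl ge_min lexx.
have hs2 s : s0 <= s <= s2 -> [/\ 0 <= s <= t, `|s - s0| < d & g s < d].
  move=> /andP[h1 h2]; have st : 0 <= s <= t by rewrite (le_trans s00)// (le_trans h2).
  have sd : `|s - s0| <= del by rewrite ger0_norm ?subr_ge0// lerBlDl.
  have half (x : R) : 0 < x -> x / 2 < x by move=> x0; rewrite ltr_pdivrMr// ltr_pMr// ltr1n.
  split => //; first by rewrite (le_lt_trans sd)// (le_lt_trans _ (half _ d0))// !ge_min lexx !orbT.
  apply: hd1 => //; rewrite /ball/= distrC (le_lt_trans sd)//.
  by rewrite (le_lt_trans _ (half _ d10))// !ge_min lexx !orbT.
have s02 : s0 <= s2 by rewrite lerDl ltW.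
pose phi s := g s * expR (- K * s).
pose dphi s := (v s (g s) / a s - K * g s) * expR (- K * s).
have dp (s : R) : s \in `]s0, s2[ -> is_derive s 1 phi (dphi s).
  rewrite in_itv/= => /andP[h1 h2].
  have [st _ _] := hs2 s ltac:(by rewrite !ltW).
  have sI : s \in `]0, t[ by rewrite in_itv/= (le_lt_trans s00 h1) (lt_le_trans h2).
  have dg := hdw_itv_derive sI (tr s st).2.
  have da := der_affine (- K) 0 s.
  have E : phi = (fun s => g s * expR (- K * s + 0)).
    by apply/funext => x; rewrite addr0.
  rewrite E; apply: (is_derive_eq (derM dg (der_comp (g := fun s => - K * s + 0) (is_derive_expR (- K * s + 0)) da))).
  by rewrite /dphi addr0; ring.
have cphi : {within `[s0, s2], continuous phi}.
  have sub : `[s0, s2]%classic `<=` `[0, t]%classic.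
    by move=> s; rewrite /= !in_itv/= => /hs2[].
  apply: withinM; first exact: continuous_subspaceW sub cg.
  apply: continuous_subspaceT => s.
  have h := der_comp (g := fun s => - K * s + 0) (is_derive_expR (- K * s + 0)) (der_affine (- K) 0 s).
  have : {for s, continuous (fun s => expR (- K * s + 0))} by exact: der_cont h.
  by under [X in {for _, continuous X} -> _]eq_fun do rewrite addr0.
have [x xI E] := MVT_segment s02 dp cphi.
have : phi s2 <= 0.
  have -> : phi s2 = dphi x * (s2 - s0).
    by rewrite -E /phi gs0 mul0r subr0.
  rewrite mulr_le0_ge0 ?subr_ge0// /dphi mulr_le0_ge0 ?expR_ge0// subr_le0.
  have [xt xd gx] := hs2 x ltac:(by move: xI; rewrite in_itv).
  have [Dx _] := tr x xt; have [x0 gx0] := oD.1 _ Dx.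
  have := vK x (g x) x0 xd ltac:(by rewrite gx0).
  have a1 : 1 <= a x by exact: (@scale_ge1 R G x x0).
  have ap : 0 < a x by exact: lt_le_trans a1.
  move=> vg; rewrite ler_pdivrMr//; apply: le_trans vg _.
  by rewrite ler_peMr// mulr_ge0// ltW.
rewrite leNgt /phi mulr_gt0 ?expR_gt0//; apply: after.
by rewrite s2t andbT ltrDl.
Unshelve. all: by end_near. Qed.

(** By [transport] the velocity along the trajectory is that of the explicit
    particle with the same label, so the two motions have the same
    derivative. *)
Lemma trajectory_path t g : 0 <= t -> trajectory a v D `[0, t] g -> 0 < g t ->
  forall s, 0 <= s <= t -> g s = path G s (g 0).
Proof.
move=> t0 traj gt.
have pos := trajectory_gt0 t0 traj gt.
have [mt [mr Cm]] := C1_mm sol; have [vt [vr Cv]] := sol_v_C1 sol.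
have tr s : 0 <= s <= t -> D (s, g s) /\ has_deriv_within `[0, t] g s (v s (g s) / a s).
  by move=> st; apply: traj; rewrite /= in_itv.
have vE s : 0 <= s <= t -> v s (g s) = vel G s (g 0).
  move=> st; apply: (proj1 (transport n0 initial_density initial_velocity oD sol Cm Cv
    (g := g) (th := 0) (al := g 0) t0 _ _ erefl st)).
    by move=> x xt; split; [exact: (tr x xt).1|exact: pos].
  by move=> x xt; rewrite mul0r subr0; exact: (tr x xt).2.
move=> s /andP[s0 st].
pose f x := g x + -1 * path G x (g 0).
have df (x : R) : x \in `]0, s[ -> is_derive x 1 f 0.
  rewrite in_itv/= => /andP[x0 xs].
  have xt : 0 <= x <= t by rewrite ltW//= (le_trans (ltW xs)).
  have xI : x \in `]0, t[ by rewrite in_itv/= x0 (lt_le_trans xs).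
  have d1 := hdw_itv_derive xI (tr x xt).2.
  have d2 := C1_dt (g 0) (C1_path G) x0.
  apply: (is_derive_eq (derD d1 (derM (derC (-1) x) d2))).
  by rewrite vE// patht_vel clockE ?(ltW x0)//; ring.
have cg : {within `[0, t], continuous g}.
  by apply: hdw_within => x; rewrite /= in_itv/= => /tr[_]; exact.
have cp : {within `[0, s], continuous (fun x => path G x (g 0))}.
  by apply: (cont_label (C1_cont (C1_path G))) => u /andP[].
have cf : {within `[0, s], continuous f}.
  apply: withinD; first exact: within_sub st cg.
  by apply: withinM => //; exact: within_const.
have := derive0_cst s0 cf df.
rewrite /f path0 => H; apply/eqP; rewrite -subr_eq0; apply/eqP.
by have : g 0 + -1 * g 0 = 0 by [ring]; rewrite -H mulN1r.
Qed.

End Trajectories.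

Section Developments.
Context {R : realType} (G : flow R).
Implicit Types (t r s : R).
Local Notation c := (light G).
Local Notation a := (scale G).
Local Notation a' := (scale' G).
Variables (n : nat) (n0 : (0 < n)%N).
Variables (rho0 v0 : R -> R) (eps : R).
Hypothesis initial_density : forall r, 0 <= r -> eps * rho0 r = dens G r.
Hypothesis initial_velocity : forall r, 0 < r -> eps * v0 r = vel G 0 r.
Variables (D : set (R * R)) (rho v : R -> R -> R).
Hypothesis dev : development n c a a' rho0 v0 eps D rho v.
Variable E : set (R * R).
Hypothesis LE : label_set G E.
Hypothesis full : forall t r, swept G E (t, r) -> forall s, 0 <= s -> E (t, s).

Lemma development_relopen : relopen D.
Proof.
have [[U oU ->] _ _ _] := dev; split => [p []//|p [qp Up]].
have := open_nbhs_nbhs (conj oU Up); apply: filterS => q Uq qq; by split.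
Qed.

Lemma relopenI (D1 D2 : set (R * R)) : relopen D1 -> relopen D2 -> relopen (D1 `&` D2).
Proof.
move=> [s1 o1] [s2 o2]; split => [p [/s1]//|p [h1 h2]].
by apply: filterS2 (o1 _ h1) (o2 _ h2) => q k1 k2 qq; split; [exact: k1|exact: k2].
Qed.

(** Each point of a development off the centre is joined to the initial line
    by a trajectory, which is an explicit path. This puts the past of the
    point inside the common domain, as the uniqueness argument requires. *)
Lemma development_agree t r : D (t, r) -> swept G E (t, r) ->
  rho t r = erho G E n t r /\
  forall vt vr, C1_with D v vt vr -> vr t r = evelr G E t r.
Proof.
have [_ _ sol reach] := dev.
have oD := development_relopen; have oS := swept_relopen LE.
have oI := relopenI oD oS.
have sI := classical_solution_sub (@subIsetl _ D (swept G E)) sol.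
have sub : D `&` swept G E `<=` swept G E by move=> p [].
have back u x : (D `&` swept G E) (u, x) -> 0 < x ->
    forall s, 0 <= s <= u -> (D `&` swept G E) (s, path G s (lab G E u x)).
  move=> [Dux Sux] x0 s su; have [g [tg gu]] := reach _ _ Dux.
  have u0 : 0 <= u by have [] := oD.1 _ Dux.
  have gp : 0 < g u by rewrite gu.
  have gE := trajectory_path n0 initial_density initial_velocity oD sol u0 tg gp.
  have g0 : 0 < g 0.
    by apply: (trajectory_gt0 n0 oD sol u0 tg gp); rewrite lexx.
  have Eu := full Sux (ltW g0).
  have labE : lab G E u x = g 0.
    by rewrite -gu (gE u) ?u0 ?lexx// lab_path.
  have Es : E (s, g 0) by exact: (ls_before LE Eu su).
  rewrite labE; split; last exact: sweptP.
  by rewrite -gE//; apply: (tg s _).1; rewrite /= in_itv.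
move=> Dtr Str; split.
  exact: (solution_rho n0 initial_density initial_velocity oI sI LE sub back (conj Dtr Str)).
move=> vt vr Cv.
apply: (solution_vr n0 initial_density initial_velocity oI sI LE sub back _ (conj Dtr Str)).
exact: C1_sub (@subIsetl _ D (swept G E)) Cv.
Qed.

End Developments.

(** * The collapse time *)

Section Collapse.
Context {R : realType} (G : flow R).
Implicit Types (t r s : R).
Local Notation c := (light G).
Local Notation w := (mom G).
Local Notation w' := (mom' G).
Local Notation stretch := (stretch G).
Local Notation squeeze := (squeeze G).
Local Notation path := (path G).

Lemma squeeze_le t s : 0 <= t -> squeeze t s <= t.
Proof.
move=> t0; have := squeeze_lip G s (lexx 0) t0.
by rewrite squeeze0 !subr0; apply: le_trans; exact: ler_norm.
Qed.

Lemma stretch_le0 t s : 0 <= t -> stretch t s <= 0 -> [/\ 0 < t, w' s < 0 & 1 <= - w' s * t].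
Proof.
move=> t0; rewrite stretchE => H.
have q0 := squeeze_ge0 G s t0; have q1 := squeeze_le s t0.
have w0 : w' s < 0.
  rewrite ltNge; apply/negP => w0; have := mulr_ge0 w0 q0; lra.
have le : 1 <= - w' s * t.
  apply: le_trans (_ : - w' s * squeeze t s <= _); first by rewrite mulNr; lra.
  by rewrite ler_wpM2l// oppr_ge0 ltW.
split => //; rewrite lt0r t0 andbT; apply: contraTneq le => ->.
by rewrite mulr0 -ltNge.
Qed.

(** In time, the stretch of a label is monotone: where it fails to be
    positive, [w'] is negative and it keeps decreasing. *)
Lemma stretch_mono t u s : 0 <= t -> t <= u -> 0 < stretch u s -> 0 < stretch t s.
Proof.
move=> t0; rewrite le_eqVlt => /orP[/eqP -> //|tu] su.
rewrite ltNge; apply/negP => H; have [_ w0 _] := stretch_le0 t0 H.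
have := squeeze_incr G s t0 tu => q.
move: H su; rewrite !stretchE leNgt => /negP H su; apply: H.
by apply: lt_le_trans su _; rewrite lerD2l ler_nM2l// ltW.
Qed.

Lemma stretch_lip : exists2 K : R, 0 < K & forall s,
  `|w s| <= K /\ `|w' s| <= K /\
  forall t u, 0 <= t -> t <= u -> `|stretch u s - stretch t s| <= K * (u - t).
Proof.
have [K HK] := mom_bound G.
have K0 : 0 <= K by have [h _] := HK 0; exact: le_trans h.
exists (K + 1) => [|s]; first by rewrite ltr_wpDl.
have [h1 h2] := HK s; split; first by rewrite (le_trans h1)// lerDl.
split=> [|t u t0 tu]; first by rewrite (le_trans h2)// lerDl.
have -> : stretch u s - stretch t s = w' s * (squeeze u s - squeeze t s).
  by rewrite !stretchE; ring.
rewrite normrM ler_pM//; first by rewrite (le_trans h2)// lerDl.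
exact: squeeze_lip.
Qed.

Lemma stretch_cont t : 0 <= t -> {within [set: R], continuous (stretch t)}.
Proof.
move=> t0; have [? C] := C1_stretch G.
apply: (cont_curve (C1_cont C) (f := fun=> t) (g := id)) => //.
  exact: within_const.
by apply: continuous_subspaceT => u; exact: cvg_id.
Qed.

(** Particles have bounded speed, so those that start far enough out are
    still beyond the radius [r] at time [t]. *)
Lemma path_surj t r : 0 <= t -> 0 <= r -> exists2 s, 0 <= s & path t s = r.
Proof.
move=> t0 r0; have [K K0 HK] := path_bound G.
pose b := r + K * t; have b0 : 0 <= b by rewrite addr_ge0// mulr_ge0// ltW.
have cp : {within `[0, b], continuous (path t)}.
  apply/subspace_continuousP => x _; apply: cvg_within_filter.
  exact: der_cont (der_path G x t0).
have rb : r <= path t b.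
  have := HK t b t0; rewrite ler_norml => /andP[h _].
  by move: h; rewrite /b; lra.
have [|s] := IVT b0 cp (v := r); first by rewrite path_at0 ge_min r0/= le_max rb orbT.
by rewrite in_itv/= => /andP[s0 _] <-; exists s.
Qed.

Lemma label_set_quadrant : (forall t s, 0 <= t -> 0 <= s -> 0 < stretch t s) ->
  label_set G quadrant.
Proof.
move=> pos; split => //.
- by move=> p _; apply: (@nearW _ (nbhs p)) => q.
- by move=> t s t' s' _ /andP[h1 _] /andP[h2 _]; split.
- by move=> t s [/= h1 h2]; exact: pos.
Qed.

Lemma swept_full E t s : label_set G E -> (forall s, 0 <= s -> E (t, s)) -> 0 <= t ->
  0 <= s -> swept G E (t, s).
Proof.
move=> LE Et t0 s0; have [x x0 <-] := path_surj t0 s0.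
by apply: sweptP; exact: Et.
Qed.

Lemma swept_quadrantE : label_set G quadrant -> swept G quadrant = quadrant.
Proof.
move=> LE; apply/seteqP; split; first exact: swept_quadrant.
move=> [t r] [/= t0 r0]; apply: swept_full => // s s0; by split.
Qed.

(** All labels before [T], and those below [B] also up to [Ts]. The case
    [notch T T 0] is the set of all labels before [T]. *)
Definition notch (T Ts B : R) : set (R * R) :=
  [set p | quadrant p /\ (p.1 < T \/ p.1 < Ts /\ p.2 < B)].

Lemma label_set_notch T Ts B : 0 < T ->
  (forall t s, 0 <= t -> 0 <= s -> t < T -> 0 < stretch t s) ->
  (forall t s, 0 <= t -> 0 <= s -> t < Ts -> s < B -> 0 < stretch t s) ->
  label_set G (notch T Ts B).
Proof.
move=> T0 pos1 pos2; split.
- by move=> p [].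
- move=> p [qp [h|[h1 h2]]].
    have n1 : \forall q \near p, q.1 < T by apply: (cvgr_lt _ (@cvg_fst _ _ _ _ _)).
    by apply: filterS n1 => q q1 qq; split => //; left.
  have n1 : \forall q \near p, q.1 < Ts by apply: (cvgr_lt _ (@cvg_fst _ _ _ _ _)).
  have n2 : \forall q \near p, q.2 < B by apply: (cvgr_lt _ (@cvg_snd _ _ _ _ _)).
  by apply: filterS2 n1 n2 => q q1 q2 qq; split => //; right.
- move=> t s t' s' [_ /= h] /andP[a1 a2] /andP[b1 b2]; split => //=.
  case: h => [h|[h1 h2]]; first by left; exact: le_lt_trans h.
  by right; split; [exact: le_lt_trans h1|exact: le_lt_trans h2].
- by move=> s s0; split; [split|left].
- move=> t s [[/= t0 s0] [h|[h1 h2]]]; first exact: pos1.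
  exact: pos2.
Qed.

Lemma notch_strip T s t : notch T T 0 (t, s) <-> 0 <= t < T /\ 0 <= s.
Proof.
split=> [[[/= h1 h2] [h|[h _]]]|[/andP[h1 h2] h3]]; rewrite ?h1 ?h//.
by split; [split|left].
Qed.

Lemma swept_strip T : label_set G (notch T T 0) -> swept G (notch T T 0) = strip T.
Proof.
move=> LE; apply/seteqP; split => [[t r] /[dup] /(swept_quadrant LE)[/= t0 r0]|].
  by move=> [s [/= /notch_strip[h _] _]]; split.
move=> [t r] [/= /andP[t0 tT] r0]; apply: swept_full => // s s0.
by apply/notch_strip; rewrite t0.
Qed.

Hypothesis falling : exists2 s : R, 0 <= s & w' s < 0.

Definition collapse_times : set R := [set t | 0 <= t /\ exists2 s, 0 <= s & stretch t s <= 0].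

Definition collapse_time : R := inf collapse_times.

Let T := collapse_time.

Lemma collapse_has_inf : has_inf collapse_times.
Proof.
split; last by exists 0 => t [].
have [s s0 ws] := falling.
have [t t0 Mt] := squeeze_unbounded G s (- (w' s)^-1).
exists t; split; first exact: ltW.
exists s => //; rewrite stretchE -lerBrDl sub0r.
rewrite (_ : -1 = w' s * - (w' s)^-1); last by rewrite mulrN divff// lt_eqF.
by rewrite ler_nM2l.
Qed.

(** The stretch starts from [1] and decreases at a rate at most the supremum
    of [w'] in absolute value. *)
Lemma collapse_time_gt0 : 0 < T.
Proof.
have [K K0 HK] := stretch_lip.
apply: lt_le_trans (_ : K^-1 <= _); first by rewrite invr_gt0.
apply: lb_le_inf; first by case: collapse_has_inf.
move=> t [t0 [s s0 st]]; have [_ _ h] := stretch_le0 t0 st.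
rewrite -[leLHS]mul1r ler_pdivrMr// mulrC; apply: le_trans h _.
rewrite ler_wpM2r//; have [_ [h _]] := HK s.
by apply: le_trans h; rewrite -normrN ler_norm.
Qed.

Lemma before_collapse t s : 0 <= t -> 0 <= s -> t < T -> 0 < stretch t s.
Proof.
move=> t0 s0 tT; rewrite ltNge; apply/negP => H.
have : T <= t by apply: ge_inf; [case: collapse_has_inf|split=> //; exists s].
by rewrite leNgt tT.
Qed.

(** The collapse time is an infimum over an unbounded set of labels and may
    not be attained, so the labels are truncated. Shortly after [T], at [t1],
    some label [b0] has collapsed, and some larger label [B] has not:
    otherwise [w'] would be at most [- 1 / t1] beyond [b0], and [w] would be
    unbounded. On the compact set [`[0, B]] the first collapse [Ts] is
    attained by a label, which differs from [B] because [B] survives until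
    [t1]. *)
Lemma first_collapse T' : T < T' -> exists Ts B be : R,
  [/\ T <= Ts < T', 0 <= be < B, stretch Ts be = 0 &
      forall t s, 0 <= t -> 0 <= s -> t < Ts -> s < B -> 0 < stretch t s].
Proof.
move=> TT'; have [K K0 HK] := stretch_lip.
have d0 : 0 < T' - T by rewrite subr_gt0.
have [t1 [t10 [b0 b00 st1]] t1T'] := inf_adherent d0 collapse_has_inf.
rewrite -/collapse_time -/T addrC subrK in t1T'.
have [t1p _ _] := stretch_le0 t10 st1.
have [B bB sB] : exists2 B, b0 < B & 0 < stretch t1 B.
  apply: contrapT => H.
  have neg B : b0 < B -> w' B <= - t1^-1.
    move=> bB; have : stretch t1 B <= 0.
      by rewrite leNgt; apply/negP => h; apply: H; exists B.
    move=> /(stretch_le0 t10)[_ _]; rewrite mulNr => h.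
    by rewrite -(ler_pM2r t1p) mulNr mulVf ?gt_eqF//; lra.
  (* Over this length a slope of [- 1 / t1] exceeds the variation [2 * K] of
     [w]. *)
  pose L := 2 * K * t1 + t1.
  have L0 : 0 < L by rewrite ltr_wpDl// mulr_ge0// mulr_ge0// ltW.
  have bL : b0 < b0 + L by rewrite ltrDl.
  have [|x] := MVT bL (df := w') (fun x _ => mom_deriv G x).
    by apply: continuous_subspaceT => x; exact: mom_cont.
  rewrite in_itv/= => /andP[bx _]; rewrite addrAC subrr add0r => E.
  have [w1 _] := HK b0; have [w2 _] := HK (b0 + L).
  have h : w' x * L <= - t1^-1 * L by rewrite ler_wpM2r ?neg// ltW.
  have E2 : - t1^-1 * L = - (2 * K + 1) by rewrite /L; field; rewrite gt_eqF.
  move: w1 w2; rewrite !ler_norml => /andP[w11 w12] /andP[w21 w22].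
  by rewrite E2 -E in h; lra.
pose Z := [set t | 0 <= t /\ exists2 s, 0 <= s <= B & stretch t s <= 0].
have Z1 : Z t1 by split => //; exists b0; rewrite ?b00 ?(ltW bB).
have hZ : has_inf Z by split; [exists t1|exists 0 => t []].
pose Ts := inf Z.
have Tst1 : Ts <= t1 by apply: ge_inf => //; case: hZ.
have TTs : T <= Ts.
  apply: lb_le_inf; first by exists t1.
  move=> t [t0 [s /andP[s0 _] st]]; apply: ge_inf; first by case: collapse_has_inf.
  by split => //; exists s.
have Ts0 : 0 < Ts by exact: lt_le_trans collapse_time_gt0 TTs.
have before t s : 0 <= t -> 0 <= s <= B -> t < Ts -> 0 < stretch t s.
  move=> t0 sB' tT; rewrite ltNge; apply/negP => H.
  have : Ts <= t by apply: ge_inf; [case: hZ|split=> //; exists s].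
  by rewrite leNgt tT.
have B0 : 0 <= B by rewrite (le_trans b00)// ltW.
have cs : {within `[0, B], continuous (stretch Ts)}.
  by apply: continuous_subspaceW (stretch_cont (ltW Ts0)).
have [be beB bmin] := EVT_min B0 cs.
have beB' : 0 <= be <= B by move: beB; rewrite in_itv.
(* If the minimum at [Ts] were positive, the stretches would stay positive
   for a while, by their uniform Lipschitz continuity in time. *)
have le0 : stretch Ts be <= 0.
  rewrite leNgt; apply/negP => m0.
  have e0 : 0 < stretch Ts be / K by rewrite divr_gt0.
  have [t [t0 [s sB' st]] tT] := inf_adherent e0 hZ.
  have Tst : Ts <= t by apply: ge_inf; [case: hZ|split=> //; exists s].
  have [_ [_ /(_ Ts t (ltW Ts0) Tst)]] := HK s.
  rewrite ler_norml => /andP[h _].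
  have := bmin s; rewrite in_itv/= => /(_ sB') h2.
  have : K * (t - Ts) < stretch Ts be.
    by rewrite mulrC -ltr_pdivlMr// ltrBlDl.
  lra.
(* If it were negative, the label would have collapsed before [Ts]. *)
have ge0 : 0 <= stretch Ts be.
  rewrite leNgt; apply/negP => m0.
  have e0 : 0 < - stretch Ts be / K by rewrite divr_gt0// oppr_gt0.
  pose t := Num.max 0 (Ts - - stretch Ts be / K).
  have t0 : 0 <= t by rewrite le_max lexx.
  have tT : t < Ts by rewrite gt_max Ts0/= ltrBlDr ltrDl.
  have pos := before t be t0 beB' tT.
  have [_ [_ /(_ t Ts t0 (ltW tT))]] := HK be.
  rewrite ler_norml => /andP[h _].
  have : K * (Ts - t) <= - stretch Ts be.
    rewrite mulrC -ler_pdivlMr// lerBlDr -lerBlDl.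
    by rewrite le_max; apply/orP; right.
  lra.
have bes : be < B.
  rewrite lt_neqAle; case/andP: beB' => _ ->; rewrite andbT.
  apply: contraTneq le0 => ->; rewrite -ltNge.
  exact: stretch_mono (ltW Ts0) Tst1 sB.
exists Ts, B, be; split.
- by rewrite TTs (le_lt_trans Tst1).
- by case/andP: beB' => -> _.
- by apply/eqP; rewrite eq_le le0 ge0.
- by move=> t s t0 s0 tT sB'; apply: before => //; rewrite s0 ltW.
Qed.

End Collapse.

(** * Blow-up *)

Section Unbounded.
Context {R : realType}.

Lemma at_left_ge0 (T : R) : 0 < T -> \forall s \near T^'-, 0 <= s < T.
Proof.
move=> T0; rewrite /at_left /prop_near1 /= /within /=.
by apply: filterS (lt_nbhsr T0) => s s0 sT; rewrite ltW.
Qed.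

Lemma cvg_at_left (f : R -> R) (T l : R) : 0 < T ->
  f @ within `[0, T] (nbhs T) --> l -> f @ T^'- --> l.
Proof.
move=> T0 cf P /cf; rewrite /at_left /= /within /= !nbhs_simpl /= => h.
apply: filterS2 h (lt_nbhsr T0) => s h s0 sT; apply: h.
by rewrite in_itv/= !ltW.
Qed.

Lemma quotient_blowup (N J : R -> R) (T : R) (e : R) : 0 < e ->
  (\forall s \near T^'-, e <= N s) -> (\forall s \near T^'-, 0 < J s) ->
  J @ T^'- --> 0 -> (fun s => N s / J s) @ T^'- --> +oo.
Proof.
move=> e0 HN HJ J0; apply/cvgryPgt => A.
have A1 : 0 < `|A| + 1 by rewrite ltr_wpDl.
near=> s.
have Ns : e <= N s by near: s.
have Js : 0 < J s by near: s.
have Jsm : J s < e / (`|A| + 1).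
  by near: s; apply: (cvgr_lt _ J0); rewrite divr_gt0.
apply: le_lt_trans (ler_norm A) _; rewrite ltr_pdivlMr//.
apply: lt_le_trans Ns; apply: le_lt_trans (_ : (`|A| + 1) * J s < _).
  by rewrite ler_wpM2r ?(ltW Js)// lerDl.
by rewrite mulrC -ltr_pdivlMr.
Unshelve. all: by end_near. Qed.

Lemma not_cvgy_bounded (f : R -> R) (T M : R) : 0 < T ->
  (forall s, 0 <= s < T -> f s <= M) -> ~ (f @ T^'- --> +oo).
Proof.
move=> T0 fM /cvgryPgt /(_ M) H.
have [s []] := @filter_ex _ (T^'-) _ _ (filterI H (at_left_ge0 T0)).
by move=> /= h /fM; rewrite leNgt h.
Qed.

Lemma not_cvgy_cvg (f : R -> R) (T l : R) : f @ T^'- --> l -> ~ (f @ T^'- --> +oo).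
Proof.
move=> fl /cvgryPgt /(_ (l + 1)) H.
have h : \forall s \near T^'-, f s < l + 1 by apply: (cvgr_lt _ fl); rewrite ltrDl.
have [s []] := @filter_ex _ (T^'-) _ _ (filterI H h).
by move=> /= h1 h2; have := lt_trans h1 h2; rewrite ltxx.
Qed.

End Unbounded.

Section BlowUp.
Context {R : realType} (G : flow R).
Implicit Types (t r s : R).
Local Notation c := (light G).
Local Notation a := (scale G).
Local Notation a' := (scale' G).
Local Notation w := (mom G).
Local Notation w' := (mom' G).
Local Notation stretch := (stretch G).
Local Notation path := (path G).
Variables (n : nat) (n0 : (0 < n)%N).
Variables (rho0 v0 : R -> R) (eps : R).
Hypothesis initial_density : forall r, 0 <= r -> eps * rho0 r = dens G r.
Hypothesis initial_velocity : forall r, 0 < r -> eps * v0 r = vel G 0 r.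

Lemma swept_back E : label_set G E -> forall u x, swept G E (u, x) -> 0 < x ->
  forall s, 0 <= s <= u -> swept G E (s, path s (lab G E u x)).
Proof.
move=> LE u x Sux _ s su; have [Es _] := labP Sux; apply: sweptP.
exact: (ls_before LE Es su).
Qed.

Lemma unique_on_swept E : label_set G E ->
  unique_classical_solution n c a a' rho0 v0 eps (swept G E).
Proof.
move=> LE; exists (erho G E n), (evel G E); split.
  exact: explicit_solution.
move=> rho1 v1 sol t r Dtr; have oS := swept_relopen LE.
have back := swept_back LE.
split.
  exact: (solution_rho n0 initial_density initial_velocity oS sol LE (fun p h => h) back Dtr).
exact: (solution_v n0 initial_density initial_velocity oS sol LE (fun p h => h) back Dtr).
Qed.

Section AtCollapse.
Variables (T Ts B be : R).
Hypothesis T0 : 0 < T.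
Hypothesis TTs : T <= Ts.
Hypothesis be0 : 0 <= be.
Hypothesis beB : be < B.
Hypothesis stretch0 : stretch Ts be = 0.
Hypothesis pos1 : forall t s, 0 <= t -> 0 <= s -> t < T -> 0 < stretch t s.
Hypothesis pos2 : forall t s, 0 <= t -> 0 <= s -> t < Ts -> s < B -> 0 < stretch t s.

Let E := notch T Ts B.
Let LE : label_set G E. Proof. exact: label_set_notch. Qed.
Let Ts0 : 0 < Ts. Proof. exact: lt_le_trans TTs. Qed.

Lemma notch_path s : 0 <= s < Ts -> E (s, be).
Proof. by move=> /andP[s0 sT]; split; [split|right]. Qed.

Lemma label_cvg (f : R -> R -> R) : cont2 halfplane f -> f s be @[s --> Ts^'-] --> f Ts be.
Proof.
move=> cf; apply: cvg_at_left => //.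
have : {within `[0, Ts], continuous (fun s => f s be)}.
  by apply: (cont_label cf) => u /andP[].
move=> /subspace_continuousP; apply.
by rewrite /= in_itv/= lexx andbT ltW.
Qed.

Lemma stretch_cvg : stretch s be @[s --> Ts^'-] --> 0.
Proof. by have [? C] := C1_stretch G; have := label_cvg (C1_cont C); rewrite stretch0. Qed.

Lemma stretch_near : \forall s \near Ts^'-, 0 < stretch s be.
Proof.
by apply: filterS (at_left_ge0 Ts0) => s /andP[s0 sT]; exact: pos2.
Qed.

(** The derivative of the velocity in the radius is [vels / stretch], and the
    numerator has a nonzero limit because [w'] is negative at a collapsing
    label. *)
Lemma gradient_collapse : (fun s => `|vels G s be / stretch s be|) @ Ts^'- --> +oo.
Proof.
have wn0 : w' be != 0.
  have le0 : stretch Ts be <= 0 by rewrite stretch0.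
  have [_ h _] := stretch_le0 (ltW Ts0) le0.
  by rewrite lt_eqF.
have [_ cvs _] := (C1_withP halfplane _ _ _).1 (C1_vel G).
have cN : `|vels G s be| @[s --> Ts^'-] --> `|vels G Ts be| by apply: cvg_norm; exact: label_cvg.
have N0 : 0 < `|vels G Ts be|.
  by rewrite normr_gt0 !mulf_neq0// ?expf_neq0 ?clock_neq0// invr_neq0// expf_neq0// gam_neq0.
have e0 : 0 < `|vels G Ts be| / 2 by rewrite divr_gt0.
have lb : \forall s \near Ts^'-, `|vels G Ts be| / 2 <= `|vels G s be|.
  have : \forall s \near Ts^'-, `|vels G Ts be| / 2 < `|vels G s be|.
    by apply: (cvgr_gt `|vels G Ts be| cN); rewrite ltr_pdivrMr// ltr_pMr// ltr1n.
  by apply: filterS => s /ltW.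
have := quotient_blowup e0 lb stretch_near stretch_cvg.
apply: cvg_trans; apply: near_eq_cvg.
apply: filterS stretch_near => s h /=.
by rewrite [RHS]normrM normfV (gtr0_norm h).
Qed.

(** The factors other than [spread] and [stretch] have a positive limit, and
    [spread] is bounded; if it tends to [0] as well, as it does when the
    centre collapses, the density only grows faster. *)
Lemma density_collapse : (fun s => rhol G n s be) @ Ts^'- --> +oo.
Proof.
pose X s := dens G be * Num.sqrt (1 + kap G be) * clock G s / (clock G s ^+ n * gam G s be).
have k0 := kap_ge0 G be.
have s0 : 0 < Num.sqrt (1 + kap G be) by rewrite sqrtr_gt0 ltr_wpDr.
have Xpos s : 0 < X s.
  have c0 := clock_gt0 G s; have g0 := gam_gt0 G s be.
  by rewrite divr_gt0 ?mulr_gt0 ?dens_gt0 ?exprn_gt0.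
have cX : X s @[s --> Ts^'-] --> X Ts.
  have cc : clock G s @[s --> Ts^'-] --> clock G Ts := label_cvg (C1_cont (C1_clock G)).
  have cg := label_cvg (C1_cont (C1_gam G)).
  apply: cvgM; first by apply: cvgM => //; exact: cvg_cst.
  apply: cvgV; first by rewrite mulf_neq0 ?gam_neq0// expf_neq0// clock_neq0.
  by apply: cvgM => //; exact: (cvg_comp _ _ cc (@exprn_continuous R n _)).
have [? CQ] := C1_spread G; have cQ := label_cvg (C1_cont CQ).
pose M := `|spread G Ts be| + 1.
have M0 : 0 < M by rewrite ltr_wpDl.
have Qle : \forall s \near Ts^'-, spread G s be < M.
  by apply: (cvgr_lt _ cQ); rewrite (le_lt_trans (ler_norm _))// ltrDl.
have Qpos : \forall s \near Ts^'-, 0 < spread G s be.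
  by apply: filterS (at_left_ge0 Ts0) => s /notch_path Es; exact: (ls_spread LE Es).
have e0 : 0 < X Ts / 2 / M ^+ n.-1 by apply: divr_gt0; [exact: divr_gt0|exact: exprn_gt0].
have lb : \forall s \near Ts^'-, X Ts / 2 / M ^+ n.-1 <= X s / spread G s be ^+ n.-1.
  have h : \forall s \near Ts^'-, X Ts / 2 < X s.
    by apply: (cvgr_gt _ cX); rewrite ltr_pdivrMr// ltr_pMr// ltr1n.
  apply: filterS3 h Qle Qpos => s h1 h2 h3.
  apply: ler_pM; [by rewrite divr_ge0// ltW|by rewrite invr_ge0 exprn_ge0// ltW|exact: ltW|].
  by rewrite lef_pV2 ?posrE ?exprn_gt0// lerXn2r ?nnegrE ?(ltW M0) ?(ltW h2) ?(ltW h3).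
have := quotient_blowup e0 lb stretch_near stretch_cvg.
apply: cvg_trans; apply: near_eq_cvg.
apply: filterS2 stretch_near Qpos => s h Q /=.
rewrite /X /rhol; field.
by rewrite !lt0r_neq0 ?exprn_gt0 ?clock_gt0 ?gam_gt0.
Qed.

Lemma collapse_is_blowup P :
  (forall p q T', joint_blowup p q T' -> P p q T') ->
  blowup_times n c a a' rho0 v0 eps P Ts.
Proof.
move=> jP; split => //.
exists (swept G E), (erho G E n), (evel G E), (evelt G E), (evelr G E), (fun s => path s be).
split.
- exact: explicit_development.
- exact: C1_evel.
- move=> t; rewrite /= in_itv/= => /andP[t0 tT].
  have Es := notch_path (introT andP (conj t0 tT)); split; first exact: sweptP.
  rewrite (evel_path LE Es) -clockE// -patht_vel.
  have := hdw_curve (C1_path G) (A := `[0, Ts[) (f := id) (g := fun=> be) (s := t) _ _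
    (@hdw_id _ _ t) (@hdw_cst _ _ be t).
  rewrite mulr1 mulr0 addr0; apply.
    by rewrite /= in_itv/= t0.
  by move=> x; rewrite /= in_itv/= => /andP[].
apply: jP; split.
  move: density_collapse; apply: cvg_trans; apply: near_eq_cvg.
  by apply: filterS (at_left_ge0 Ts0) => s /notch_path Es; rewrite (erho_path LE n Es).
move: gradient_collapse; apply: cvg_trans; apply: near_eq_cvg.
by apply: filterS (at_left_ge0 Ts0) => s /notch_path Es; rewrite (evelr_path LE Es).
Qed.

(** By uniqueness, the radial derivative of the velocity of such a solution
    would agree with the explicit one on the swept region, hence be unbounded
    along the collapsing path. It would also be continuous at the end point
    of this path. *)
Lemma no_solution_past T1 : Ts < T1 ->
  ~ exists rho v, classical_solution n c a a' rho0 v0 eps (strip T1) rho v.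
Proof.
move=> TsT1 [rho [v sol]]; have oS := swept_relopen LE.
have sub : swept G E `<=` strip T1.
  move=> [t r] /[dup] /(swept_quadrant LE)[/= t0 r0] [s [/= [_ /= h] _]].
  split => //=; rewrite t0/=; case: h => [h|[h _]]; last exact: lt_trans TsT1.
  by rewrite (lt_trans h)// (le_lt_trans TTs).
have sol' := classical_solution_sub sub sol.
have [vt [vr Cv]] := sol_v_C1 sol.
have back := swept_back LE.
have vrE s : 0 <= s < Ts -> vr s (path s be) = vels G s be / stretch s be.
  move=> /notch_path Es; rewrite -(evelr_path LE Es).
  exact: (solution_vr n0 initial_density initial_velocity oS sol' LE (fun p h => h) back
    (C1_sub sub Cv) (@sweptP R G E _ _ Es)).
have pc : path s be @[s --> Ts^'-] --> path Ts be := label_cvg (C1_cont (C1_path G)).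
have pge s : 0 <= s < Ts -> 0 <= path s be.
  by move=> /notch_path Es; exact: (path_ge0 LE Es).
have pTs : 0 <= path Ts be.
  rewrite leNgt; apply/negP => p0.
  have h : \forall s \near Ts^'-, path s be < 0 by apply: (cvgr_lt _ pc).
  have [s [/= h1 /pge]] := @filter_ex _ (Ts^'-) _ _ (filterI h (at_left_ge0 Ts0)).
  by rewrite leNgt h1.
have inS s : 0 <= s <= Ts -> strip T1 (s, path s be).
  move=> /andP[s0 sT]; split; first by rewrite /= s0 (le_lt_trans sT).
  move: sT; rewrite le_eqVlt => /orP[/eqP ->//|sT].
  by apply: pge; rewrite s0.
have cvr : {within `[0, Ts], continuous (fun s => vr s (path s be))}.
  have [_ h _] := (C1_withP (strip T1) v vt vr).1 Cv.
  by apply: (cont_along h) => //; apply: (cont_label (C1_cont (C1_path G))) => u /andP[].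
have TsI : `[0, Ts]%classic Ts by rewrite /= in_itv/= lexx andbT ltW.
move/subspace_continuousP : cvr => /(_ _ TsI) /(cvg_at_left Ts0) /cvg_norm cvr.
apply: (not_cvgy_cvg cvr).
move: gradient_collapse; apply: cvg_trans; apply: near_eq_cvg.
by apply: filterS (at_left_ge0 Ts0) => s /vrE E1 /=; rewrite -E1.
Qed.

End AtCollapse.

Hypothesis falling : exists2 s : R, 0 <= s & w' s < 0.
Let T := collapse_time G.
Let T0 : 0 < T := collapse_time_gt0 falling.
Let pos1 t s : 0 <= t -> 0 <= s -> t < T -> 0 < stretch t s.
Proof. exact: before_collapse. Qed.

Let E := notch T T 0.
Let LE : label_set G E.
Proof.
apply: label_set_notch => // t s _ s0 _; rewrite ltNge s0//.
Qed.

Lemma strip_unique : unique_classical_solution n c a a' rho0 v0 eps (strip T).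
Proof. by rewrite -(swept_strip LE); exact: unique_on_swept. Qed.

Lemma no_later_solution T1 : T < T1 ->
  ~ exists rho v, classical_solution n c a a' rho0 v0 eps (strip T1) rho v.
Proof.
move=> /(first_collapse falling)[Ts [B [be [/andP[h1 h2] /andP[h3 h4] h5 h6]]]].
exact: (no_solution_past T0 h1 h3 h4 h5 pos1 h6 h2).
Qed.

Lemma label_bound T1 s (f : R -> R -> R) : 0 < T1 -> T1 < T -> 0 <= s -> cont2 E f ->
  exists M : R, forall t, 0 <= t < T1 -> f t s <= M.
Proof.
move=> T10 T1T s0 cf.
have Es t : 0 <= t <= T1 -> E (t, s).
  by move=> /andP[t0 tT]; apply/notch_strip; rewrite t0 (le_lt_trans tT).
have cs := cont_label cf Es.
have [x _ xmax] := EVT_max (ltW T10) cs.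
by exists (f x s) => t /andP[t0 tT]; apply: xmax; rewrite in_itv/= t0 ltW.
Qed.

(** Before the collapse time every development agrees with the explicit
    solution and its particles follow explicit paths. Along these the density
    and the gradient are continuous on compact time intervals, hence bounded. *)
Lemma blowup_after P T1 :
  (forall p q, P p q T1 -> density_blowup p q T1 \/ gradient_blowup p q T1) ->
  blowup_times n c a a' rho0 v0 eps P T1 -> T <= T1.
Proof.
move=> PT [T10 [D [rho [v [vt [vr [g [dev Cv traj Ppq]]]]]]]].
rewrite leNgt; apply/negP => T1T.
have full t r : swept G E (t, r) -> forall s, 0 <= s -> E (t, s).
  by move=> [x [/= /notch_strip[h _] _]] s s0; apply/notch_strip.
have [_ _ sol _] := dev; have oD := development_relopen dev.
have inS s : 0 <= s < T1 -> D (s, g s) /\ swept G E (s, g s).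
  move=> sT; have [Ds _] := traj s ltac:(by rewrite /= in_itv).
  split => //; rewrite (swept_strip LE); have [_ g0] := oD.1 _ Ds.
  by case/andP: sT => s0 sT; split => //=; rewrite s0 (lt_trans sT).
have al0 : 0 <= g 0.
  have [D0 _] := inS 0 ltac:(by rewrite lexx).
  by have [] := oD.1 _ D0.
(* Off the centre the trajectory is the path of its label; the centre is the
   path of the label [0]. *)
have gE s : 0 <= s < T1 -> g s = path s (g 0) \/ g s = path s 0.
  move=> sT; have [Ds _] := inS s sT; have [_ /= gs0] := oD.1 _ Ds.
  move: gs0; rewrite le_eqVlt => /orP[/eqP gs|gs]; first by right; rewrite path_at0.
  have /andP[s0 s1] := sT.
  have tr : trajectory a v D `[0, s] g.
    move=> u; rewrite /= in_itv/= => /andP[u0 us].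
    have [|h1 h2] := traj u; first by rewrite /= in_itv/= u0 (le_lt_trans us).
    split => //; apply: hdw_sub h2 => y; rewrite /= !in_itv/= => /andP[-> /=] ys.
    exact: le_lt_trans ys s1.
  left; apply: (trajectory_path n0 initial_density initial_velocity oD sol s0 tr gs).
  by rewrite s0 lexx.
have Es s x : 0 <= s < T1 -> 0 <= x -> E (s, x).
  by move=> /andP[s0 sT] x0; apply/notch_strip; rewrite s0 (lt_trans sT).
have bound (f F : R -> R -> R) : cont2 E F ->
    (forall t x, E (t, x) -> f t (path t x) = F t x) ->
    exists M : R, forall s, 0 <= s < T1 -> f s (g s) <= M.
  move=> cF fF; have [M1 HM1] := label_bound T10 T1T al0 cF.
  have [M2 HM2] := label_bound T10 T1T (lexx 0) cF.
  exists (Num.max M1 M2) => s sT; rewrite le_max.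
  have [->|->] := gE s sT; rewrite fF; first by rewrite HM1.
  - exact: Es.
  - by rewrite HM2 ?orbT.
  - exact: Es.
have EH : E `<=` halfplane by move=> [t s] [[]].
have [rt [rr Cr]] : C1_on E (rhol G n).
  by apply: C1_rhol EH _ => t s Ets; split; [exact: (ls_spread LE Ets)|exact: (ls_stretch LE Ets)].
have [Mr HMr] := bound (erho G E n) (rhol G n) (C1_cont Cr) (fun t x h => erho_path LE n h).
have cg : cont2 E (fun t s => `|vels G t s / stretch t s|).
  have [_ cvs _] := (C1_withP E _ _ _).1 (C1_sub EH (C1_vel G)).
  have [? CJ] := C1_stretch G; have cJ := C1_cont (C1_sub EH CJ).
  move=> p Ep; apply: cvg_norm; apply: cvgM; first exact: cvs.
  apply: cvgV; last exact: cJ.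
  by rewrite lt0r_neq0//; apply: (ls_stretch LE); rewrite -surjective_pairing.
have [Mv HMv] := bound (fun t r => `|evelr G E t r|) _ cg
  (fun t x h => congr1 Num.norm (evelr_path LE h)).
have [db|gb] := PT _ _ Ppq.
  apply: (not_cvgy_bounded T10 _ db (M := Mr)) => s sT.
  have [Ds Ss] := inS s sT.
  by have [-> _] := development_agree n0 initial_density initial_velocity dev LE full Ds Ss; exact: HMr.
apply: (not_cvgy_bounded T10 _ gb (M := Mv)) => s sT.
have [Ds Ss] := inS s sT.
have [_ /(_ vt vr Cv) ->] := development_agree n0 initial_density initial_velocity dev LE full Ds Ss.
exact: HMv.
Qed.

(** Blow-up never occurs before [T] and does occur at times arbitrarily close
    to [T] from above, for the density and the gradient together; so the
    three notions of blow-up have the same time. *)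
Lemma blowup_time P :
  (forall p q T', joint_blowup p q T' -> P p q T') ->
  (forall p q T', P p q T' -> density_blowup p q T' \/ gradient_blowup p q T') ->
  is_blowup_time n c a a' rho0 v0 eps P T.
Proof.
move=> jP Pdg.
have lb : lbound (blowup_times n c a a' rho0 v0 eps P) T.
  by move=> T1; apply: blowup_after => p q; exact: Pdg.
have near_T (e : R) : 0 < e -> exists2 Ts, blowup_times n c a a' rho0 v0 eps P Ts & Ts < T + e.
  move=> e0; have Te : T < T + e by rewrite ltrDl.
  have [Ts [B [be [/andP[h1 h2] /andP[h3 h4] h5 h6]]]] := first_collapse falling Te.
  by exists Ts => //; exact: (collapse_is_blowup T0 h1 h3 h4 h5 pos1 h6 jP).
have hi : has_inf (blowup_times n c a a' rho0 v0 eps P).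
  by split; [have [Ts h _] := near_T _ ltr01; exists Ts|exists T].
split => //; apply/eqP; rewrite eq_le; apply/andP; split.
  apply/ler_addgt0Pr => e e0; have [Ts h hT] := near_T e e0.
  by apply: le_trans (ltW hT); apply: ge_inf => //; case: hi.
by apply: lb_le_inf => //; case: hi.
Qed.

End BlowUp.

(** * Global existence and blow-up *)

Section ScaleFactor.
Context {R : realType} (a a' a'' : R -> R).
Hypothesis ha : scale_factor a a' a''.
Hypothesis hH : assumption_H3 a a' a'' \/ assumption_H4 a.

Lemma scale_factor_ge1 t : 0 <= t -> 1 <= a t.
Proof.
move=> t0; have [_ a0 da _] := ha.
case: hH => [[pos _]|H4]; last by rewrite H4.
have sub (s : R) : `[0, t]%classic s -> 0 <= s by rewrite /= in_itv/= => /andP[].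
have dat (s : R) : `[0, t]%classic s -> has_deriv_within `[0, t] a s (a' s).
  by move=> /sub s0; apply: hdw_sub (da s s0); exact: segment_sub.
have [s|s] := MVT_segment t0 (df := a') _ (hdw_within dat).
  move=> sI; apply: (hdw_itv_derive sI); apply: dat.
  by move: sI; rewrite /= !in_itv/= => /andP[h1 h2]; rewrite !ltW.
rewrite in_itv/= => /andP[s0 _]; rewrite a0 subr0 => E.
by rewrite -subr_ge0 E mulr_ge0// ltW//; have [] := pos s s0.
Qed.

(** For [l <= 1/2] the square of [a] grows at most linearly, which is the
    borderline for the divergence of the integral of [1 / a ^ 2]. *)
Lemma scale_factor_growth : exists2 C : R, 0 < C &
  forall t, 0 <= t -> a t ^+ 2 <= C * (1 + t).
Proof.
have [apos _ _ _] := ha.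
case: hH => [[_ [l [l0 l1 [C C0 HC]]]]|H4]; last first.
  by exists 1 => // t t0; rewrite H4// expr1n mul1r lerDl.
exists (C ^+ 2) => [|t t0]; first by rewrite exprn_gt0.
have [_ h] := HC t t0; have at0 := apos t t0.
have t1 : 1 <= 1 + t by rewrite lerDl.
have p0 : 0 <= (1 + t) `^ l by exact: powR_ge0.
apply: le_trans (_ : (C * (1 + t) `^ l) ^+ 2 <= _).
  by rewrite lerXn2r ?nnegrE ?mulr_ge0 ?(ltW at0) ?(ltW C0).
rewrite exprMn ler_wpM2l ?sqr_ge0//.
rewrite -powR_mulrn// -powRrM -[leRHS]powRr1 ?(le_trans ler01)//.
by rewrite ler_powR//; lra.
Qed.

End ScaleFactor.

Theorem theorem1p4 (R : realType) (n : nat) (hn : (1 <= n)%N)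
    (c : R) (hc : 0 < c)
    (a a' a'' : R -> R) (ha : scale_factor a a' a'')
    (hH : assumption_H3 a a' a'' \/ assumption_H4 a)
    (rho0 v0 : R -> R)
    (hrho0 : bounded_Ck 1 (fun x : 'rV[R]_n => radial_scalar rho0 x))
    (hv0 : forall i : 'I_n,
       bounded_Ck 2 (fun x : 'rV[R]_n => radial_vector v0 i x))
    (hpos : forall r : R, 0 <= r -> 0 < rho0 r) :
  exists2 eps0 : R, 0 < eps0 &
  forall eps : R, 0 < eps -> eps < eps0 ->
    ((forall alpha : R, 0 < alpha -> 0 <= derive1 v0 alpha) ->
       unique_classical_solution n c a a' rho0 v0 eps quadrant)
    /\
    ((exists2 alpha : R, 0 < alpha & derive1 v0 alpha < 0) ->
       exists T : R,
         [/\ 0 < T,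
             unique_classical_solution n c a a' rho0 v0 eps (strip T),
             forall T1 : R, T < T1 ->
               ~ exists rho v : R -> R -> R,
                   classical_solution n c a a' rho0 v0 eps (strip T1) rho v &
             [/\ is_blowup_time n c a a' rho0 v0 eps density_blowup T,
                 is_blowup_time n c a a' rho0 v0 eps gradient_blowup T &
                 is_blowup_time n c a a' rho0 v0 eps joint_blowup T]]).
Proof.
have [k1 [dk ck1]] := scalar_profile hn hrho0.
have [h [h1 [h2 [dh dh1 ch2 [h_odd hv] [M HM]]]]] := vector_profile hn hv0.
have M0 : 0 <= M by have [h0 _] := HM 0; exact: le_trans h0.
(* [M] bounds the velocity profile; then [eps * M < c] keeps the initial
   velocities away from [c]. *)
exists (c / (M + 1)) => [|eps eps0 epsM]; first by rewrite divr_gt0// ltr_wpDl.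
have epsMc : eps * M < c.
  move: epsM; rewrite ltr_pdivlMr ?ltr_wpDl// => epsM.
  by apply: le_lt_trans epsM; rewrite ler_wpM2l ?(ltW eps0)// lerDl.
have [w [w1 [w2 [wE dw dw1 sign [K HK]]]]] :=
  momentum_profile hc eps0 M0 epsMc dh dh1 ch2 HM.
have [apos a0 da da'] := ha.
have mom_odd s : w (- s) = - w s.
  by rewrite !wE h_odd mulrN /momentum /lorentz !mulNr sqrrN.
have dd (s : R) : is_derive s 1 (fun s => eps * rho0 `|s|) (eps * k1 s).
  by apply: (is_derive_eq (derM (derC eps s) (dk s))); rewrite mul0r add0r.
have cd : continuous (fun s => eps * k1 s).
  by move=> s; apply: cvgM; [exact: cvg_cst|exact: ck1].
have dens_pos (s : R) : 0 < eps * rho0 `|s| by rewrite mulr_gt0// hpos.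
have dens_ev (s : R) : eps * rho0 `|- s| = eps * rho0 `|s| by rewrite normrN.
have ca' : {within `[0, +oo[, continuous a'}.
  by apply: (hdw_within (df := a'')) => s; rewrite /= in_itv/= andbT; exact: da'.
pose G := @Flow R c a a' w w1 w2 (fun s => eps * rho0 `|s|) (fun s => eps * k1 s)
  hc a0 (@scale_factor_ge1 R a a' a'' ha hH) da ca' (@scale_factor_growth R a a' a'' ha hH)
  dw (fun s => (dw1 s).1) (fun s => (dw1 s).2) mom_odd (ex_intro _ K HK) dd cd dens_ev dens_pos.
have init_rho r : 0 <= r -> eps * rho0 r = dens G r.
  by move=> r0; rewrite /= ger0_norm.
have small s : `|eps * h s| < c.
  apply: le_lt_trans epsMc; rewrite normrM (gtr0_norm eps0) ler_wpM2l ?(ltW eps0)//.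
  by have [] := HM s.
have init_v r : 0 < r -> eps * v0 r = vel G 0 r.
  move=> r0; rewrite vel0 /kap /= wE -(hv r r0).
  by have [_] := velocity_of_momentum hc (small r).
have dv0 (s : R) : 0 < s -> derive1 v0 s = h1 s.
  move=> s0; rewrite derive1E; apply: derive_val.
  apply: near_eq_is_derive (dh s).
  by apply: filterS (lt_nbhsr s0) => u u0; rewrite hv.
split=> [rising|[al al0 fall]].
  have w1_ge0 s : 0 < s -> 0 <= w1 s.
    move=> s0; have [k k0 ->] := sign s.
    by rewrite mulr_ge0 ?(ltW k0)// -dv0// rising.
  (* The sign is given at positive labels, and extends to the centre by
     continuity. *)
  have w10 : 0 <= w1 0.
    rewrite leNgt; apply/negP => w0.
    have : \forall s \near (0 : R), w1 s < 0.
      have cw : w1 s @[s --> (0 : R)] --> w1 0 := der_cont (dw1 0).1.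
      exact: (cvgr_lt (w1 0) cw 0 w0).
    move=> /nbhs_ballP[d /= d0 hd].
    have d2 : 0 < d / 2 by rewrite divr_gt0.
    have : w1 (d / 2) < 0.
      apply: hd; rewrite /ball/= sub0r normrN gtr0_norm//.
      by rewrite ltr_pdivrMr// ltr_pMr// ltr1n.
    by rewrite ltNge w1_ge0.
  have LE : label_set G quadrant.
    apply: label_set_quadrant => t s t0 s0; rewrite stretchE.
    rewrite ltr_pwDl// mulr_ge0 ?squeeze_ge0//=.
    by move: s0; rewrite le_eqVlt => /orP[/eqP <-//|/w1_ge0].
  rewrite -(swept_quadrantE LE); exact: (unique_on_swept hn init_rho init_v LE).
have falling : exists2 s : R, 0 <= s & mom' G s < 0.
  exists al; first exact: ltW.
  have [k k0 /= ->] := sign al.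
  by rewrite pmulr_rlt0// -dv0.
exists (collapse_time G); split.
- exact: collapse_time_gt0.
- exact: (strip_unique hn init_rho init_v falling).
- exact: (no_later_solution hn init_rho init_v falling).
split; apply: (blowup_time hn init_rho init_v falling).
- by move=> p q T [].
- by move=> p q T; left.
- by move=> p q T [].
- by move=> p q T; right.
- by [].
- by move=> p q T [db _]; left.
Qed.
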